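(* Let $S\subseteq\mathbb{N}$ be a set of positive integers such that $|S\cap[1,n]|=o(n/\log n)$ as $n\to\infty$. Let $K\subset\mathbb{C}$ be a number field and let $f(z)=\sum_{n\ge 0}a_nz^n\in K[[z]]$ be such that for every field embedding $\sigma:K\to\mathbb{C}$ the series $\sigma(f):=\sum_{n\ge0}\sigma(a_n)z^n$ converges in the open unit disk. Suppose that for every $\beta>1$ we have $$\operatorname{lcm}\{\operatorname{den}(a_k):\ k\le n,\ k\notin S\}<\beta^n$$ for every sufficiently large integer $n$, and suppose moreover that $\operatorname{den}(a_n)=e^{o(n)}$ for $n\in S$ as $n\to\infty$. Then either $f(z)$ admits the unit circle as a natural boundary, or $f(z)$ is a rational function all of whose poles are roots of unity.
   Context: $\mathbb{N}$ denotes the set of positive integers. For an algebraic number $\alpha$, $\operatorname{den}(\alpha)$ is the smallest positive integer $d$ such that $d\alpha$ is an algebraic integer. The number field $K$ is regarded as a subfield of $\mathbb{C}$, so $f$ defines an analytic function on the open unit disk; ''admits the unit circle as a natural boundary'' means $f$ cannot be analytically continued to a neighborhood of any point of the unit circle. *)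

(* Defs.v *)
From HB Require Import structures.
From mathcomp Require Import all_boot all_order all_algebra all_field.
From mathcomp Require Import complex.
From mathcomp Require Import all_classical all_reals all_analysis.

Set Implicit Arguments.
Unset Strict Implicit.
Unset Printing Implicit Defensive.

Import Order.TTheory GRing.Theory Num.Theory.
Import numFieldNormedType.Exports.

Local Open Scope classical_set_scope.
Local Open Scope ring_scope.

(* [K : fieldExtType rat] is a number field; an element of [K] is algebraic
   over the rationals, so [den] is total. *)
Section Denominator.
Variable K : fieldExtType rat.
Implicit Type x : K.

Definition algebraic_integer x : Prop := integralOver (intr : int -> K) x.

Let intrK_eq0 (z : int) : (z%:~R == 0 :> K) = (z == 0).
Proof. by rewrite -(rmorph_int (in_alg K)) fmorph_eq0 intr_eq0. Qed.

Lemma den_subproof x :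
  exists d : nat, (0 < d)%N && `[< algebraic_integer (d%:R * x) >].
Proof.
have /polyOver1P[r Dr] : minPoly 1%AS x \is a polyOver 1%VS by exact: minPolyOver.
have rx : root (map_poly (in_alg K) r) x by rewrite -Dr root_minPoly.
have r_neq0 : r != 0.
  by rewrite -(map_poly_eq0 (in_alg K)) -Dr monic_neq0 // monic_minPoly.
have [q [a a_neq0 Dq]] := rat_poly_scale r.
pose qK : {poly K} := map_poly intr q.
have q_neq0 : q != 0.
  by apply: contra_neq r_neq0 => q0; rewrite Dq q0 rmorph0 scaler0.
have qx : qK.[x] = 0.
  move: rx; rewrite Dq map_polyZ rootE hornerZ mulf_eq0 fmorph_eq0 invr_eq0.
  rewrite intr_eq0 (negPf a_neq0) /= => /eqP <-.
  by congr (_.[x]); apply/polyP => i; rewrite !coef_map /= scaler_int.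
pose c := lead_coef q; pose n := (size q).-1.
have szq : size q = n.+1 by rewrite polySpred.
have Dc : c = q`_n by [].
have cI : algebraic_integer (c%:~R * x).
  have n_gt0 : (0 < n)%N.
    rewrite lt0n; apply: contra_neq q_neq0 => n0.
    have /size_poly1P[b b0 Db] : size q == 1%N by rewrite szq n0.
    move: qx; rewrite /qK Db map_polyC hornerC => /eqP.
    by rewrite intrK_eq0 (negPf b0).
  pose m := \poly_(i < n.+1) (if i == n then 1 else q`_i * c ^+ (n.-1 - i)).
  exists m.
    rewrite monicE lead_coefE.
    have -> : size m = n.+1 by rewrite size_poly_eq // eqxx oner_eq0.
    by rewrite coef_poly /= ltnSn eqxx.
  have -> : map_poly intr m = \poly_(i < n.+1) (m`_i)%:~R :> {poly K}.
    apply/polyP => i; rewrite coef_map [RHS]coef_poly; case: ltnP => //= le_n_i.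
    by rewrite nth_default // (leq_trans (size_poly _ _)).
  rewrite rootE horner_poly; apply/eqP.
  transitivity (c%:~R ^+ n.-1 * qK.[x]); last by rewrite qx mulr0.
  rewrite (@horner_coef_wide _ n.+1); last first.
    by rewrite size_map_poly_id0 ?szq // intrK_eq0 -/c lead_coef_eq0.
  rewrite mulr_sumr; apply: eq_bigr => [[i lt_i]] _ /=.
  rewrite coef_poly lt_i coef_map /= exprMn.
  have [-> | ne_i] := eqVneq i n.
    by rewrite -Dc mul1r -{1}(prednK n_gt0) exprSr !mulrA.
  have le_i : (i <= n.-1)%N by rewrite -ltnS prednK // ltn_neqAle ne_i -ltnS.
  rewrite rmorphM rmorphXn /= -{2}(subnK le_i) exprD.
  by rewrite -(mulrC (c%:~R ^+ (n.-1 - i))) mulrACA.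
exists `|c|%N; apply/andP; split.
  by rewrite absz_gt0 lead_coef_eq0.
apply/asboolP; have [c_ge0|/ltW c_le0] := leP 0 c.
  by move: cI; rewrite -{1}(gez0_abs c_ge0).
have -> : `|c|%N%:R * x = - (c%:~R * x).
  by rewrite -{2}[c]opprK -(lez0_abs c_le0) rmorphN mulNr opprK.
exact: (@integral_opp int K intr).
Qed.

Definition den x : nat := ex_minn (den_subproof x).

End Denominator.

(* Seeing [R[i]] as a [numClosedFieldType] gives it the topology of its norm. *)
Definition CC (R : realType) : numClosedFieldType := R[i].

Section PowerSeries.
Variable R : realType.
Local Notation C := (CC R).
Implicit Types (a : nat -> C) (g : C -> C) (z w : C).

(* [mathcomp.analysis.exp.pseries] is restricted to real arguments. *)
Definition cpseries a z : nat -> C := series (fun n => a n * z ^+ n).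

Definition analytic_at g w : Prop :=
  exists c : nat -> C,
    \forall z \near w, cpseries c (z - w) n @[n --> \oo] --> g z.

Definition continues_analytically_at a w : Prop :=
  exists (U : set C) (g : C -> C),
    [/\ open U, U w, forall z, U z -> analytic_at g z &
        forall z, U z -> `|z| < 1 -> cpseries a z n @[n --> \oo] --> g z].

Definition unit_circle_natural_boundary a : Prop :=
  forall w : C, `|w| = 1 -> ~ continues_analytically_at a w.

Definition root_of_unity w : Prop :=
  exists2 n : nat, (0 < n)%N & n.-unity_root w.

(* As [p / q] is in lowest terms, its poles in the complex plane are the roots
   of [q]; in particular [q] has no root in the open unit disk. *)
Definition rational_with_root_of_unity_poles a : Prop :=
  exists p q : {poly C},
    [/\ q != 0, coprimep p q, forall w, root q w -> root_of_unity w &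
        forall z, `|z| < 1 -> cpseries a z n @[n --> \oo] --> p.[z] / q.[z]].

End PowerSeries.

(* Main.v *)
(* If [f] continues across a point of the unit circle, then so does each weighted
   series [\sum_k a_k (\prod_(s < n, s in S) (k - s)) z ^ k]. Composing with a
   polynomial [phi] that fixes 0, has [phi'(0) > 1], and maps the disk into the
   domain of [f] makes the [m x m] Hankel determinants of these series of size
   [phi'(0) ^ - (m (m - 1))] up to [e ^ o(m ^ 2)]. The weight kills the
   coefficients with index in [S], so the norms of the determinants are too small
   unless the determinants vanish for [n / 16 <= m <= n / 2]: the weighted series
   agree to high order with rational functions of small degree. Letting [n] grow,
   these approximants fit together and one weighted series is exactly rational.
   Its recurrence bounds the denominators of the [a_k] with [k] in [S], and the
   same argument with [S] empty then shows that [f] itself is rational.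
   Fatou's lemma applied to the norm of the denominator of [f], whose conjugates
   have no root in the open disk, gives an integer polynomial with constant term
   [+-1]; by Kronecker's theorem its roots are roots of unity. *)
Require Import Defs.
From HB Require Import structures.
From mathcomp Require Import all_boot all_order all_fingroup all_algebra all_solvable all_field.
From mathcomp Require Import complex.
From mathcomp Require Import all_classical all_reals all_analysis.
From mathcomp Require Import ring lra zify.

Set Implicit Arguments.
Unset Strict Implicit.
Unset Printing Implicit Defensive.

Import Order.TTheory GRing.Theory Num.Theory.
Import numFieldNormedType.Exports.

Local Open Scope classical_set_scope.
Local Open Scope ring_scope.

(** The obstacle is that no common denominator of all coefficients up to [n] is available at first:
    each denominator at an index of [S] is [e ^ o(n)], but nothing bounds their lcm. The weight
    removes them at a cost of at most [n ^ count_below S n], which is [e ^ o(n)] because [S] has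
    [o(n / log n)] elements up to [n]. One denominator from [S] at a time remains affordable, so a
    weight may leave out a single index [k] of [S]; this variant is what reaches [a_k]. In a
    determinant of order [m] each subexponential cost enters to a power proportional to [m]. With
    [m] comparable to [n], the total [e ^ o(m n)] loses against [kappa ^ (m (m - 1))],
    [kappa = phi'(0)], however close to 1 [kappa] is. The limit [m <= n / 2] keeps all Hankel
    indices below [n], where the weight vanishes on the chosen indices and the denominators are
    controlled. The weights depend on [n], so the approximants belong to different series. They can
    be compared because one more factor of the weight is a first-order differential operator, which
    at most doubles degrees. *)

Definition partial_sum (F : nzRingType) M (a : nat -> F) : {poly F} := \poly_(i < M) a i.

Lemma sum_ord_extend (V : nmodType) (P : pred nat) (g : nat -> V) n m :
  (n <= m)%N -> (forall i, (n <= i)%N -> g i = 0) ->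
  \sum_(i < n | P i) g i = \sum_(i < m | P i) g i.
Proof.
move=> le_nm g0; rewrite (big_ord_widen_cond m P g) // [RHS](bigID (fun i : 'I_m => (i < n)%N)) /=.
rewrite [X in _ = _ + X]big1 ?addr0 // => i /andP[_].
by rewrite -leqNgt => /g0.
Qed.

(** * The complex modulus as a real number *)

Section Modulus.
Variable R : realType.
Local Notation C := (CC R).
Implicit Types z w : C.

Definition rc (x : R) : C := x%:C%C.

Fact rc_is_zmod_morphism : zmod_morphism rc.
Proof. by move=> x y; apply: (rmorphB (@real_complex R)). Qed.

Fact rc_is_monoid_morphism : monoid_morphism rc.
Proof.
split; first exact: (rmorph1 (@real_complex R)).
by move=> x y; apply: (rmorphM (@real_complex R)).
Qed.

HB.instance Definition _ := GRing.isZmodMorphism.Build R C rc rc_is_zmod_morphism.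
HB.instance Definition _ :=
  GRing.isMonoidMorphism.Build R C rc rc_is_monoid_morphism.

Lemma ler_rc x y : (rc x <= rc y) = (x <= y).
Proof. exact: lecR. Qed.

Lemma ltr_rc x y : (rc x < rc y) = (x < y).
Proof. exact: ltcR. Qed.

Lemma conj_rc x : (rc x)^* = rc x.
Proof. by apply: conj_Creal; rewrite realE -(rmorph0 rc) !ler_rc -realE num_real. Qed.

(** The norm of [CC R] takes its values in [CC R]. A modulus with values in [R] gives access to a
    total order, and so to [lra] and [nra]. *)
Definition cabs z : R := complex.Re `|z|.

Lemma cabsE z : `|z| = rc (cabs z).
Proof. by rewrite /rc /cabs; case: z => x y; rewrite normc_def. Qed.

Lemma ler_cabs z (x : R) : (`|z| <= rc x) = (cabs z <= x).
Proof. by rewrite cabsE ler_rc. Qed.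

Lemma ltr_cabs z (x : R) : (`|z| < rc x) = (cabs z < x).
Proof. by rewrite cabsE ltr_rc. Qed.

Lemma cabs_ge0 z : 0 <= cabs z.
Proof. by rewrite -ler_rc -cabsE normr_ge0. Qed.

Lemma cabsM z w : cabs (z * w) = cabs z * cabs w.
Proof. by apply: (fmorph_inj rc); rewrite /= -cabsE normrM !cabsE -(rmorphM rc). Qed.

Lemma ler_cabsD z w : cabs (z + w) <= cabs z + cabs w.
Proof. by rewrite -ler_rc (rmorphD rc) /= -!cabsE ler_normD. Qed.

Lemma cabs_rc (x : R) : cabs (rc x) = `|x|.
Proof. by rewrite /cabs normc_def /= expr0n addr0 sqrtr_sqr. Qed.

Lemma cabs_rc_ge0 (x : R) : 0 <= x -> cabs (rc x) = x.
Proof. by move=> x0; rewrite cabs_rc ger0_norm. Qed.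

Lemma cabs0 : cabs 0 = 0.
Proof. by rewrite -(cabs_rc_ge0 (lexx 0)). Qed.

Lemma cabs1 : cabs 1 = 1.
Proof. by rewrite /cabs normr1. Qed.

Lemma cabs_eq0 z : (cabs z == 0) = (z == 0).
Proof. by rewrite -(inj_eq (fmorph_inj rc)) /= -cabsE normr_eq0. Qed.

Lemma cabsN z : cabs (- z) = cabs z.
Proof. by rewrite /cabs normrN. Qed.

Lemma cabsX z n : cabs (z ^+ n) = cabs z ^+ n.
Proof. by elim: n => [|n IH]; rewrite ?expr0 ?cabs1 // !exprS cabsM IH. Qed.

Lemma cabsV z : cabs z^-1 = (cabs z)^-1.
Proof. by apply: (fmorph_inj rc); rewrite /= -cabsE normfV cabsE -(fmorphV rc). Qed.

Lemma cabs_nat n : cabs (n%:R) = n%:R.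
Proof. by rewrite -(rmorph_nat rc) cabs_rc_ge0 ?ler0n. Qed.

Lemma ler_cabs_sum (I : Type) (r : seq I) (P : pred I) (F : I -> C) :
  cabs (\sum_(i <- r | P i) F i) <= \sum_(i <- r | P i) cabs (F i).
Proof.
elim/big_rec2: _ => [|i y x _ le_xy]; first by rewrite cabs0.
by apply: le_trans (ler_cabsD _ _) _; rewrite lerD2l.
Qed.

Lemma cabs_prod (I : Type) (r : seq I) (P : pred I) (F : I -> C) :
  cabs (\prod_(i <- r | P i) F i) = \prod_(i <- r | P i) cabs (F i).
Proof. exact: (big_morph _ cabsM cabs1). Qed.

Lemma ler_cabsB z w : cabs (z - w) <= cabs z + cabs w.
Proof. by rewrite -(cabsN w) ler_cabsD. Qed.

Lemma cabs_distC z w : cabs (z - w) = cabs (w - z).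
Proof. by rewrite -cabsN opprB. Qed.

Lemma norm1_cabs z : (`|z| == 1) = (cabs z == 1).
Proof. by rewrite cabsE -(rmorph1 rc) (inj_eq (fmorph_inj rc)). Qed.

Lemma expr_eventually_le (q e : R) : 0 <= q -> q < 1 -> 0 < e ->
  exists n, forall m, (n <= m)%N -> q ^+ m <= e.
Proof.
move=> q0 q1 e0; have q1' : `|q| < 1 by rewrite ger0_norm.
have [N _ HN] : \forall n \near \oo, `|q ^+ n| <= e.
  by move/cvgr0_norm_le: (cvg_expr q1'); apply.
exists N => m Nm; have := HN m Nm.
by rewrite /= ger0_norm // exprn_ge0.
Qed.

End Modulus.

(** * Padé approximants and rational functions *)

Section Pade.
Variable F : fieldType.
Implicit Types (p q g : {poly F}) (a b r : nat -> F).

Lemma coef_partial_sum M a i : (partial_sum M a)`_i = if (i < M)%N then a i else 0.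
Proof. exact: coef_poly. Qed.

Lemma dvdXnP M g : reflect (forall i, (i < M)%N -> g`_i = 0) ('X^M %| g).
Proof.
apply: (iffP idP) => [/dvdpP[h ->] i lt_iM | g0].
  by rewrite coefMXn lt_iM.
rewrite -(poly_take_drop M g).
have -> : take_poly M g = 0.
  by apply/polyP => i; rewrite coef_take_poly coef0; case: ifP => // /g0.
by rewrite add0r dvdp_mull.
Qed.

Lemma dvdXn_size_eq0 M g : (size g <= M)%N -> 'X^M %| g -> g = 0.
Proof.
move=> szg /dvdXnP g0; apply/polyP => i; rewrite coef0.
by case: (ltnP i M) => [/g0 //|le_Mi]; rewrite nth_default // (leq_trans szg).
Qed.

Lemma dvdXn_le M M' g : (M <= M')%N -> 'X^M' %| g -> 'X^M %| g.
Proof. by move=> le_MM'; apply: dvdp_trans; rewrite dvdp_exp2l. Qed.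

Lemma size_mul_le p q m n k : (size p <= m)%N -> (size q <= n)%N ->
  ((m + n).-1 <= k)%N -> (size (p * q)%R <= k)%N.
Proof.
move=> szp szq; apply: leq_trans; apply: leq_trans (size_polyMleq _ _) _.
by rewrite -!subn1 leq_sub2r // leq_add.
Qed.

Lemma size_sub_le p q k : (size p <= k)%N -> (size q <= k)%N ->
  (size (p - q)%R <= k)%N.
Proof.
move=> szp szq; apply: leq_trans (size_polyD _ _) _.
by rewrite size_polyN geq_max szp.
Qed.

Lemma coprimeXn M q : q`_0 != 0 -> coprimep 'X^M q.
Proof.
move=> q0; rewrite coprimep_expl // coprimep_sym -['X]subr0 -polyC0 coprimep_XsubC.
by rewrite rootE horner_coef0.
Qed.

Lemma poly_Xn_factor q : q != 0 -> exists v h,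
  [/\ q = h * 'X^v, h`_0 != 0 & size q = (size h + v)%N].
Proof.
move=> q0; have [v [h]] := multiplicity_XsubC q 0; rewrite q0 /= => h0 qE.
rewrite polyC0 subr0 in qE; exists v, h; split => //.
  by rewrite -horner_coef0; apply: contra h0 => /eqP; rewrite rootE => ->.
have hn0 : h != 0 by apply: contraNneq q0 => hz; rewrite qE hz mul0r.
by rewrite qE (size_mulXn _ hn0) addnC.
Qed.

(** A nonzero polynomial of size at most [k.+1] has [X]-adic valuation at most [k], so cancelling it
    costs at most [k] orders. *)
Lemma dvdXn_mull_cancel q g k n : q != 0 -> (size q <= k.+1)%N ->
  'X^(k + n) %| q * g -> 'X^n %| g.
Proof.
move=> /poly_Xn_factor[v [h [-> h0 ->]]] le_sz.
have szh : (0 < size h)%N.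
  by rewrite size_poly_gt0; apply: contraNneq h0 => ->; rewrite coef0.
have le_vk : (v <= k)%N by lia.
have -> : (k + n = v + (k - v + n))%N by lia.
have -> : h * 'X^v * g = 'X^v * (h * g) by ring.
rewrite exprD dvdp_mul2l ?monic_neq0 ?monicXn //.
rewrite Gauss_dvdpr; last exact: coprimeXn.
by apply: dvdXn_le; rewrite leq_addl.
Qed.

(* [p / q] agrees with the series [a] up to order [M]; no degree bound is built in. *)
Definition pade q p a M := 'X^M %| q * partial_sum M a - p.

Lemma partial_sum_dvd M M' a : (M <= M')%N -> 'X^M %| partial_sum M' a - partial_sum M a.
Proof.
move=> le_MM'; apply/dvdXnP => i lt_iM.
by rewrite coefB !coef_partial_sum lt_iM (leq_trans lt_iM) // subrr.
Qed.

Lemma pade_le q p a M M' : (M <= M')%N -> pade q p a M' -> pade q p a M.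
Proof.
move=> le_MM' /(dvdXn_le le_MM') pM'; rewrite /pade.
have -> : q * partial_sum M a - p = (q * partial_sum M' a - p) - q * (partial_sum M' a - partial_sum M a) by ring.
by rewrite dvdp_sub // dvdp_mull // partial_sum_dvd.
Qed.

Lemma eq_partial_sum M a b : (forall i, (i < M)%N -> a i = b i) -> partial_sum M a = partial_sum M b.
Proof.
by move=> ab; apply/polyP => i; rewrite !coef_partial_sum; case: ifP => // /ab.
Qed.

(** A kernel vector of the Hankel matrix, read backwards, is the denominator: the [m] equations say
    that its product with the series has no coefficient of index [m - 1] to [2 m - 2], and the
    numerator is what lies below. *)
Lemma hankel_pade a m : (0 < m)%N ->
  \det (\matrix_(i < m, j < m) a (i + j)%N) = 0 ->
  exists q p, [/\ q != 0, (size q <= m)%N, (size p <= m.-1)%N &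
    pade q p a (m.*2.-1)].
Proof.
case: m => // m _ /eqP/det0P[v v0 vA].
pose q := \poly_(i < m.+1) v 0 (inord (m - i)).
have qE (i : 'I_m.+1) : q`_(m - i) = v 0 i.
  rewrite coef_poly ltnS leq_subr; congr (v 0 _); apply: val_inj => /=.
  by rewrite subKn ?inordK // -ltnS.
exists q, (take_poly m (q * partial_sum m.+1.*2.-1 a)); split.
- apply: contraNneq v0 => q0; apply/eqP/matrixP => i j.
  by rewrite (ord1 i) -qE q0 coef0 mxE.
- exact: size_poly.
- exact: size_take_poly.
apply/dvdXnP => n lt_n; rewrite coefB coef_take_poly.
case: ltnP => [_|le_mn]; first by rewrite subrr.
rewrite subr0 coefM.
pose j : 'I_m.+1 := inord (n - m).
have jE : nat_of_ord j = (n - m)%N by rewrite inordK //; lia.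
have := congr1 (fun B : 'rV_m.+1 => B 0 j) vA; rewrite !mxE => vj.
rewrite -[RHS]vj.
pose g i := q`_i * (partial_sum m.+1.*2.-1 a)`_(n - i).
transitivity (\sum_(i < m.+1) g i).
  apply/esym; apply: (sum_ord_extend xpredT) => // i le_i.
  by rewrite /g nth_default ?mul0r // (leq_trans (size_poly _ _)).
rewrite (reindex_inj rev_ord_inj) /=; apply: eq_bigr => i _.
rewrite /g subSS qE coef_partial_sum mxE; congr (_ * _).
have := ltn_ord i; case: ifP => [_ lti|]; last by lia.
by congr (a _); rewrite jE; lia.
Qed.

(** Approximants for consecutive [m] and [m.+1] define the same fraction, because their cross
    difference has size at most [2 m - 1] and is divisible by [X ^ (2 m - 1)]. So the small fraction
    found at [m0] inherits the precision [2 m1 - 1] reached at [m1], less the [m1 - 1] orders lost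
    in cancelling the last denominator. *)
Lemma pade_range a m0 m1 : (0 < m0)%N -> (m0 <= m1)%N ->
  (forall m, (m0 <= m <= m1)%N -> \det (\matrix_(i < m, j < m) a (i + j)%N) = 0) ->
  exists q p, [/\ q != 0, (size q <= m0)%N, (size p <= m0)%N & pade q p a m1].
Proof.
move=> m0_gt0 le_m01 det0.
have [|q0 [p0 [q00 szq0 szp0 pade0]]] := hankel_pade m0_gt0 (det0 m0 _).
  by rewrite leqnn.
have ext m : (m0 <= m)%N -> (m <= m1)%N -> exists q p,
    [/\ q != 0, (size q <= m)%N, (size p <= m.-1)%N & pade q p a (m.*2.-1)] /\
    p * q0 = p0 * q.
  elim: m => [|m IH]; first by rewrite leqNgt m0_gt0.
  rewrite leq_eqVlt => /orP[/eqP <- _|lt_m0m lt_mm1].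
    by exists q0, p0; split; first split.
  have [q [p [[q_n0 szq szp padem] pq]]] := IH lt_m0m (ltnW lt_mm1).
  have m1P : (m0 <= m.+1 <= m1)%N by rewrite ltnW.
  have [q' [p' [q'_n0 szq' szp' padem']]] := hankel_pade (ltn0Sn m) (det0 _ m1P).
  exists q', p'; split => //.
  have padem'' : pade q' p' a m.*2.-1 by apply: pade_le padem'; lia.
  have cross : p * q' = p' * q.
    apply/eqP; rewrite -subr_eq0; apply/eqP/(@dvdXn_size_eq0 m.*2.-1).
      apply: size_sub_le; [apply: size_mul_le szp szq' _ | apply: size_mul_le szp' szq _].
        by lia.
      by lia.
    set A := partial_sum m.*2.-1 a.
    have -> : p * q' - p' * q = q * (q' * A - p') - q' * (q * A - p) by ring.
    by rewrite dvdp_sub // dvdp_mull.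
  apply: (mulfI q_n0); rewrite mulrA [q * p']mulrC -cross mulrAC pq; ring.
have [q1 [p1 [[q1_n0 szq1 szp1 pade1] pq1]]] := ext m1 le_m01 (leqnn _).
exists q0, p0; split => //; first by rewrite (leq_trans szp0) ?leq_pred.
set B := partial_sum m1.*2.-1 a in pade1.
have dvdB : 'X^m1 %| q0 * B - p0.
  apply: (dvdXn_mull_cancel (k := m1.-1) q1_n0); first by lia.
  have -> : (m1.-1 + m1 = m1.*2.-1)%N by lia.
  have -> : q1 * (q0 * B - p0) = q0 * (q1 * B - p1) + (p1 * q0 - p0 * q1) by ring.
  by rewrite pq1 subrr addr0 dvdp_mull.
rewrite /pade; have -> : q0 * partial_sum m1 a - p0 = (q0 * B - p0) - q0 * (B - partial_sum m1 a) by ring.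
by rewrite dvdp_sub // dvdp_mull // partial_sum_dvd //; lia.
Qed.

(** The power of [X] in the denominator has exponent at most [m <= M], so it divides the numerator
    as well; removing it costs at most [m] orders. *)
Lemma pade_normalize q p a m M : (m <= M)%N ->
  q != 0 -> (size q <= m)%N -> (size p <= m)%N -> pade q p a M ->
  exists q' p', [/\ q'`_0 = 1, (size q' <= m)%N, (size p' <= m)%N &
    pade q' p' a (M - m)].
Proof.
move=> le_mM /poly_Xn_factor[v [h [-> h0 szq]]]; rewrite szq => le_sz szp padeq.
have le_vm : (v <= m)%N by apply: leq_trans le_sz; rewrite leq_addl.
have : 'X^v %| p.
  have -> : p = h * 'X^v * partial_sum M a - (h * 'X^v * partial_sum M a - p) by ring.
  rewrite dvdp_sub //; first by rewrite mulrAC dvdp_mull.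
  by apply: dvdXn_le padeq; apply: leq_trans le_mM.
case/dvdpP => g pE; rewrite pE in padeq szp.
exists ((h`_0)^-1 *: h), ((h`_0)^-1 *: g); split.
- by rewrite coefZ mulVf.
- by rewrite size_scale ?invr_eq0 // (leq_trans _ le_sz) ?leq_addr.
- rewrite size_scale ?invr_eq0 //; apply: leq_trans szp.
  have [->|g0] := eqVneq g 0; first by rewrite size_poly0.
  by rewrite size_mulXn // leq_addl.
rewrite /pade -scalerAl -scalerBr dvdpZr ?invr_eq0 //.
have : 'X^(v + (M - v)) %| 'X^v * (h * partial_sum M a - g).
  by rewrite subnKC ?(leq_trans le_vm) //; have -> : 'X^v * (h * partial_sum M a - g) =
     h * 'X^v * partial_sum M a - g * 'X^v by ring.
rewrite exprD dvdp_mul2l ?monic_neq0 ?monicXn // => dvdg.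
have -> : h * partial_sum (M - m) a - g = (h * partial_sum M a - g) - h * (partial_sum M a - partial_sum (M - m) a) by ring.
rewrite dvdp_sub ?dvdp_mull ?partial_sum_dvd ?leq_subr //.
by apply: dvdXn_le dvdg; lia.
Qed.

(** The identity [q * (\sum_k a_k X ^ k) = p] of formal power series, expressed through
    truncations. *)
Definition exact q p a := forall M, pade q p a M.

Lemma exactP q p a : exact q p a <-> forall n, \sum_(i < n.+1) q`_i * a (n - i)%N = p`_n.
Proof.
have E n M : (n < M)%N -> (q * partial_sum M a - p)`_n = \sum_(i < n.+1) q`_i * a (n - i)%N - p`_n.
  move=> lt_nM; rewrite coefB coefM; congr (_ - _); apply: eq_bigr => i _.
  by rewrite coef_partial_sum (leq_ltn_trans (leq_subr _ _)).
split=> [qp n | qp M].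
  by apply/eqP; rewrite -subr_eq0 -(E n n.+1) //; apply/eqP/(dvdXnP _ _ (qp n.+1)).
by apply/dvdXnP => n lt_nM; rewrite E // qp subrr.
Qed.

(** Bezout inverts [q] modulo each power of [X]. The resulting quotients are unique modulo that
    power, hence compatible, and coefficient [k] is read off modulo [X ^ k.+1]. *)
Lemma exact_exists q p : q`_0 != 0 -> exists r, exact q p r.
Proof.
move=> q0.
have inv M : exists g, 'X^M %| q * g - p.
  have /Bezout_eq1_coprimepP[[u v] /= uv] := coprimeXn M q0.
  exists (v * p).
  have -> : q * (v * p) - p = - (u * p * 'X^M) by rewrite -[p in X in _ - X]mul1r -uv; ring.
  by rewrite dvdpNr dvdp_mull.
pose G M := sval (cid (inv M)).
have GE M : 'X^M %| q * G M - p by rewrite /G; case: cid.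
exists (fun k => (G k.+1)`_k) => M.
have compat k : (k < M)%N -> (G k.+1)`_k = (G M)`_k.
  move=> lt_kM; apply/eqP; rewrite -subr_eq0 -coefB; apply/eqP.
  apply: (dvdXnP k.+1 _ _) (ltnSn k).
  rewrite -(Gauss_dvdpr _ (coprimeXn k.+1 q0)).
  have -> : q * (G k.+1 - G M) = (q * G k.+1 - p) - (q * G M - p) by ring.
  by rewrite dvdp_sub // (dvdXn_le lt_kM).
rewrite /pade; set A := partial_sum _ _.
have -> : q * A - p = (q * G M - p) - q * (G M - A) by ring.
rewrite dvdp_sub // dvdp_mull //; apply/dvdXnP => i lt_iM.
by rewrite coefB coef_partial_sum lt_iM compat // subrr.
Qed.

Lemma exact_pade_eq q p a r M : q`_0 != 0 -> exact q p r -> pade q p a M ->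
  forall k, (k < M)%N -> a k = r k.
Proof.
move=> q0 qr qa k lt_kM; apply/eqP; rewrite -subr_eq0.
have /dvdXnP/(_ _ lt_kM) : 'X^M %| partial_sum M a - partial_sum M r.
  rewrite -(Gauss_dvdpr _ (coprimeXn M q0)).
  have -> : q * (partial_sum M a - partial_sum M r) = (q * partial_sum M a - p) - (q * partial_sum M r - p) by ring.
  by rewrite dvdp_sub //; apply: qr.
by rewrite coefB !coef_partial_sum lt_kM => ->.
Qed.

(** Both fractions approximate [b] to an order not below the size of [q * p' - q' * p], so they are
    equal and share the expansion [r]. *)
Lemma pade_transfer q p q' p' b r M : q`_0 != 0 ->
  pade q p b M -> pade q' p' b M ->
  (size q + size p' <= M)%N -> (size q' + size p <= M)%N ->
  exact q p r -> exact q' p' r.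
Proof.
move=> q0 qb q'b sz1 sz2 qr n.
have cross : q * p' - q' * p = 0.
  apply: (@dvdXn_size_eq0 M).
    apply: size_sub_le; apply: size_mul_le (leqnn _) (leqnn _) _.
      by rewrite (leq_trans (leq_pred _)).
    by rewrite (leq_trans (leq_pred _)).
  have -> : q * p' - q' * p = q' * (q * partial_sum M b - p) - q * (q' * partial_sum M b - p') by ring.
  by rewrite dvdp_sub // dvdp_mull.
rewrite /pade -(Gauss_dvdpr _ (coprimeXn n q0)).
have -> : q * (q' * partial_sum n r - p') = q' * (q * partial_sum n r - p) - (q * p' - q' * p) by ring.
by rewrite cross subr0; apply: dvdp_mull; apply: qr.
Qed.

Definition theta p : {poly F} := 'X * p^`().

Lemma coef_theta p i : (theta p)`_i = i%:R * p`_i.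
Proof.
rewrite coefXM coef_deriv; case: i => [|i]; first by rewrite mul0r.
by rewrite mulr_natl.
Qed.

Lemma thetaM p q : theta (p * q) = theta p * q + p * theta q.
Proof. by rewrite /theta derivM; ring. Qed.

Lemma thetaB p q : theta (p - q) = theta p - theta q.
Proof. by rewrite /theta derivB mulrBr. Qed.

Lemma theta_dvd M g : 'X^M %| g -> 'X^M %| theta g.
Proof.
by move/dvdXnP => g0; apply/dvdXnP => i /g0 gi; rewrite coef_theta gi mulr0.
Qed.

Lemma size_theta p : (size (theta p) <= size p)%N.
Proof.
by apply/leq_sizeP => i /leq_sizeP p0; rewrite coef_theta p0 ?mulr0.
Qed.

(* For [f = p / q], [(theta - c) f = theta_num c q p / q ^ 2]. *)
Definition theta_num (c : F) q p := q * theta p - p * theta q - c *: (p * q).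

Lemma size_theta_num c q p : (size (theta_num c q p) <= size q + size p)%N.
Proof.
have le1 (u v : {poly F}) : (size u <= size q)%N -> (size v <= size p)%N ->
    (size (u * v)%R <= size q + size p)%N.
  by move=> szu szv; apply: size_mul_le szu szv _; apply: leq_pred.
rewrite /theta_num; apply: size_sub_le; first apply: size_sub_le.
- by apply: le1 (leqnn _) (size_theta _).
- by rewrite mulrC; apply: le1 (size_theta _) (leqnn _).
by apply: leq_trans (size_scale_leq _ _) _; rewrite mulrC; apply: le1.
Qed.

Lemma pade_theta (c : F) q p a M : pade q p a M ->
  pade (q * q) (theta_num c q p) (fun k => (k%:R - c) * a k) M.
Proof.
move=> qa; rewrite /pade.
have -> : partial_sum M (fun k => (k%:R - c) * a k) = theta (partial_sum M a) - c *: partial_sum M a.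
  apply/polyP => i; rewrite coefB coef_theta coefZ !coef_partial_sum.
  by case: ifP => _; rewrite ?mulr0 ?subrr // mulrBl.
set A := partial_sum M a in qa *.
have -> : q * q * (theta A - c *: A) - theta_num c q p =
    q * theta (q * A - p) - theta q * (q * A - p) - c *: (q * (q * A - p)).
  by rewrite /theta_num thetaB thetaM -!mul_polyC; ring.
rewrite -mul_polyC; apply: dvdp_sub; last by do 2!apply: dvdp_mull.
by apply: dvdp_sub; apply: dvdp_mull => //; apply: theta_dvd.
Qed.

(* The weights for [n] and [n.+1] differ by at most one factor [k - n], which
   acts on generating functions as [theta - n]. So consecutive Padé approximants
   determine one rational function, and the series [r] it defines agrees with
   the weighted [a] wherever the later factors do not vanish. *)
Section Gluing.
Variables (S : pred nat) (a : nat -> F) (n0 : nat) (sz M : nat -> nat).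
Hypothesis F_char0 : forall i j : nat, (i%:R == j%:R :> F) = (i == j).
Hypothesis M_sz : forall n, (n0 <= n)%N -> (sz n.+1 + (sz n).*2 <= M n)%N.
Hypothesis M_mono : forall n, (M n <= M n.+1)%N.
Hypothesis M_large : forall k, exists2 n, (n0 <= n)%N & (k < M n)%N.

Definition weight n k : F := \prod_(0 <= s < n | S s) (k%:R - s%:R).

Hypothesis pade_weight : forall n, (n0 <= n)%N -> exists q p,
  [/\ q`_0 = 1, (size q <= sz n)%N, (size p <= sz n)%N &
      pade q p (fun k => weight n k * a k) (M n)].

Lemma glue_pade q0 p0 r : q0`_0 = 1 -> (size q0 <= sz n0)%N -> (size p0 <= sz n0)%N ->
  pade q0 p0 (fun k => weight n0 k * a k) (M n0) -> exact q0 p0 r ->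
  forall k, ~~ S k -> r k = weight n0 k * a k.
Proof.
move=> q00 szq0 szp0 pade0 exact0.
(* [V n k] collects the factors of [weight n k] with [s >= n0]. The induction keeps, besides the
   approximant at [n], the fact that the same fraction expands exactly to [V n k * r k]. *)
pose V n k : F := \prod_(n0 <= s < n | S s) (k%:R - s%:R).
have main n : (n0 <= n)%N -> exists q p,
   [/\ q`_0 = 1, (size q <= sz n)%N, (size p <= sz n)%N,
      pade q p (fun k => weight n k * a k) (M n) &
      exact q p (fun k => V n k * r k)].
  move/subnKC <-; elim: (n - n0)%N => {n} [|d IH].
    rewrite addn0; exists q0, p0; split => //.
    move=> m; rewrite /pade (@eq_partial_sum _ _ r); first exact: exact0.
    by move=> k _; rewrite /V big_geq ?mul1r.
  move: IH; rewrite addnS; have := leq_addr d n0.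
  move: (n0 + d)%N => n le_n0n [q [p [q_1 szq szp qp exq]]].
  have [q' [p' [q'_1 szq' szp' qp']]] := pade_weight (leqW le_n0n).
  exists q', p'; split => //.
  have szM := M_sz le_n0n.
  have {}qp' := pade_le (M_mono n) qp'.
  have [Sn|nSn] := boolP (S n).
    have wE k : weight n.+1 k * a k = (k%:R - n%:R) * (weight n k * a k).
      by rewrite /weight [X in X * _]big_mkcond big_nat_recr //= -big_mkcond Sn; ring.
    have VE k : V n.+1 k * r k = (k%:R - n%:R) * (V n k * r k).
      by rewrite /V [X in X * _]big_mkcond big_nat_recr //= -big_mkcond Sn; ring.
    have ex2 : exact (q * q) (theta_num n%:R q p) (fun k => V n.+1 k * r k).
      move=> m; rewrite /pade (eq_partial_sum (fun k _ => VE k)); exact: pade_theta.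
    apply: (pade_transfer (M := M n) _ _ qp' _ _ ex2).
    - by rewrite -horner_coef0 hornerM horner_coef0 q_1 mulr1 oner_eq0.
    - by rewrite /pade (eq_partial_sum (fun k _ => wE k)); apply: pade_theta.
    - have := size_polyMleq q q; lia.
    have := size_theta_num n%:R q p; lia.
  have wE k : weight n.+1 k = weight n k.
    by rewrite /weight big_mkcond big_nat_recr //= -big_mkcond (negPf nSn) mulr1.
  have VE k : V n.+1 k = V n k.
    by rewrite /V big_mkcond big_nat_recr //= -big_mkcond (negPf nSn) mulr1.
  have ex2 : exact q p (fun k => V n.+1 k * r k).
    by move=> m; rewrite /pade (@eq_partial_sum _ _ (fun k => V n k * r k)) => [|k _]; rewrite ?VE //; apply: exq.
  apply: (pade_transfer (M := M n) _ _ qp' _ _ ex2).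
  - by rewrite q_1 oner_eq0.
  - by rewrite /pade (@eq_partial_sum _ _ (fun k => weight n k * a k)) // => k _; rewrite wE.
  - by lia.
  by lia.
(* A fixed [k] lies below the order [M n] for some [n]. There both series of the invariant agree,
   and outside [S] the factor [V n k] is nonzero and cancels. *)
move=> k nSk; have [n le_n0n lt_kM] := M_large k.
have [q [p [q_1 _ _ qp exq]]] := main n le_n0n.
have q_0 : q`_0 != 0 by rewrite q_1 oner_eq0.
have := exact_pade_eq q_0 exq qp lt_kM.
have -> : weight n k = V n k * weight n0 k.
  by rewrite /weight /V mulrC -big_cat_nat.
have V0 : V n k != 0.
  rewrite /V; elim/big_rec: _ => [|s x Ss x0]; first exact: oner_neq0.
  rewrite mulf_neq0 // subr_eq0 F_char0; apply: contraNneq nSk => ->; exact: Ss.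
by rewrite -mulrA => /(mulfI V0) ->.
Qed.

End Gluing.

End Pade.

(** * Rational algebraic integers and the embeddings of a number field *)

Lemma rat_integral_int (x : rat) :
  integralOver (intr : int -> rat) x -> exists z : int, x = z%:~R.
Proof.
case=> p p_monic px; have pxC : root (map_poly intr p : {poly algC}) (ratr x).
  have -> : map_poly intr p = map_poly ratr (map_poly intr p : {poly rat}) :> {poly algC}.
    by rewrite -map_poly_comp; apply: eq_map_poly => b /=; rewrite ratr_int.
  by rewrite fmorph_root.
have xA : (ratr x : algC) \in Aint.
  apply: root_monic_Aint pxC _ _; first by rewrite monic_map.
  by apply/polyOverP => i; rewrite coef_map rpred_int.
have /intrP[z xz] := Cint_rat_Aint (Crat_rat x) xA.
by exists z; apply: (fmorph_inj (@ratr algC)); rewrite /= xz ratr_int.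
Qed.

Lemma rmorphism_exists (A B : nzRingType) (f : A -> B) :
  zmod_morphism f -> monoid_morphism f -> exists g : {rmorphism A -> B}, g =1 f.
Proof.
move=> f_add f_mul.
pose mf := GRing.isZmodMorphism.Build A B f f_add.
pose mm := GRing.isMonoidMorphism.Build A B f f_mul.
by exists (HB.pack f mf mm : {rmorphism A -> B}).
Qed.

Section Embeddings.
Variables (K : fieldExtType rat) (C : numClosedFieldType).
Local Notation iota := (in_alg K).

Lemma rat_primitive_element : exists (t : K) (mu : {poly rat}),
  [/\ mu \is monic, separable_poly mu,
      forall x, exists2 P : {poly rat}, (size P <= (size mu).-1)%N & x = (map_poly iota P).[t],
      (map_poly iota mu).[t] = 0 &
      forall A : {poly rat}, (map_poly iota A).[t] = 0 -> mu %| A].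
Proof.
have charK : [pchar K] =i pred0 by move=> p; rewrite (fmorph_pchar iota) pchar_num.
have sepK : separable 1 {:K} by apply/separableP => y _; apply: pcharf0_separable.
pose t := separable_generator 1 {:K}.
have genK := eq_adjoin_separable_generator sepK (subvf _).
have /polyOver1P[mu Dmu] : minPoly 1%AS t \is a polyOver 1%VS by exact: minPolyOver.
exists t, mu; split.
- by rewrite -(map_monic iota) -Dmu monic_minPoly.
- by rewrite -(separable_map iota) -Dmu; apply: separable_generatorP.
- move=> x; have Kx : x \in <<1; t>>%VS by rewrite -genK memvf.
  have /polyOver1P[P DP] := Fadjoin_polyOver 1%AS t x.
  exists P; last by rewrite -DP Fadjoin_poly_eq.
  rewrite -(size_map_poly iota) -DP -(size_map_poly iota mu) -Dmu size_minPoly.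
  exact: size_Fadjoin_poly.
- by rewrite -Dmu minPolyxx.
move=> A At; rewrite -(dvdp_map iota) -Dmu; apply: minPoly_dvdp; last exact/rootP.
by apply/polyOver1P; exists A.
Qed.

(* The norm polynomial is [\det M], [M] being multiplication by [g] in the power
   basis of a primitive element; a Vandermonde matrix diagonalizes it over [C]. *)
Lemma number_field_embeddings :
  exists (d : nat) (sigma : 'I_d -> {rmorphism K -> C}),
    (forall f : {rmorphism K -> C}, exists i, f =1 sigma i) /\
    (forall g : {poly K}, exists G : {poly rat},
       map_poly ratr G = \prod_i map_poly (sigma i) g).
Proof.
have [t [mu [mu_monic mu_sep repr mut mu_dvd]]] := rat_primitive_element.
pose rep x := s2val (cid2 (repr x)).
have szrep x : (size (rep x) <= (size mu).-1)%N by rewrite /rep; case: cid2.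
have repE x : x = (map_poly iota (rep x)).[t] by rewrite /rep; case: cid2.
have [rs Drs] := closed_field_poly_normal (map_poly ratr mu : {poly C}).
have muC_monic : (map_poly ratr mu : {poly C}) \is monic by rewrite map_monic.
rewrite (monicP muC_monic) scale1r in Drs.
have rs_uniq : uniq rs by rewrite -separable_prod_XsubC -Drs separable_map.
pose d := size rs.
have szmu : size mu = d.+1.
  by rewrite -(size_map_poly (@ratr C)) Drs size_prod_XsubC.
(* [rep] comes from choice, so even its value at 0 has to be derived from the size bound. It is used
   for the coefficients of [g] beyond its size. *)
have rep0 : rep 0 = 0.
  have /mu_dvd/dvdp_leq le_mu : (map_poly iota (rep 0)).[t] = 0 by rewrite -repE.
  apply/eqP; apply: contraT => /le_mu; rewrite leqNgt => /negP[].
  by rewrite szmu ltnS (leq_trans (szrep 0)) ?szmu.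
(* Evaluation at a conjugate of [t] depends on [x] alone: two polynomials with the same value at [t]
   differ by a multiple of [mu]. Additivity and multiplicativity follow from this. *)
pose f0 (i : 'I_d) (x : K) : C := (map_poly ratr (rep x)).[rs`_i].
have rootA (i : 'I_d) (A : {poly rat}) : (map_poly iota A).[t] = 0 ->
    (map_poly ratr A : {poly C}).[rs`_i] = 0.
  move=> /mu_dvd/dvdpP[B ->].
  have -> : map_poly ratr (B * mu) = map_poly ratr B * map_poly ratr mu :> {poly C}.
    exact: rmorphM.
  rewrite hornerM Drs.
  have /rootP -> : root (\prod_(z <- rs) ('X - z%:P)) rs`_i.
    by rewrite root_prod_XsubC mem_nth.
  by rewrite mulr0.
have f0E i (A : {poly rat}) x : (map_poly iota A).[t] = x ->
    f0 i x = (map_poly ratr A).[rs`_i].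
  move=> Ax; apply/eqP; rewrite -subr_eq0 -hornerN -hornerD -rmorphB; apply/eqP.
  by apply: rootA; rewrite rmorphB hornerD hornerN -repE Ax subrr.
have f0_add i : zmod_morphism (f0 i).
  move=> x y; rewrite (f0E i (rep x - rep y)) ?rmorphB ?hornerD ?hornerN -?repE //.
have f0_mul i : monoid_morphism (f0 i).
  split=> [|x y]; first by rewrite (f0E i 1) ?rmorph1 ?hornerC.
  by rewrite (f0E i (rep x * rep y)) ?rmorphM ?hornerM -?repE.
have f0_morph i := rmorphism_exists (f0_add i) (f0_mul i).
pose sigma i := sval (cid (f0_morph i)).
have sigmaE i : sigma i =1 f0 i by rewrite /sigma; case: cid.
exists d, sigma; split.
  move=> f; have f_iota : f \o iota =1 ratr := fmorph_eq_rat (f \o iota).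
  have ft A : f (map_poly iota A).[t] = (map_poly ratr A).[f t].
    rewrite -horner_map -map_poly_comp; congr (_.[_]); exact: eq_map_poly.
  have : root (map_poly ratr mu) (f t) by rewrite rootE -ft mut rmorph0.
  rewrite Drs root_prod_XsubC => /(nthP 0)[i ltid fti].
  exists (Ordinal ltid) => x; rewrite sigmaE /f0 /= fti.
  by rewrite {1}[x]repE ft.
move=> g.
pose M : 'M[{poly rat}]_d :=
  \matrix_(j, l) \poly_(k < size g) (rep (g`_k * t ^+ j))`_l.
pose theta : 'rV[C]_d := \row_i rs`_i.
pose V : 'M[{poly C}]_d := map_mx polyC (Vandermonde d theta).
pose D : 'M[{poly C}]_d := diag_mx (\row_i map_poly (sigma i) g).
have key : map_mx (map_poly ratr) M *m V = V *m D.
  apply/matrixP => j i; rewrite mul_mx_diag !mxE.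
  apply/polyP => k; rewrite coef_sum coefCM coef_map /=.
  have sig_t (l : nat) : sigma i (t ^+ l) = rs`_i ^+ l.
    rewrite sigmaE (f0E i 'X^l) ?map_polyXn ?hornerXn //.
  have : sigma i (g`_k * t ^+ j) =
      \sum_(l < d) ratr (rep (g`_k * t ^+ j))`_l * rs`_i ^+ l.
    rewrite sigmaE /f0 (@horner_coef_wide _ d).
      by apply: eq_bigr => l _; rewrite coef_map.
    by rewrite size_map_poly (leq_trans (szrep _)) // szmu.
  rewrite rmorphM /= sig_t mulrC => ->.
  apply: eq_bigr => l _; rewrite !mxE coefMC coef_map /= coef_poly.
  by case: ltnP => // le_gk; rewrite [g`_k]nth_default // mul0r rep0 coef0.
have detV : \det V != 0.
  rewrite det_map_mx polyC_eq0 det_Vandermonde; apply/prodf_neq0 => i _.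
  apply/prodf_neq0 => j lt_ij; rewrite !mxE subr_eq0 nth_uniq //.
  by rewrite gtn_eqF.
exists (\det M); apply: (mulIf detV).
rewrite -[map_poly _ (\det M)]det_map_mx -det_mulmx key det_mulmx mulrC; congr (_ * _).
by rewrite det_diag; apply: eq_bigr => i _; rewrite mxE.
Qed.

End Embeddings.

Lemma integral_sum (B : comNzRingType) (I : Type) (r : seq I) (P : pred I) (F : I -> B) :
  (forall i, P i -> integralOver (intr : int -> B) (F i)) ->
  integralOver (intr : int -> B) (\sum_(i <- r | P i) F i).
Proof.
move=> F_int; elim/big_rec: _ => [|i x Pi x_int]; first exact: mxpoly.integral0.
by apply: integral_add => //; apply: F_int.
Qed.

Lemma integral_prod (B : comNzRingType) (I : Type) (r : seq I) (P : pred I) (F : I -> B) :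
  (forall i, P i -> integralOver (intr : int -> B) (F i)) ->
  integralOver (intr : int -> B) (\prod_(i <- r | P i) F i).
Proof.
move=> F_int; elim/big_rec: _ => [|i x Pi x_int]; first exact: integral1.
by apply: integral_mul => //; apply: F_int.
Qed.

(** * Norms, Fatou's lemma and Kronecker's theorem *)

Section Norm.
Variables (K : fieldExtType rat) (C : numClosedFieldType).
Variables (d : nat) (sigma : 'I_d -> {rmorphism K -> C}).
Hypothesis sigma_norm : forall g : {poly K}, exists G : {poly rat},
  map_poly ratr G = \prod_i map_poly (sigma i) g.

Definition integral_coefs (p : {poly K}) := forall i, algebraic_integer p`_i.

Lemma integral_morph (f : {rmorphism K -> C}) x :
  algebraic_integer x -> integralOver (intr : int -> C) (f x).
Proof.
case=> p p_monic px; exists p => //.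
have -> : map_poly intr p = map_poly f (map_poly intr p) :> {poly C}.
  by rewrite -map_poly_comp; apply: eq_map_poly => b /=; rewrite rmorph_int.
by rewrite fmorph_root.
Qed.

Lemma integral_ratr (x : rat) :
  integralOver (intr : int -> C) (ratr x) -> exists z : int, x = z%:~R.
Proof.
case=> p p_monic px; apply: rat_integral_int; exists p => //.
have pE : map_poly intr p = map_poly ratr (map_poly intr p : {poly rat}) :> {poly C}.
  by rewrite -map_poly_comp; apply: eq_map_poly => b /=; rewrite ratr_int.
by rewrite pE fmorph_root in px.
Qed.

(** The coefficients of the product are rational and integral over the integers. *)
Lemma norm_integral_poly (g : {poly K}) : integral_coefs g ->
  exists G : {poly int}, map_poly intr G = \prod_i map_poly (sigma i) g.
Proof.
move=> g_int; have [G GE] := sigma_norm g.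
have G_int i : exists z : int, G`_i = z%:~R.
  apply: integral_ratr; rewrite -coef_map /= GE.
  elim/big_rec: _ i => [|j p _ p_int] i.
    by rewrite coef1; apply: integral_nat.
  rewrite coefM; apply: integral_sum => k _; apply: integral_mul; last exact: p_int.
  by rewrite coef_map; apply: integral_morph.
exists (\poly_(i < size G) sval (cid (G_int i))); rewrite -GE.
apply/polyP => i; rewrite !coef_map coef_poly /=.
case: ltnP => [_|le_Gi]; last by rewrite nth_default ?rmorph0.
by case: cid => z /= ->; rewrite ratr_int.
Qed.

Lemma norm_ge1 (x : K) : algebraic_integer x -> x != 0 -> 1 <= \prod_i `|sigma i x|.
Proof.
move=> x_int x0; have [|G GE] := @norm_integral_poly x%:P.
  by move=> i; rewrite coefC; case: ifP => // _; apply: mxpoly.integral0.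
have : \prod_i sigma i x = (G`_0)%:~R.
  rewrite -coef_map GE -horner_coef0 horner_prod; apply: eq_bigr => i _.
  by rewrite map_polyC hornerC.
move/(congr1 Num.norm); rewrite normr_prod => ->; rewrite -intr_norm ler1z.
rewrite -gtz0_ge1 normr_gt0 -(intr_eq0 C).
rewrite -coef_map GE -horner_coef0 horner_prod; apply/prodf_neq0 => i _.
by rewrite map_polyC hornerC fmorph_eq0.
Qed.

End Norm.

Section Fatou.

(** Modulo [p] the polynomial [Q] starts in degree [k], so as long as [p] divides [D] the first
    [M - k] coefficients of [G] are divisible by [p]. Dividing [G] and [D] by [p] costs [k] orders,
    and this can happen at most [v] times. *)
Lemma fatou_valuation (p : nat) (Q : {poly int}) k :
  prime p -> (forall i, (i < k)%N -> (p %| Q`_i)%Z) -> ~~ (p %| Q`_k)%Z ->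
  (0 < k)%N ->
  forall v M (G : {poly int}) (D : int), ~~ ((p ^ v.+1)%N %| D)%Z ->
  (forall i, (i < M)%N -> (Q * G)`_i = if i == 0%N then D else 0) ->
  (M <= k * v)%N.
Proof.
move=> p_pr Q_lt Qk k0; have base M G D : ~~ (p %| D)%Z ->
    (forall i, (i < M)%N -> (Q * G)`_i = if i == 0%N then D else 0) -> M = 0%N.
  move=> pD QG; case: M QG => // M /(_ 0%N (ltn0Sn _)) /=.
  rewrite coefM big_ord_recl big_ord0 addr0 => DE; case/negP: pD.
  by rewrite -DE dvdz_mulr // Q_lt.
elim=> [|v IH] M G D; first by rewrite expn1 => pD /(base _ _ _ pD) ->.
have [pD|pD _ /(base _ _ _ pD) -> //] := boolP (p %| D)%Z.
move=> pvD QG; have pG n : (n < M - k)%N -> (p %| G`_n)%Z.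
  elim/ltn_ind: n => n IHn lt_n.
  have kP : (k < (n + k).+1)%N by rewrite ltnS leq_addl.
  have QkGn : Q`_k * G`_n = (Q * G)`_(n + k) -
      \sum_(i < (n + k).+1 | i != Ordinal kP) Q`_i * G`_(n + k - i).
    by rewrite coefM (bigD1 (Ordinal kP)) //= addnK addrK.
  have pQG : (p %| Q`_k * G`_n)%Z.
    rewrite QkGn; apply: rpredB.
      by rewrite QG; [case: ifP => _ //; apply: dvdz0 | lia].
    apply: rpred_sum => -[i lti] /=; rewrite -val_eqE /= => ne_ik.
    have [lt_ik|lt_ki|eq_ik] := ltngtP i k; last by rewrite eq_ik eqxx in ne_ik.
      by apply: dvdz_mulr; apply: Q_lt.
    by apply: dvdz_mull; apply: IHn; lia.
  move: pQG; rewrite !dvdzE /= abszM Euclid_dvdM // => /orP[pQk|//].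
  by rewrite dvdzE pQk in Qk.
have p0 : (p%:Z != 0) by rewrite -lt0n prime_gt0.
have /dvdzP[D' DE] := pD.
pose G' := \poly_(i < M - k) (G`_i %/ p)%Z.
have /IH : ~~ ((p ^ v.+1)%N %| D')%Z.
  by move: pvD; rewrite DE expnSr PoszM dvdz_mul2r.
move=> /(_ (M - k)%N G') H.
suff : (M - k <= k * v)%N by rewrite mulnS; lia.
apply: H => i lt_i; apply: (mulfI p0).
have -> : p%:Z * (Q * G')`_i = (Q * G)`_i.
  rewrite !coefM mulr_sumr; apply: eq_bigr => j _; rewrite coef_poly.
  have lt_ij : (i - j < M - k)%N by apply: leq_ltn_trans (leq_subr _ _) lt_i.
  by rewrite lt_ij mulrCA; congr (_ * _); rewrite mulrC divzK ?pG.
rewrite QG; last by lia.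
by case: ifP => _; rewrite ?mulr0 // DE mulrC.
Qed.

(** [G / D M] is the expansion of [1 / Q] up to order [M]. If a prime [p] divided the constant term
    of the primitive polynomial [Q], with [k] the first index whose coefficient is prime to [p],
    then [D M] would be divisible by about [p ^ (M / k)]: too much for the last hypothesis. *)
Lemma fatou (Q : {poly int}) (D : nat -> nat) :
  zcontents Q = 1 ->
  (forall M, (0 < D M)%N) ->
  (forall M : nat, exists G : {poly int}, forall i : nat, (i < M)%N ->
     (Q * G)`_i = (if i == 0%N then (D M)%:Z else 0)) ->
  (forall k, exists M v, (k * v < M)%N /\ (D M < 2 ^ v.+1)%N) ->
  absz Q`_0 = 1%N.
Proof.
move=> Q_prim D0 QG D_small; apply/eqP; apply: contraT => Q01.
have [p p_pr pQ0] : exists2 p, prime p & (p %| absz (Q`_0)%R)%N.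
  have [Q00|Q0_gt0] := posnP (absz Q`_0); first by exists 2%N; rewrite ?Q00.
  exists (pdiv (absz (Q`_0)%R)); last exact: pdiv_dvd.
  by apply: pdiv_prime; rewrite ltn_neqAle eq_sym Q01.
have ex_k : exists k, ~~ (p %| Q`_k)%Z.
  have : ~~ (p%:Z %| zcontents Q)%Z by rewrite Q_prim dvdz1 /= neq_ltn prime_gt1 ?orbT.
  rewrite dvdz_contents => /negP pQ; apply/not_existsP => no_k; apply: pQ.
  by apply/polyOverP => i; apply/negPn/negP/no_k.
case: (ex_minnP ex_k) => k pQk k_min.
have k_gt0 : (0 < k)%N.
  by rewrite lt0n; apply: contraNneq pQk => ->; rewrite dvdzE.
have Q_lt i : (i < k)%N -> (p %| Q`_i)%Z.
  by apply: contraTT => /k_min; rewrite -leqNgt.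
have [M [v [lt_kvM lt_DM]]] := D_small k; have [G QGM] := QG M.
have pD : ~~ ((p ^ v.+1)%N %| (D M)%:Z)%Z.
  rewrite dvdzE /=; apply/negP => /dvdn_leq; rewrite D0 => /(_ isT).
  by rewrite leqNgt (leq_trans lt_DM) // leq_exp2r // prime_gt1.
have := fatou_valuation p_pr Q_lt pQk k_gt0 pD QGM.
by rewrite leqNgt lt_kvM.
Qed.

End Fatou.

Section Kronecker.
Variable C : numClosedFieldType.

(** A factor [X - z] multiplies the modulus of the constant term by [|z|] and the bound on the
    coefficients by at most [1 + |z| <= 2 |z|]. *)
Lemma coef_le_roots_ge1 (c : C) (rs : seq C) i : all (fun z => 1 <= `|z|) rs ->
  let p := c *: \prod_(z <- rs) ('X - z%:P) in
  `|p`_i| <= 2 ^+ size rs * `|p`_0|.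
Proof.
rewrite /=; elim: rs i => [|z rs IH] i /=.
  move=> _; rewrite big_nil expr0 mul1r !coefZ !coef1 eqxx mulr1.
  by case: (i == 0)%N; rewrite ?mulr1 // mulr0 normr0 normr_ge0.
case/andP=> z1 rs1; rewrite big_cons scalerAr.
set p := c *: _ in IH *.
have pE j : (('X - z%:P) * p)`_j = (if j == 0%N then 0 else p`_j.-1) - z * p`_j.
  by rewrite mulrBl coefB coefXM coefCM.
rewrite !pE /= sub0r normrN normrM.
apply: le_trans (ler_normB _ _) _.
have H1 : `|if i == 0%N then 0 else p`_i.-1| <= 2 ^+ size rs * `|p`_0|.
  by case: ifP => _; [rewrite normr0 mulr_ge0 ?exprn_ge0 ?normr_ge0 | apply: IH].
have H2 : `|z * p`_i| <= `|z| * (2 ^+ size rs * `|p`_0|).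
  by rewrite normrM ler_wpM2l ?normr_ge0 // IH.
apply: le_trans (lerD H1 H2) _.
have -> : 2 ^+ (size rs).+1 * (`|z| * `|p`_0|) =
  `|z| * (2 ^+ size rs * `|p`_0|) + `|z| * (2 ^+ size rs * `|p`_0|).
  by rewrite exprS; ring.
by rewrite lerD2r ler_peMl // mulr_ge0 ?exprn_ge0 ?normr_ge0.
Qed.

Definition roots_ge1 (Q : {poly int}) :=
  forall z : C, root (map_poly intr Q) z -> 1 <= `|z|.

(* [Q'] is defined by [Q'(X ^ 2) = Q(X) Q(-X)], so its roots are the squares of
   those of [Q]. *)
Lemma graeffe (Q : {poly int}) : Q != 0 -> exists Q' : {poly int},
  [/\ (size Q' <= size Q)%N, Q'`_0 = Q`_0 ^+ 2 &
      forall z : C, (map_poly intr Q').[z ^+ 2] =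
        (map_poly intr Q).[z] * (map_poly intr Q).[- z]].
Proof.
move=> Q0; pose Qn := Q \Po (- 'X); pose P := Q * Qn.
have Peven : P \Po (- 'X) = P.
  rewrite /P comp_polyM -comp_polyA mulrC; congr (_ * _).
  have -> : (- 'X) \Po (- 'X) = 'X :> {poly int}.
    by rewrite (raddfN (comp_poly (- 'X))) /= comp_polyX opprK.
  exact: comp_polyXr.
have Podd : odd_poly P = 0.
  apply/polyP => i; rewrite coef_odd_poly coef0; apply/eqP.
  have : (P \Po (- 'X))`_(i.*2.+1) = - P`_(i.*2.+1).
    have -> : - 'X = (-1) *: 'X :> {poly int} by rewrite scaleN1r.
    rewrite coef_comp_poly.
    transitivity (\sum_(j < size P) (if j == i.*2.+1 :> nat then - P`_j else 0)).
      apply: eq_bigr => j _; rewrite exprZn coefZ coefXn eq_sym.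
      case: eqP => [->|_]; last by rewrite !mulr0.
      by rewrite mulr1 -signr_odd /= odd_double expr1 mulrN1.
    rewrite -big_mkcond /=; case: (ltnP i.*2.+1 (size P)) => [lt_i|le_i].
      by rewrite (big_pred1 (Ordinal lt_i)).
    rewrite big_pred0 ?nth_default ?oppr0 // => j.
    by apply/eqP => ji; have := ltn_ord j; rewrite ji ltnNge le_i.
  by rewrite Peven => /eqP; rewrite -addr_eq0 -mulr2n mulrn_eq0.
have PE := poly_even_odd P; rewrite Podd comp_poly0 mul0r addr0 in PE.
exists (even_poly P); split.
- apply: leq_trans (size_even_poly _) _.
  have szQn : (size Qn <= size Q)%N.
    by rewrite size_comp_poly2 // size_polyN size_polyX.
  have : (size P <= (size Q + size Qn).-1)%N by apply: size_polyMleq.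
  have : (0 < size Q)%N by rewrite size_poly_gt0.
  by rewrite uphalfE; lia.
- rewrite coef_even_poly /P coefM big_ord_recl big_ord0 addr0 subn0 expr2.
  congr (_ * _); rewrite /Qn -!horner_coef0 horner_comp hornerN hornerX oppr0 //.
move=> z; have intrE : map_poly intr P = map_poly intr (even_poly P) \Po 'X^2 :> {poly C}.
  by rewrite -[in LHS]PE map_comp_poly map_polyXn.
have -> : (map_poly intr (even_poly P)).[z ^+ 2] = (map_poly intr P).[z] :> C.
  by rewrite intrE horner_comp hornerXn.
rewrite /P rmorphM hornerM; congr (_ * _).
by rewrite /Qn /= map_comp_poly horner_comp rmorphN /= map_polyX hornerN hornerX.
Qed.

Lemma int_poly_coef_bound (Q : {poly int}) n i : roots_ge1 Q -> (size Q <= n)%N ->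
  `|Q`_i| <= (2 ^ n)%:Z * `|Q`_0|.
Proof.
move=> Q_ge1 szQ.
have [rs Drs] := closed_field_poly_normal (map_poly intr Q : {poly C}).
set c := lead_coef _ in Drs.
have [Q0|Qn0] := eqVneq Q 0; first by rewrite Q0 !coef0 normr0 mulr0.
have cn0 : c != 0 by rewrite lead_coef_eq0 map_poly_eq0_id0 // intr_eq0 lead_coef_eq0.
have rs1 : all (fun z => 1 <= `|z|) rs.
  apply/allP => z z_rs; apply: Q_ge1.
  by rewrite Drs rootZ // root_prod_XsubC.
have szrs : (size rs <= n)%N.
  have := congr1 (fun p : {poly C} => size p) Drs.
  rewrite size_scale // size_prod_XsubC size_map_inj_poly //; last exact: intr_inj.
  by move=> szQE; rewrite ltnW // -szQE.
have := coef_le_roots_ge1 c i rs1; rewrite /= -Drs !coef_map /= -!intr_norm.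
have -> : 2 ^+ size rs = ((2 ^ size rs)%:Z)%:~R :> C.
  by rewrite -natrX pmulrn.
rewrite -rmorphM ler_int => /le_trans; apply.
by rewrite ler_wpM2r ?normr_ge0 // lez_nat leq_exp2l.
Qed.

(** Under repeated [graeffe] steps [z ^ (2 ^ k)] stays a root of an integer polynomial of size at
    most [n], with constant term [+-1] and no root in the open disk. Such polynomials have
    coefficients bounded by [2 ^ n], so only finitely many roots occur and two of these powers
    coincide. *)
Lemma kronecker (Q : {poly int}) (z : C) : absz Q`_0 = 1%N -> roots_ge1 Q ->
  root (map_poly intr Q) z -> exists2 n : nat, (0 < n)%N & z ^+ n = 1.
Proof.
move=> Q01 Q_ge1 Qz; pose n := size Q; pose B := (2 ^ n)%N.
pose good (P : {poly int}) := [/\ (size P <= n)%N, absz P`_0 = 1%N & roots_ge1 P].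
have nz (P : {poly int}) : absz P`_0 = 1%N -> P != 0.
  by apply: contra_eq_neq => ->; rewrite coef0.
have step P : good P -> exists2 P', good P' &
    forall x : C, root (map_poly intr P) x -> root (map_poly intr P') (x ^+ 2).
  case=> szP P01 P_ge1; have [P' [szP' P'0 P'E]] := graeffe (nz _ P01).
  exists P'; last by move=> x /rootP Px; apply/rootP; rewrite P'E Px mul0r.
  split; first exact: leq_trans szP.
    by rewrite P'0 abszX P01.
  move=> x Px; pose y := sqrtC x; have xE : x = y ^+ 2 by rewrite sqrtCK.
  have : root (map_poly intr P) y || root (map_poly intr P) (- y).
    by move: Px; rewrite xE rootE P'E mulf_eq0.
  rewrite xE normrX; case/orP => /P_ge1; rewrite ?normrN => y1; exact: exprn_ege1.
have iter k : exists2 P, good P & root (map_poly intr P) (z ^+ (2 ^ k)).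
  elim: k => [|k [P goodP Pz]]; first by exists Q => //; rewrite expn0 expr1.
  have [P' goodP' H] := step P goodP; exists P' => //.
  by rewrite expnSr exprM; apply: H.
(* Coefficients between [- B] and [B] are coded as ordinals by a shift, which makes the candidates
   an enumerable finite type. *)
pose polyf (f : {ffun 'I_n -> 'I_(B.*2.+1)}) : {poly int} :=
  \poly_(i < n) (if insub i is Some i' then (f i')%:Z - B%:Z else 0).
have polyf_onto P : good P -> exists f, P = polyf f.
  case=> szP P01 P_ge1.
  have Pi i : `|P`_i| <= B%:Z.
    apply: le_trans (int_poly_coef_bound i P_ge1 szP) _.
    by rewrite -abszE P01 mulr1.
  exists [ffun i : 'I_n => inord (absz (P`_i + B%:Z))].
  apply/polyP => i; rewrite coef_poly; case: ltnP => [lt_in|le_ni]; last first.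
    by rewrite nth_default // (leq_trans szP).
  have := Pi i; rewrite ler_norml => /andP[PiB1 PiB2].
  have PiB : 0 <= P`_i + B%:Z by rewrite -lerBlDr sub0r.
  rewrite insubT ffunE /= inordK; first by rewrite gez0_abs // addrK.
  rewrite ltnS -lez_nat gez0_abs // -addnn PoszD lerD2r //.
pose rts (p : {poly C}) := sval (closed_field_poly_normal p).
pose L := flatten [seq rts (map_poly intr (polyf f)) | f <- enum {: {ffun 'I_n -> 'I_(B.*2.+1)}}].
have zL k : z ^+ (2 ^ k) \in L.
  have [P goodP Pz] := iter k; have [f PE] := polyf_onto P goodP.
  apply/flattenP; exists (rts (map_poly intr (polyf f))).
    by apply/mapP; exists f; rewrite ?mem_enum.
  move: Pz; rewrite -PE /rts; case: closed_field_poly_normal => rs /= Drs.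
  rewrite {1}Drs rootZ ?root_prod_XsubC // lead_coef_eq0.
  rewrite map_poly_eq0_id0 ?intr_eq0 ?lead_coef_eq0; last by case: goodP => _ /nz.
  by case: goodP => _ /nz.
pose s := [seq z ^+ (2 ^ k) | k <- iota 0 (size L).+1].
have s_nuniq : ~~ uniq s.
  apply/negP => s_uniq; have : (size s <= size L)%N.
    by apply: (uniq_leq_size s_uniq) => x /mapP[k _ ->].
  by rewrite size_map size_iota ltnn.
have [j [k [lt_jk lt_k zjk]]] := uniqPn 0 s_nuniq.
rewrite size_map size_iota in lt_k.
move: zjk; rewrite !(nth_map 0%N) ?size_iota ?(ltn_trans lt_jk) //.
rewrite !nth_iota ?(ltn_trans lt_jk) // !add0n => zjk.
have z0 : z != 0.
  have := Q_ge1 z Qz; apply: contraTneq => ->.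
  by rewrite normr0 ler10.
have lt_exp : (2 ^ j < 2 ^ k)%N by rewrite ltn_exp2l.
exists (2 ^ k - 2 ^ j)%N; first by rewrite subn_gt0.
have zj0 : z ^+ (2 ^ j) != 0 by rewrite expf_neq0.
apply: (mulfI zj0).
by rewrite -exprD subnKC ?(ltnW lt_exp) // mulr1 zjk.
Qed.

End Kronecker.

Lemma closed_prim_root_exists (F : numClosedFieldType) n :
  (0 < n)%N -> exists z : F, n.-primitive_root z.
Proof.
move=> n_gt0; pose p : {poly F} := 'X^n - 1.
have [r Dp] := closed_field_poly_normal p.
rewrite (monicP _) ?monicXnsubC // scale1r in Dp.
have rn1 : all n.-unity_root r by apply/allP => z; rewrite -root_prod_XsubC -Dp.
have sz_r : (n <= size r)%N.
  by rewrite -ltnS -(size_prod_XsubC r id) -Dp size_XnsubC.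
have [|z] := hasP (has_prim_root n_gt0 rn1 _ sz_r); last by exists z.
by rewrite -separable_prod_XsubC -Dp separable_Xn_sub_1 // pnatr_eq0 -lt0n.
Qed.

(** * Analytic continuation and Hankel determinants *)

Section Peak.
Variable R : realType.
Local Notation C := (CC R).
Implicit Types (t z : C) (p : {poly C}).

Lemma sqr_cabs_1Bmul (c : R) t : cabs t = 1 ->
  cabs (1 - rc c * t) ^+ 2 = c * cabs (1 - t) ^+ 2 + (1 - c) ^+ 2.
Proof.
move=> t1; have tt : t * t^* = 1 by rewrite -normCK cabsE t1 expr1n.
have sqrE z : rc (cabs z ^+ 2) = z * z^*.
  by rewrite rmorphXn /= -cabsE normCK.
have creal : (rc c)^* = rc c.
  by exact: conj_rc.
apply: (fmorph_inj (@rc R)); rewrite /= rmorphD rmorphM /= !sqrE rmorphXn rmorphB /=.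
rewrite !rmorphB rmorphM /= !rmorph1 creal.
have -> : (1 - rc c * t) * (1 - rc c * t^*) =
  1 - rc c * t - rc c * t^* + rc c ^+ 2 * (t * t^*) :> C by ring.
have -> : (1 - t) * (1 - t^*) = 1 - t - t^* + t * t^* :> C by ring.
by rewrite tt; ring.
Qed.

(* [b = 1 + e v], where [v] is a Fejér mean of the partial sums of
   [t / (1 - t)], so that [(1 - t) b] is close to [1 - (1 - e) t]. *)
Lemma peak_polynomial_lt1 (d : R) : 0 < d -> d <= 1 ->
  exists b : {poly C}, exists2 q : R, 0 <= q < 1 &
    b`_0 = 1 /\ forall t, cabs t = 1 -> d <= cabs (1 - t) -> cabs b.[t] <= q.
Proof.
(* With [e = d ^ 2 / 2] one has [e ^ 2 <= e / 2 * D ^ 2] whenever [D >= d], and [sqr_cabs_1Bmul]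
   then bounds the square of [|1 - (1 - e) t|] by [(1 - e / 2) D ^ 2]. *)
move=> d0 d1; have [e de] : exists e : R, d ^+ 2 = 2 * e.
  by exists (d ^+ 2 / 2); lra.
have dd0 : 0 < d ^+ 2 by rewrite exprn_gt0.
have dd1 : d ^+ 2 <= 1 by apply: exprn_ile1 => //; apply: ltW.
have e0 : 0 < e by lra.
have e1 : e <= 1 / 2 by lra.
(* Large enough that the tail of the Fejér mean, at most [2 e / (L D)], takes at most half of the
   gain [e / 4 * D]. *)
pose L := (Num.truncn (16 / d ^+ 2)).+1.
have leL : 16 / d ^+ 2 <= L%:R by apply/ltW/truncnS_gt.
have L0 : 0 < L%:R :> R by rewrite ltr0n.
have LC0 : L%:R != 0 :> C by rewrite pnatr_eq0.
pose s l : {poly C} := \sum_(n < l.+1) 'X^(n.+1).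
pose v : {poly C} := (L%:R)^-1 *: \sum_(l < L) s l.
exists (1 + (rc e) *: v), (1 - e / 8); first by apply/andP; split; lra.
split.
  rewrite coefD coefZ coef1 /= coefZ coef_sum big1 ?mulr0 ?addr0 // => l _.
  by rewrite coef_sum big1 // => n _; rewrite coefXn.
move=> t t1 dt; set D := cabs (1 - t) in dt.
have D0 : 0 < D by apply: lt_le_trans dt.
have dD : d ^+ 2 <= D ^+ 2.
  by apply: lerXn2r; rewrite ?nnegrE ?(ltW d0) ?(ltW D0).
have sE l : (1 - t) * (s l).[t] = t - t ^+ l.+2.
  rewrite horner_sum; under eq_bigr do rewrite hornerXn exprS.
  rewrite -mulr_sumr mulrCA -[1 - t]opprB mulNr -subrX1 opprB.
  by rewrite mulrBr mulr1 -exprS.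
have vE : (1 - t) * v.[t] = t - L%:R^-1 * (\sum_(l < L) t ^+ l.+2).
  rewrite hornerZ mulrCA horner_sum mulr_sumr.
  under eq_bigr do rewrite sE.
  rewrite sumrB sumr_const card_ord mulrBr; congr (_ - _).
  by rewrite -[t *+ L]mulr_natl mulKf.
have wE : (1 - t) * (\sum_(l < L) t ^+ l.+2) = t ^+ 2 * (1 - t ^+ L).
  under eq_bigr do rewrite -addn2 addnC exprD.
  by rewrite -mulr_sumr mulrCA -[1 - t]opprB mulNr -subrX1 opprB.
have w_le : cabs (\sum_(l < L) t ^+ l.+2) <= 2 / D.
  rewrite ler_pdivlMr // mulrC -cabsM wE cabsM cabsX t1 expr1n mul1r.
  by apply: le_trans (ler_cabsB _ _) _; rewrite cabs1 cabsX t1 expr1n.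
have bE : (1 - t) * (1 + rc e *: v).[t] =
    (1 - rc (1 - e) * t) - rc e * L%:R^-1 * (\sum_(l < L) t ^+ l.+2).
  rewrite hornerD hornerZ hornerC mulrDr mulrCA vE mulr1 rmorphB /= mulrBr.
  by rewrite mulrA rmorph1; ring.
have main_le : cabs (1 - rc (1 - e) * t) <= (1 - e / 4) * D.
  have := sqr_cabs_1Bmul (1 - e) t1; rewrite -/D => E.
  have h0 : 0 <= (1 - e / 4) * D.
    by apply: mulr_ge0; [lra | exact: ltW].
  rewrite -(@ler_pXn2r _ 2) ?nnegrE ?cabs_ge0 // E.
  have : e ^+ 2 <= e / 2 * D ^+ 2.
    by rewrite expr2 -mulrA ler_pM2l //; lra.
  have := exprn_gt0 2 D0; nra.
have tail_le : cabs (rc e * L%:R^-1 * (\sum_(l < L) t ^+ l.+2)) <= e / 8 * D.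
  rewrite !cabsM cabsV cabs_nat cabs_rc_ge0 ?(ltW e0) // -!mulrA ler_pM2l //.
  rewrite ler_pdivrMl //; apply: le_trans w_le _.
  rewrite ler_pdivrMr //.
  have : 16 <= L%:R * d ^+ 2 by rewrite -ler_pdivrMr.
  have : L%:R * d ^+ 2 <= L%:R * D ^+ 2 by rewrite ler_pM2l.
  by rewrite [D ^+ 2]expr2; lra.
rewrite -(ler_pM2l D0) /D -cabsM bE -/D.
by apply: le_trans (ler_cabsB _ _) _; nra.
Qed.

(** A high power of the previous polynomial. The value [1 / 4] makes the displacement [2 u |h t|]
    away from 1 at most [u / 2], less than the radius [3 u / 4] on which derivatives are controlled
    there. *)
Lemma peak_polynomial (d : R) : 0 < d ->
  exists2 h : {poly C}, h`_0 = 1 &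
    forall t, cabs t = 1 -> d <= cabs (1 - t) -> cabs h.[t] <= 1 / 4.
Proof.
move=> d0.
have d'0 : 0 < Num.min d 1 by rewrite lt_min d0 ltr01.
have d'1 : Num.min d 1 <= 1 by rewrite ge_min lexx orbT.
have [b [q /andP[q0 q1] [b0 b_le]]] := peak_polynomial_lt1 d'0 d'1.
have q4 : (0 : R) < 1 / 4 by lra.
have [n qn] := expr_eventually_le q0 q1 q4.
move: qn => /(_ n (leqnn n)) qn.
exists (b ^+ n).
  rewrite -horner_coef0 hornerE horner_coef0 b0 expr1n //.
move=> t t1 dt; rewrite hornerE cabsX; apply: le_trans qn.
rewrite lerXn2r ?nnegrE ?cabs_ge0 //; apply: b_le => //.
by rewrite ge_min dt.
Qed.

(* Cauchy's estimate, with roots of unity in place of the contour integral. *)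
Lemma coef_le_circle p (M : R) n :
  (forall t, cabs t = 1 -> cabs p.[t] <= M) -> cabs p`_n <= M.
Proof.
move=> pM; pose L := (maxn (size p) n).+1.
have LC0 : L%:R != 0 :> C by rewrite pnatr_eq0.
have [z zP] := closed_prim_root_exists C (ltn0Sn (maxn (size p) n)).
have z1 : cabs z = 1.
  have : cabs z ^+ L = 1 by rewrite -cabsX (prim_expr_order zP) cabs1.
  by move/eqP; rewrite pexpr_eq1 ?cabs_ge0 // => /eqP.
have nL : (n < L)%N by rewrite ltnS leq_maxr.
have E : L%:R * p`_n = \sum_(j < L) p.[z ^+ j] * (z ^+ j)^-1 ^+ n.
  under eq_bigr => j _.
    rewrite (@horner_coef_wide _ L); last by rewrite ltnW // ltnS leq_maxl.
    rewrite mulr_suml; over.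
  rewrite exchange_big /= (bigD1 (Ordinal nL)) //= [X in _ + X]big1 ?addr0.
    under eq_bigr => j _.
      rewrite -mulrA -exprMn mulfV ?expr1n ?mulr1; last first.
        by rewrite expf_neq0 // -cabs_eq0 z1 oner_eq0.
      over.
    by rewrite sumr_const card_ord mulr_natl.
  move=> i ne_in.
  pose w := z ^+ i / z ^+ n.
  have zn0 k : z ^+ k != 0 by rewrite expf_neq0 // -cabs_eq0 z1 oner_eq0.
  have w1 : w != 1.
    rewrite /w -subr_eq0 -(divff (zn0 n)) -mulrBl mulf_neq0 ?invr_neq0 //.
    rewrite subr_eq0 (eq_prim_root_expr zP) /= !modn_small //.
  have -> : \sum_(j < L) p`_i * (z ^+ j) ^+ i * (z ^+ j)^-1 ^+ n =
            p`_i * \sum_(j < L) w ^+ j.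
    rewrite mulr_sumr; apply: eq_bigr => j _; rewrite -mulrA; congr (_ * _).
    by rewrite /w exprMn !exprVn -!exprM !(mulnC j).
  have : (w - 1) * \sum_(j < L) w ^+ j = 0.
    rewrite -subrX1 /w exprMn exprVn -!exprM ![(_ * L)%N]mulnC !exprM.
    by rewrite (prim_expr_order zP) !expr1n invr1 mulr1 subrr.
  move/eqP; rewrite mulf_eq0 subr_eq0 (negPf w1) /= => /eqP ->.
  by rewrite mulr0.
have L0 : 0 < L%:R :> R by rewrite ltr0n.
rewrite -(ler_pM2l L0) -{1}(cabs_nat R L) -cabsM E.
apply: le_trans (ler_cabs_sum _ _ _) _.
have -> : L%:R * M = \sum_(j < L) M by rewrite sumr_const card_ord mulr_natl.
apply: ler_sum => j _; rewrite cabsM cabsX cabsV cabsX z1 expr1n invr1 expr1n.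
by rewrite mulr1 pM // cabsX z1 expr1n.
Qed.

End Peak.

Section WienerNorm.
Variable R : realType.
Local Notation C := (CC R).
Implicit Types (p q : {poly C}).

(* The norm of the Wiener algebra. *)
Definition wnorm p : R := \sum_(i < size p) cabs p`_i.

Lemma wnorm_ge0 p : 0 <= wnorm p.
Proof. by apply: sumr_ge0 => i _; apply: cabs_ge0. Qed.

Lemma cabs_horner_wnorm p (t : C) : cabs t = 1 -> cabs p.[t] <= wnorm p.
Proof.
move=> t1; rewrite horner_coef; apply: le_trans (ler_cabs_sum _ _ _) _.
by apply: ler_sum => i _; rewrite cabsM cabsX t1 expr1n mulr1.
Qed.

Lemma wnorm_wide p m : (size p <= m)%N -> wnorm p = \sum_(i < m) cabs p`_i.
Proof.
move=> le_pm; rewrite /wnorm -!(big_mkord xpredT (fun i => cabs p`_i)).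
rewrite [RHS](@big_cat_nat _ _ _ (size p)) //= addrC.
rewrite [X in X + _]big_nat_cond [X in X + _]big1 ?add0r //.
by move=> i /andP[/andP[le_pi _] _]; rewrite nth_default // cabs0.
Qed.

Lemma wnorm_mulX p : wnorm ('X * p) = wnorm p.
Proof.
have szp : leq (size ('X * p)) (size p).+1.
  by rewrite (leq_trans (size_polyMleq _ _)) // size_polyX.
rewrite (wnorm_wide szp) big_ord_recl coefXM cabs0 add0r.
by apply: eq_bigr => i _; rewrite coefXM.
Qed.

Lemma wnorm_coefM p q (E : R) n : (forall j, (j <= n)%N -> cabs q`_j <= E) ->
  cabs (p * q)`_n <= wnorm p * E.
Proof.
move=> qE; rewrite coefM; apply: le_trans (ler_cabs_sum _ _ _) _.
have E0 : 0 <= E by apply: le_trans (qE 0 _); rewrite ?cabs_ge0.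
apply: le_trans (_ : \sum_(j < n.+1) cabs p`_j * E <= _).
  apply: ler_sum => j _; rewrite cabsM ler_wpM2l ?cabs_ge0 //.
  by rewrite qE // leq_subr.
rewrite -mulr_suml ler_wpM2r //.
rewrite (wnorm_wide (leq_maxl (size p) n.+1)).
rewrite -!(big_mkord xpredT (fun i => cabs p`_i)).
rewrite [leRHS](@big_cat_nat _ _ _ n.+1) ?leq_maxr //= lerDl.
by apply: sumr_ge0 => i _; apply: cabs_ge0.
Qed.

Lemma wnorm_coefXM p q (E : R) k n :
  (forall j, (j <= n)%N -> cabs q`_j <= E) ->
  cabs (p ^+ k * q)`_n <= wnorm p ^+ k * E.
Proof.
elim: k n => [|k IH] n qE; first by rewrite !expr0 !mul1r qE.
rewrite !exprS -!mulrA; apply: wnorm_coefM => j le_jn.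
by apply: IH => i le_ij; apply: qE; apply: leq_trans le_jn.
Qed.

End WienerNorm.

Section BinomialSum.
Variable R : realType.

(** Partial sums of the negative binomial series of [(1 - x) ^ - k.+1]: by Pascal's rule,
    multiplication by [1 - x] lowers [k] by one, up to a boundary term of favourable sign. *)
Lemma sum_binomial_geometric (x : R) k K : 0 <= x -> x < 1 ->
  \sum_(i < K) 'C(k + i, i)%:R * x ^+ i <= ((1 - x)^-1) ^+ k.+1.
Proof.
move=> x0 x1; have x1' : 0 < 1 - x by rewrite subr_gt0.
elim: k K => [|k IH] K.
  under eq_bigr do rewrite add0n binn mul1r.
  rewrite expr1 -(ler_pM2l x1') mulfV ?gt_eqF //.
  by rewrite -opprB mulNr -subrX1 opprB lerBlDr lerDl exprn_ge0.
rewrite exprS -(ler_pM2l x1') mulrA mulfV ?gt_eqF // mul1r.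
apply: le_trans (IH K).
have E m : (1 - x) * \sum_(i < m) 'C(k.+1 + i, i)%:R * x ^+ i =
  \sum_(i < m) 'C(k + i, i)%:R * x ^+ i - (if m is m'.+1 then
     'C(k.+1 + m', m')%:R * x ^+ m else 0).
  elim: m => [|m IHm]; first by rewrite !big_ord0 mulr0 subr0.
  rewrite !big_ord_recr /= mulrDr IHm.
  case: m {IHm} => [|m]; first by rewrite !bin0; ring.
  have -> : 'C(k.+1 + m.+1, m.+1) = ('C(k + m.+1, m.+1) + 'C(k.+1 + m, m))%N.
    by rewrite addSn binS addnS addSn.
  by rewrite natrD [x ^+ m.+2]exprS; ring.
rewrite E; case: K => [|K]; first by rewrite subr0.
by rewrite gerBl mulr_ge0 ?ler0n ?exprn_ge0.
Qed.

End BinomialSum.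

Section PartialSums.
Variable R : realType.
Local Notation C := (CC R).
Implicit Types (a : nat -> C) (p : {poly C}).

(** Cauchy's estimate for divided derivatives: [coef_le_circle] applied to the Taylor polynomial at
    [z], rescaled to the unit circle. *)
Lemma nderivn_le_circle p (z : C) (x E : R) k : 0 < x ->
  (forall y : C, cabs y = x -> cabs p.[z + y] <= E) ->
  cabs p^`N(k).[z] <= E * x^-1 ^+ k.
Proof.
move=> x0 pE.
pose q := \poly_(i < size p) (p^`N(i).[z] * rc x ^+ i).
have qE t : q.[t] = p.[z + rc x * t].
  rewrite horner_poly nderiv_taylor; last exact: mulrC.
  by apply: eq_bigr => i _; rewrite exprMn mulrA.
have := @coef_le_circle R q E k.
rewrite coef_poly exprVn ler_pdivlMr ?exprn_gt0 //.
case: ltnP => [ltk | lek].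
  rewrite cabsM cabsX cabs_rc_ge0 ?(ltW x0) //; apply => t t1.
  by rewrite qE pE // cabsM t1 mulr1 cabs_rc_ge0 ?(ltW x0).
rewrite cabs0 => q_le.
rewrite nderivn_poly0 // horner0 cabs0 mul0r; apply: q_le => t t1.
by rewrite qE pE // cabsM t1 mulr1 cabs_rc_ge0 ?(ltW x0).
Qed.

Lemma partial_sum_tail a (rho A x : R) (z : C) M M' :
  0 <= x -> x < rho -> (forall n, cabs (a n) * rho ^+ n <= A) ->
  cabs z <= x -> (M <= M')%N ->
  cabs ((partial_sum M' a).[z] - (partial_sum M a).[z]) <= A * (x / rho) ^+ M / (1 - x / rho).
Proof.
move=> x0 x_rho aA zx le_MM'.
have rho0 : 0 < rho by apply: le_lt_trans x_rho.
set q := x / rho.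
have q0 : 0 <= q by rewrite divr_ge0 // ltW.
have q1 : q < 1 by rewrite ltr_pdivrMr // mul1r.
have q1' : 0 < 1 - q by rewrite subr_gt0.
have A0 : 0 <= A by apply: le_trans (aA 0); rewrite mulr_ge0 ?cabs_ge0.
rewrite !horner_poly -!(big_mkord xpredT (fun i => a i * z ^+ i)).
have -> : \sum_(0 <= i < M') a i * z ^+ i - \sum_(0 <= i < M) a i * z ^+ i =
    \sum_(M <= i < M') a i * z ^+ i.
  by rewrite (@big_cat_nat _ _ _ M 0 M') //= addrAC subrr add0r.
apply: le_trans (ler_cabs_sum _ _ _) _.
apply: le_trans (_ : \sum_(M <= i < M') A * q ^+ i <= _).
  rewrite big_nat_cond [leRHS]big_nat_cond; apply: ler_sum => i _.
  rewrite cabsM cabsX /q exprMn exprVn mulrA.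
  rewrite ler_pdivlMr ?exprn_gt0 // mulrAC.
  apply: le_trans (_ : A * cabs z ^+ i <= _).
    by rewrite ler_wpM2r ?exprn_ge0 ?cabs_ge0.
  by rewrite ler_wpM2l // lerXn2r ?nnegrE ?cabs_ge0.
rewrite -mulr_sumr -mulrA ler_wpM2l //.
rewrite ler_pdivlMr //.
have -> : \sum_(M <= i < M') q ^+ i = q ^+ M * \sum_(i < M' - M) q ^+ i.
  rewrite -{1}[M]add0n big_addn big_mkord mulr_sumr.
  by apply: eq_bigr => i _; rewrite exprD mulrC.
rewrite -mulrA [_ * (1 - q)]mulrC -opprB mulNr -subrX1 opprB.
by rewrite ler_piMr ?exprn_ge0 // gerBl exprn_ge0.
Qed.

Lemma partial_sum_bound a (rho A x : R) (z : C) M :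
  0 <= x -> x < rho -> (forall n, cabs (a n) * rho ^+ n <= A) ->
  cabs z <= x -> cabs (partial_sum M a).[z] <= A / (1 - x / rho).
Proof.
move=> x0 x_rho aA zx.
have := partial_sum_tail x0 x_rho aA zx (leq0n M).
by rewrite {2}/partial_sum poly_def big_ord0 horner0 subr0 expr0 mulr1.
Qed.

End PartialSums.

Section AnalyticContinuation.
Variable R : realType.
Local Notation C := (CC R).
Variables (a c : nat -> C) (D : R).
Hypothesis D_gt0 : 0 < D.
Hypothesis a_bound : forall x : R, 0 < x < 1 ->
  exists A, forall n, cabs (a n) * x ^+ n <= A.
Hypothesis c_bound : exists A, forall n, cabs (c n) * D ^+ n <= A.
Hypothesis a_c_agree : forall (z : C) (e : R), cabs z < 1 -> cabs (z - 1) < D ->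
  0 < e -> exists N, forall M, (N <= M)%N ->
    cabs ((partial_sum M a).[z] - (partial_sum M c).[z - 1]) <= e.

(** Pointwise agreement becomes uniform: pass from [M] to a larger truncation, where the difference
    is at most an arbitrary [e], and bound the two tails by geometric series. Uniformity is what
    lets Cauchy's estimate pass to derivatives. *)
Lemma partial_sums_agree (x : R) : 0 < x < 1 ->
  exists A q : R, [/\ 0 <= A, 0 <= q < 1 & forall M (y : C), cabs y <= x ->
    cabs (y - 1) <= D / 2 ->
    cabs ((partial_sum M a).[y] - (partial_sum M c).[y - 1]) <= A * q ^+ M].
Proof.
have D0 := D_gt0; case/andP=> x0 x1; pose rho := (1 + x) / 2.
have x_rho : x < rho by rewrite /rho; lra.
have rho1 : 0 < rho < 1 by rewrite /rho; apply/andP; split; lra.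
have [rho0 _] := andP rho1; clearbody rho.
have [Aa HAa] := a_bound rho1; have [Ac HAc] := c_bound.
have q1 : 0 <= x / rho < 1 by rewrite divr_ge0 ?ltW //= ltr_pdivrMr ?mul1r.
have Aa0 : 0 <= Aa by apply: le_trans (HAa 0); rewrite mulr_ge0 ?cabs_ge0.
have Ac0 : 0 <= Ac by apply: le_trans (HAc 0); rewrite mulr_ge0 ?cabs_ge0.
have D2 : 0 <= D / 2 < D by apply/andP; split; lra.
have q2E : D / 2 / D = 1 / 2 by field; rewrite gt_eqF.
pose q := Num.max (x / rho) (1 / 2).
exists (Aa / (1 - x / rho) + Ac / (1 - 1 / 2)), q; split.
- by apply: addr_ge0; apply: divr_ge0 => //; case/andP: q1 => _ q1; lra.
- rewrite /q le_max gt_max (andP q1).1 (andP q1).2 /=; lra.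
move=> M y yx yD; apply/ler_addgt0Pr => e e0.
have y1 : cabs y < 1 by apply: le_lt_trans yx _.
have [N HN] := a_c_agree y1 (le_lt_trans yD (andP D2).2) e0.
have := HN (maxn N M) (leq_maxl _ _).
have := partial_sum_tail (ltW x0) x_rho HAa yx (leq_maxr N M).
have := partial_sum_tail (andP D2).1 (andP D2).2 HAc yD (leq_maxr N M).
set am' := (partial_sum _ a).[y]; set cm' := (partial_sum _ c).[_].
set am := (partial_sum M a).[y]; set cm := (partial_sum M c).[_] => Hc Ha He.
have -> : am - cm = (am' - cm') - (am' - am) + (cm' - cm) by ring.
apply: le_trans (ler_cabsD _ _) _; rewrite addrC.
apply: le_trans (lerD Hc (ler_cabsB _ _)) _.
rewrite q2E; have H1 : Aa * (x / rho) ^+ M / (1 - x / rho) <=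
                       Aa / (1 - x / rho) * q ^+ M.
  rewrite mulrAC ler_wpM2l //.
    by apply: divr_ge0 => //; case/andP: q1 => _ q1; lra.
  by rewrite lerXn2r ?nnegrE ?/q ?le_max ?(andP q1).1 ?lexx.
have H2 : Ac * (1 / 2) ^+ M / (1 - 1 / 2) <= Ac / (1 - 1 / 2) * q ^+ M.
  rewrite mulrAC ler_wpM2l //; first by apply: divr_ge0 => //; lra.
  rewrite lerXn2r ?nnegrE ?/q ?le_max ?(andP q1).1 ?lexx ?orbT //; lra.
by rewrite mulrDl; lra.
Qed.

(** [rc (1 - u) * t] is the centre of expansion and [rc (2 * u) * t * h.[t]] the displacement from
    it to [phi t]. Each centre has a disk of radius [1 / b], at least four thirds of the
    displacement, with uniform bounds on derivatives: near 1 it comes from the local series [c],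
    elsewhere from [a]. [A] and [B] are independent of [K]; only the truncation depends on it. *)
Lemma derivative_bounds_on_circle (u : R) (h : {poly C}) :
  0 < u -> u <= D / 16 -> u <= 1 / 8 -> u * wnorm h <= D / 16 ->
  (forall t, cabs t = 1 -> D / 8 <= cabs (1 - t) -> cabs h.[t] <= 1 / 4) ->
  exists A B : R, forall K, exists M0, forall M, (M0 <= M)%N ->
  forall t, cabs t = 1 -> exists b : R,
    [/\ 0 <= b <= B, b * cabs (rc (2 * u) * t * h.[t]) <= 3 / 4 &
    forall k, (k <= K)%N ->
      cabs (partial_sum M a)^`N(k).[rc (1 - u) * t] <= A * b ^+ k].
Proof.
have D0 := D_gt0; move=> u0 uD u8 uh h_peak.
have rho1 : 0 < 1 - u / 8 < 1 by apply/andP; split; lra.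
have x_rho : 1 - u / 4 < 1 - u / 8 by lra.
have x0 : 0 <= 1 - u / 4 by lra.
have x1 : 0 < 1 - u / 4 < 1 by apply/andP; split; lra.
have [Aa HAa] := a_bound rho1; have [Ac HAc] := c_bound.
have D2 : 0 <= D / 2 < D by apply/andP; split; lra.
have [A3 [q [A30 /andP[q0 q1] HA3]]] := partial_sums_agree x1.
set A1 := Aa / (1 - (1 - u / 4) / (1 - u / 8)).
set A2 := Ac / (1 - D / 2 / D).
have A10 : 0 <= A1.
  apply: le_trans (partial_sum_bound 0 x0 x_rho HAa (_ : cabs 0 <= _)).
    exact: cabs_ge0.
  by rewrite cabs0.
have A20 : 0 <= A2.
  apply: le_trans (partial_sum_bound 0 (andP D2).1 (andP D2).2 HAc (_ : cabs 0 <= _)).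
    exact: cabs_ge0.
  by rewrite cabs0 (andP D2).1.
(* A circle of radius [3 u / 4] around a point of modulus [1 - u] stays in the disk of radius
   [1 - u / 4]. One of radius [D / 4] around a point within [D / 4] of 1 stays within [D / 2] of
   1. *)
pose b1 : R := (3 * u / 4)^-1; pose b2 : R := (D / 4)^-1.
have b10 : 0 < b1 by rewrite invr_gt0; lra.
have b20 : 0 < b2 by rewrite invr_gt0; lra.
exists (A1 + A2 + 1), (b1 + b2) => K.
have v1 : 0 < b2 / b1 <= 1.
  by rewrite divr_gt0 //= ler_pdivrMr // mul1r /b1 /b2 lef_pV2 ?posrE; lra.
have eK : 0 < (b2 / b1) ^+ K / (A3 + 1).
  rewrite divr_gt0 // ?exprn_gt0 ?(andP v1).1 //; lra.
(* Near 1 the truncations of [a] and [c] are compared on circles of radius [1 / b1], which gives the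
   growth [b1 ^ k]. A truncation error below [(b2 / b1) ^ K] turns it into [b2 ^ k] for all
   [k <= K]. *)
have [M0 HM0] := expr_eventually_le q0 q1 eK.
have HM M : (M0 <= M)%N -> A3 * q ^+ M <= (b2 / b1) ^+ K.
  move=> /HM0; rewrite ler_pdivlMr; last by lra.
  apply: le_trans; rewrite mulrC ler_wpM2l ?exprn_ge0 //; lra.
exists M0 => M /HM{}HM t t1.
have zE : cabs (rc (1 - u) * t) = 1 - u.
  by rewrite cabsM t1 mulr1 cabs_rc_ge0 //; lra.
have dispE : cabs (rc (2 * u) * t * h.[t]) = 2 * u * cabs h.[t].
  by rewrite !cabsM t1 mulr1 cabs_rc_ge0 //; lra.
rewrite dispE; have [near|away] := ltP (cabs (1 - t)) (D / 8).
  exists b2; split.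
  - by rewrite (ltW b20) lerDr ltW.
  - rewrite /b2 mulrC ler_pdivrMr; last by lra.
    have := cabs_horner_wnorm h t1.
    move=> /(ler_wpM2l (ltW u0)); lra.
  move=> k le_kK.
  pose pc := partial_sum M c \Po ('X - 1%:P).
  have pcE y : pc.[y] = (partial_sum M c).[y - 1] by rewrite horner_comp !hornerE.
  rewrite -(subrK pc (partial_sum M a)) nderivnD hornerD.
  have zD : cabs (rc (1 - u) * t - 1) <= D / 4.
    have -> : rc (1 - u) * t - 1 = - (1 - t) - rc u * t.
      by rewrite rmorphB rmorph1; ring.
    apply: le_trans (ler_cabsB _ _) _.
    by rewrite cabsN cabsM t1 mulr1 cabs_rc_ge0 ?(ltW u0) //; lra.
  have H1 : cabs (partial_sum M a - pc)^`N(k).[rc (1 - u) * t] <= 1 * b2 ^+ k.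
    apply: le_trans (_ : A3 * q ^+ M * b1 ^+ k <= _).
      apply: nderivn_le_circle; first by lra.
      move=> y yE; rewrite hornerD hornerN pcE; apply: HA3.
        by apply: le_trans (ler_cabsD _ _) _; rewrite zE yE; lra.
      rewrite addrAC; apply: le_trans (ler_cabsD _ _) _; rewrite yE; lra.
    apply: le_trans (_ : (b2 / b1) ^+ k * b1 ^+ k <= _).
      rewrite ler_wpM2r ?exprn_ge0 ?(ltW b10) //; apply: le_trans HM _.
      by rewrite ler_wiXn2l ?(ltW (andP v1).1) ?(andP v1).2.
    by rewrite -exprMn mulfVK ?gt_eqF // mul1r.
  have H2 : cabs pc^`N(k).[rc (1 - u) * t] <= A2 * b2 ^+ k.
    apply: nderivn_le_circle; first by lra.
    move=> y yE; rewrite pcE.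
    apply: partial_sum_bound (andP D2).1 (andP D2).2 HAc _.
    rewrite addrAC; apply: le_trans (ler_cabsD _ _) _; rewrite yE; lra.
  apply: le_trans (ler_cabsD _ _) _; apply: le_trans (lerD H1 H2) _.
  rewrite -mulrDl ler_wpM2r ?exprn_ge0 ?(ltW b20) //; lra.
exists b1; split.
- by rewrite (ltW b10) lerDl ltW.
- rewrite /b1 mulrC ler_pdivrMr; last by lra.
  have := h_peak t t1 away; move=> /(ler_wpM2l (ltW u0)); lra.
move=> k _; apply: le_trans (_ : A1 * b1 ^+ k <= _).
  apply: nderivn_le_circle; first by lra.
  move=> y yE; apply: partial_sum_bound x0 x_rho HAa _.
  by apply: le_trans (ler_cabsD _ _) _; rewrite zE yE; lra.
rewrite ler_wpM2r ?exprn_ge0 ?(ltW b10) //; lra.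
Qed.

End AnalyticContinuation.

Section Composition.
Variable R : realType.
Local Notation C := (CC R).

(* It maps the closed disk into the region of holomorphy of [f], with derivative
   [r + e > 1] at 0; [h] peaks at 1, where the disk is pushed outwards. *)
Definition conformal_poly (h : {poly C}) (r e : R) : {poly C} :=
  rc r *: 'X + rc e *: ('X * h).

Lemma comp_poly_taylor (F : comNzRingType) (f p q : {poly F}) :
  f \Po (p + q) = \sum_(i < size f) (f^`N(i) \Po p) * q ^+ i.
Proof.
rewrite /comp_poly nderiv_taylor; last exact: mulrC.
rewrite size_map_inj_poly ?rmorph0 //; last exact: polyC_inj.
by apply: eq_bigr => i _; rewrite nderivn_map.
Qed.

Lemma nderivn_nderivn (F : nzRingType) (p : {poly F}) k i :
  (p^`N(k))^`N(i) = p^`N(k + i) *+ 'C(k + i, i).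
Proof.
apply/polyP => j; rewrite coefMn !coef_nderivn -!mulrnA !addnA; congr (_ *+ _).
have [fi fk fj] : [/\ i`! > 0, k`! > 0 & j`! > 0]%N by rewrite !fact_gt0.
have E1 := @bin_fact (k + i + j) k; have E2 := @bin_fact (i + j) i.
have E3 := @bin_fact (k + i + j) (k + i); have E4 := @bin_fact (k + i) i.
move: E1 E2 E3 E4; rewrite -addnA leq_addr addKn => /(_ isT) E1.
rewrite leq_addr addKn => /(_ isT) E2.
rewrite addnA leq_addr addKn => /(_ isT) E3.
rewrite leq_addl addnK => /(_ isT) E4.
apply/eqP; rewrite -(eqn_pmul2r fi) -(eqn_pmul2r fk) -(eqn_pmul2r fj).
apply/eqP; move: E1 E2 E3 E4; rewrite -!addnA; nia.
Qed.

(** As [p] has no constant term, [p ^+ s] contributes to coefficient [n] only for [s <= n], so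
    truncating the series at [M > n] is harmless. *)
Lemma partial_sum_nderivn_comp (a : nat -> C) (p : {poly C}) k n M :
  p`_0 = 0 -> (n < M)%N ->
  (\sum_(s < n.+1) 'C(s, k)%:R * a s * (p ^+ s)`_n) =
  (p ^+ k * ((partial_sum M a)^`N(k) \Po p))`_n.
Proof.
move=> p0 ltnM; have p_low s m : (m < s)%N -> (p ^+ s)`_m = 0.
  elim: s m => [//|s IH] m lt_ms; rewrite exprS coefM big1 // => -[[|i] lti] _ /=.
    by rewrite p0 mul0r.
  by rewrite [X in _ * X]IH ?mulr0 //; rewrite subnS; lia.
have -> : p ^+ k * ((partial_sum M a)^`N(k) \Po p) =
    \sum_(s < M) ('C(s, k)%:R * a s) *: p ^+ s.
  rewrite /partial_sum poly_def !raddf_sum /= mulr_sumr; apply: eq_bigr => s _.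
  rewrite nderivnZ nderivnXn comp_polyZ.
  have [lt_sk|le_ks] := ltnP s k.
    by rewrite bin_small // mulr0n comp_poly0 scaler0 mulr0 mul0r scale0r.
  rewrite [_ \Po _](raddfMn (comp_poly p)) /= rmorphXn /= comp_polyX.
  by rewrite -scalerAr mulrnAr -exprD subnKC // mulr_natl -scalerMnr -scalerMnl.
rewrite coef_sum [RHS](bigID (fun s : 'I_M => (s < n.+1)%N)) /=.
rewrite [X in _ + X]big1 ?addr0; last first.
  by move=> s; rewrite -leqNgt => lt_ns; rewrite coefZ p_low ?mulr0.
rewrite (big_ord_widen_cond M xpredT
  (fun s => 'C(s, k)%:R * a s * (p ^+ s)`_n)) //=.
by apply: eq_bigr => s _; rewrite coefZ.
Qed.

Lemma coef_mulXexp (F : comNzRingType) (p q : {poly F}) n i : (n < i)%N ->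
  (p * ('X * q) ^+ i)`_n = 0.
Proof.
by move=> lt_ni; rewrite exprMn mulrCA coefXnM lt_ni.
Qed.

Section Bound.
Variables (a c : nat -> C) (D : R).
Hypothesis D_gt0 : 0 < D.
Hypothesis a_bound : forall x : R, 0 < x < 1 ->
  exists A, forall n, cabs (a n) * x ^+ n <= A.
Hypothesis c_bound : exists A, forall n, cabs (c n) * D ^+ n <= A.
Hypothesis a_c_agree : forall (z : C) (e : R), cabs z < 1 -> cabs (z - 1) < D ->
  0 < e -> exists N, forall M, (N <= M)%N ->
    cabs ((partial_sum M a).[z] - (partial_sum M c).[z - 1]) <= e.

(** With [r = 1 - u] and [e = 2 u] the derivative of [phi] at 0 is [1 + u]. On the unit circle the
    [k]-th divided derivative at [phi t] is expanded around [(1 - u) t]. The binomials from iterated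
    derivatives sum by [sum_binomial_geometric] with ratio at most [3 / 4], whence a factor
    [4 ^ k.+1]. *)
Lemma conformal_composition_bound : exists (h : {poly C}) (r e A B : R),
  [/\ 0 < r, 0 < e, 1 < r + e, h`_0 = 1 &
      e * (\sum_(i < size h) \sum_(j < size h) cabs h`_(i + j)) <= r / 2] /\
  (1 <= B /\ forall k n,
    cabs (\sum_(s < n.+1) 'C(s, k)%:R * a s * (conformal_poly h r e ^+ s)`_n)
      <= A * B ^+ k).
Proof.
have D0 := D_gt0; have D8 : 0 < D / 8 by lra.
have [h h0 h_peak] := peak_polynomial D8.
set H1 := \sum_(i < size h) \sum_(j < size h) cabs h`_(i + j).
have le_wn_H1 : wnorm h <= H1.
  apply: ler_sum => -[i lti] _ /=; case: (size h) lti => // n _.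
  by rewrite big_ord_recl addn0 lerDl sumr_ge0 // => j _; apply: cabs_ge0.
have H1_ge1 : 1 <= H1.
  apply: le_trans le_wn_H1; rewrite -(cabs1 R) -h0.
  rewrite (wnorm_wide (leqnSn (size h))) big_ord_recl lerDl.
  by apply: sumr_ge0 => i _; apply: cabs_ge0.
have H1_gt0 : 0 < H1 by lra.
(* Dividing by [H1] serves two constraints: near 1 the displacement is at most [D / 8], and [e * H1]
   is small enough for [convolution_inverse_bound]. *)
pose u := Num.min (D / 16) (1 / 8) / H1.
have m0 : 0 < Num.min (D / 16) (1 / 8) by rewrite lt_min; apply/andP; split; lra.
have u0 : 0 < u by rewrite divr_gt0.
have uH : u * H1 = Num.min (D / 16) (1 / 8) by rewrite mulfVK ?gt_eqF.
have uH16 : u * H1 <= D / 16 by rewrite uH ge_min lexx.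
have uH8 : u * H1 <= 1 / 8 by rewrite uH ge_min lexx orbT.
have u_le : u <= u * H1 by rewrite ler_peMr // ltW.
have uwn : u * wnorm h <= u * H1 by rewrite ler_wpM2l // ltW.
have H1E : H1 = \sum_(i < size h) \sum_(j < size h) cabs h`_(i + j) by [].
clearbody u; clearbody H1.
have [|||||A [B0 HAB]] := @derivative_bounds_on_circle R a c D D_gt0 a_bound
  c_bound a_c_agree u h => //; try lra.
pose phi := conformal_poly h (1 - u) (2 * u).
have phiE : phi = rc (1 - u) *: 'X + 'X * (rc (2 * u) *: h).
  by rewrite /phi /conformal_poly -scalerAr.
have phi0 : phi`_0 = 0.
  by rewrite phiE coefD coefZ coefX coefXM mulr0 addr0.
exists h, (1 - u), (2 * u), (4 * A), (1 + wnorm phi * (4 * (`|B0| + 1))).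
split; first by rewrite -H1E; split => //; lra.
split.
  rewrite lerDl mulr_ge0 ?wnorm_ge0 // mulr_ge0 // addr_ge0 //.
(* The displacement is divisible by [X], so coefficients up to [n] involve only the terms [i <= n]
   of the expansion, hence derivatives of order at most [k + n]. This decides how far to
   truncate. *)
move=> k n; pose K := (k + n)%N; have [M0 HM0] := HAB K.
pose M := maxn M0 (k + n).+1.
have ltnM : (n < M)%N by rewrite /M; lia.
rewrite (partial_sum_nderivn_comp a k phi0 ltnM).
have A0 : 0 <= A.
  have [b [_ _ /(_ 0%N (leq0n _)) HA0]] := HM0 M (leq_maxl _ _) 1 (cabs1 R).
  by move: HA0; rewrite expr0 !mulr1; apply: le_trans (cabs_ge0 _).
apply: le_trans (_ : wnorm phi ^+ k *
   (4 * A * (4 * (`|B0| + 1)) ^+ k) <= _); last first.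
  rewrite mulrCA -exprMn ler_wpM2l //; first by lra.
  have ge0 : 0 <= wnorm phi * (4 * (`|B0| + 1)).
    by rewrite mulr_ge0 ?wnorm_ge0 // mulr_ge0 // addr_ge0.
  by rewrite lerXn2r ?nnegrE ?addr_ge0 // lerDr.
apply: wnorm_coefXM => j le_jn.
pose f := (partial_sum M a)^`N(k).
pose P := \sum_(i < n.+1) (f^`N(i) \Po (rc (1 - u) *: 'X)) *
    ('X * (rc (2 * u) *: h)) ^+ i.
have -> : (f \Po phi)`_j = P`_j.
  rewrite phiE comp_poly_taylor.
  pose G i := ((f^`N(i) \Po (rc (1 - u) *: 'X)) *
    ('X * (rc (2 * u) *: h)) ^+ i)`_j.
  rewrite !coef_sum.
  rewrite -!(big_mkord xpredT G).
  have G0 i : (n < i)%N -> G i = 0.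
    by move=> lt_ni; rewrite /G coef_mulXexp //; apply: leq_ltn_trans lt_ni.
  have G0' i : (size f <= i)%N -> G i = 0.
    by move=> le_fi; rewrite /G nderivn_poly0 // comp_poly0 mul0r coef0.
  have widen m m' : (m <= m')%N -> (forall i, (m <= i)%N -> G i = 0) ->
      \sum_(0 <= i < m) G i = \sum_(0 <= i < m') G i.
    move=> le_mm' Gm; rewrite [RHS](@big_cat_nat _ _ _ m) //= [X in _ + X]big_nat_cond.
    by rewrite [X in _ + X]big1 ?addr0 // => i /andP[/andP[/Gm ->]].
  by rewrite (widen _ (maxn (size f) n.+1)) ?leq_maxl // (widen n.+1 (maxn (size f) n.+1)) ?leq_maxr.
apply: coef_le_circle => t t1.
have [b [/andP[b0 bB] bdisp HA]] := HM0 M (leq_maxl _ _) t t1.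
rewrite horner_sum; apply: le_trans (ler_cabs_sum _ _ _) _.
set x := cabs (rc (2 * u) * t * h.[t]) in bdisp.
have x0 : 0 <= x by apply: cabs_ge0.
apply: le_trans (_ : \sum_(i < n.+1) A * b ^+ k *
     ('C(k + i, i)%:R * (b * x) ^+ i) <= _).
  apply: ler_sum => i _; rewrite hornerM horner_exp cabsM cabsX.
  have -> : ('X * (rc (2 * u) *: h)).[t] = rc (2 * u) * t * h.[t].
    by rewrite hornerM hornerX hornerZ mulrCA mulrA.
  rewrite -/x horner_comp hornerZ hornerX nderivn_nderivn hornerMn.
  rewrite -mulr_natl cabsM cabs_nat.
  have -> : A * b ^+ k * ('C(k + i, i)%:R * (b * x) ^+ i) =
    'C(k + i, i)%:R * (A * b ^+ (k + i)) * x ^+ i by rewrite exprMn exprD; ring.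
  rewrite ler_wpM2r ?exprn_ge0 // ler_wpM2l // HA //.
  by rewrite leq_add2l -ltnS.
rewrite -mulr_sumr.
have bx0 : 0 <= b * x by rewrite mulr_ge0.
have bx1 : b * x < 1 by lra.
have Ab0 : 0 <= A * b ^+ k by rewrite mulr_ge0 ?exprn_ge0.
apply: le_trans (ler_wpM2l Ab0 (sum_binomial_geometric k n.+1 bx0 bx1)) _.
have inv_le : (1 - b * x)^-1 <= 4.
  by rewrite -[leRHS]invrK lef_pV2 ?posrE; lra.
have inv_ge0 : 0 <= (1 - b * x)^-1 by rewrite invr_ge0; lra.
apply: le_trans (_ : A * b ^+ k * 4 ^+ k.+1 <= _).
  by rewrite ler_wpM2l // lerXn2r ?nnegrE.
rewrite [4 ^+ _]exprS exprMn mulrA.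
have -> : A * b ^+ k * 4 * 4 ^+ k = 4 * A * (4 ^+ k * b ^+ k) by ring.
rewrite ler_wpM2l //; first by lra.
rewrite ler_wpM2l ?exprn_ge0 // lerXn2r ?nnegrE ?addr_ge0 //.
apply: le_trans bB _; apply: le_trans (ler_norm _) _; lra.
Qed.

End Bound.
End Composition.

Section Hankel.
Variable R : realType.
Local Notation C := (CC R).

Lemma det_le_factorial m (A : 'M[C]_m) (E : R) : (forall i j, cabs (A i j) <= E) ->
  cabs (\det A) <= m`!%:R * E ^+ m.
Proof.
move=> AE; apply: le_trans (ler_cabs_sum _ _ _) _.
apply: le_trans (_ : \sum_(s : 'S_m) E ^+ m <= _).
  apply: ler_sum => s _; rewrite cabsM cabsX cabsN cabs1 expr1n mul1r cabs_prod.
  have -> : E ^+ m = \prod_(i < m) E by rewrite prodr_const card_ord.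
  by apply: ler_prod => i _; rewrite cabs_ge0 AE.
by rewrite sumr_const card_Sn mulr_natl.
Qed.

(* Weights are expanded in binomials because [\sum_s 'C(s, k) a_s z ^ s] is
   [z ^ k] times the [k]-th divided derivative of [f]. *)
Lemma binomial_expansion_bound (xs : seq C) (N : R) :
  all (fun x => cabs x <= N) xs -> (size xs)%:R <= N ->
  exists w : nat -> C,
    [/\ forall n, \prod_(x <- xs) (n%:R - x) =
          \sum_(k < (size xs).+1) w k * 'C(n, k)%:R,
        forall k, (size xs < k)%N -> w k = 0 &
        forall k, cabs (w k) <= (3 * N) ^+ size xs].
Proof.
elim: xs => [|x xs IH] /=.
  move=> _ _; exists (fun k => (k == 0)%:R); split => [n|[]//|k].
    by rewrite big_nil big_ord_recl big_ord0 bin0 mulr1 addr0.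
  by rewrite expr0; case: k => [|k] /=; rewrite ?cabs1 // cabs0.
case/andP=> xN xsN; rewrite -natr1 => szN.
have [|w [wE w0 wN]] := IH xsN; first by lra.
have N0 : 0 <= N by apply: le_trans xN; apply: cabs_ge0.
exists (fun k => (if k is k'.+1 then k%:R * w k' else 0) + (k%:R - x) * w k).
split.
- move=> n; rewrite big_cons wE mulr_sumr.
  have -> : \sum_(i < (size xs).+1) (n%:R - x) * (w i * 'C(n, i)%:R) =
    \sum_(i < (size xs).+1) (i.+1%:R * w i * 'C(n, i.+1)%:R) +
    \sum_(i < (size xs).+1) ((i%:R - x) * w i * 'C(n, i)%:R).
    rewrite -big_split /=; apply: eq_bigr => i _.
    have -> : i.+1%:R * w i * 'C(n, i.+1)%:R =
        w i * (i.+1 * 'C(n, i.+1))%:R by rewrite natrM; ring.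
    rewrite mul_bin_left; have [le_in|lt_ni] := leqP i n.
      by rewrite natrM natrB //; ring.
    by rewrite bin_small // muln0; ring.
  rewrite [RHS](eq_bigr (fun k : 'I__ =>
     (if (k : nat) is k'.+1 then k%:R * w k' else 0) * 'C(n, k)%:R +
     (k%:R - x) * w k * 'C(n, k)%:R)); last by move=> k _; rewrite mulrDl.
  rewrite big_split /= [X in _ = X + _]big_ord_recl mul0r add0r.
  rewrite [X in _ = _ + X]big_ord_recr /= w0 // mulr0 mul0r addr0.
  by congr (_ + _); apply: eq_bigr.
- by move=> [//|k] lt_sk; rewrite !w0 ?mulr0 ?addr0 // ltnW.
move=> k; have [lt_sk|le_ks] := ltnP (size xs).+1 k.
  case: k lt_sk => // k lt_sk.
  by rewrite !w0 ?mulr0 ?addr0 ?cabs0 ?exprn_ge0 ?mulr_ge0 // ltnW.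
have kN : k%:R <= N by apply: le_trans szN; rewrite natr1 ler_nat.
set E := (3 * N) ^+ size xs in wN *.
have E0 : 0 <= E by rewrite exprn_ge0 ?mulr_ge0.
have H1 : cabs (if k is k'.+1 then k%:R * w k' else 0) <= N * E.
  case: k kN {le_ks} => [|k] kN; first by rewrite cabs0 mulr_ge0.
  by rewrite cabsM cabs_nat ler_pM ?cabs_ge0 ?ler0n.
have H2 : cabs ((k%:R - x) * w k) <= 2 * N * E.
  rewrite cabsM ler_pM ?cabs_ge0 //; apply: le_trans (ler_cabsB _ _) _.
  by rewrite cabs_nat; lra.
apply: le_trans (ler_cabsD _ _) _; rewrite exprS -/E.
by apply: le_trans (lerD H1 H2) _; lra.
Qed.

Lemma weighted_composition_bound (a : nat -> C) (phi : {poly C}) (A B N : R)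
    (xs : seq C) :
  1 <= B -> all (fun x => cabs x <= N) xs -> (size xs)%:R <= N ->
  (forall k n, cabs (\sum_(s < n.+1) 'C(s, k)%:R * a s * (phi ^+ s)`_n)
     <= A * B ^+ k) ->
  forall n, cabs (\sum_(s < n.+1) (\prod_(x <- xs) (s%:R - x)) * a s *
      (phi ^+ s)`_n) <= (size xs).+1%:R * A * (3 * N * B) ^+ size xs.
Proof.
move=> B1 xsN szN aE n.
have [w [wE _ wN]] := binomial_expansion_bound xsN szN.
have A0 : 0 <= A by have := aE 0 0; rewrite expr0 mulr1; apply: le_trans (cabs_ge0 _).
have N0 : 0 <= N by apply: le_trans szN.
have -> : \sum_(s < n.+1) (\prod_(x <- xs) (s%:R - x)) * a s * (phi ^+ s)`_n =
  \sum_(k < (size xs).+1)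
     w k * \sum_(s < n.+1) 'C(s, k)%:R * a s * (phi ^+ s)`_n.
  under [RHS]eq_bigr do rewrite mulr_sumr.
  rewrite exchange_big; apply: eq_bigr => s _; rewrite wE !mulr_suml.
  by apply: eq_bigr => k _; rewrite !mulrA.
apply: le_trans (ler_cabs_sum _ _ _) _.
apply: le_trans (_ : \sum_(k < (size xs).+1) A * (3 * N * B) ^+ size xs <= _);
  last by rewrite sumr_const card_ord -[leLHS]mulr_natl mulrA.
apply: ler_sum => k _; rewrite cabsM exprMn mulrCA.
apply: ler_pM (wN k) _; rewrite ?cabs_ge0 //; apply: le_trans (aE _ _) _.
by rewrite ler_wpM2l // ler_weXn2l // -ltnS.
Qed.

(* [(p(x) - p(y)) / (x - y)], with ['X%:P] as [x] and ['X] as [y]; for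
   [p = \sum_s b_s X ^ s.+1] it generates the Hankel matrix of [b]. *)
Definition divided_difference (p : {poly C}) : {poly {poly C}} :=
  \poly_(l < size p) \poly_(k < size p) p`_(k + l).+1.

Lemma coef_divided_difference p k l : (divided_difference p)`_l`_k = p`_(k + l).+1.
Proof.
rewrite coef_poly; case: ltnP => [_|le_pl].
  rewrite coef_poly; case: ltnP => // le_pk.
  by rewrite nth_default // -addnS (leq_trans le_pk) ?leq_addr.
rewrite coef0 nth_default // (leq_trans le_pl) //.
by rewrite -addSn leq_addl.
Qed.

Lemma divided_differenceE p :
  ('X%:P - 'X) * divided_difference p = p%:P - map_poly polyC p.
Proof.
apply/polyP => l; apply/polyP => k.
rewrite mulrBl coefB coefCM coefXM coefB coefXM coefB coefC coef_map /=.
rewrite coef_divided_difference.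
case: k => [|k]; case: l => [|l] /=;
  rewrite ?coef0 ?coef_divided_difference ?coefB ?coefC ?coef0 //=;
  by rewrite ?add0n ?addn0 ?addnS ?addSn ?subrr ?subr0.
Qed.

(** Factor [p(x) ^ s.+1 - p(y) ^ s.+1] and cancel [x - y]. *)
Lemma divided_difference_mul (p : {poly C}) s :
  divided_difference p * \sum_(i < s.+1)
    (p ^+ (s - i))%:P * map_poly polyC (p ^+ i) =
  divided_difference (p ^+ s.+1).
Proof.
have X0 : 'X%:P - 'X != 0 :> {poly {poly C}}.
  rewrite subr_eq0; apply/negP => /eqP/(congr1 (fun q : {poly {poly C}} => q`_1)).
  by rewrite coefC coefX /= => /eqP; rewrite eq_sym oner_eq0.
apply: (mulfI X0); rewrite mulrA !divided_differenceE.
rewrite (rmorphXn polyC) (rmorphXn (map_poly polyC)) /= subrXX; congr (_ * _).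
by apply: eq_bigr => i _; rewrite !rmorphXn.
Qed.

(** The combination bounded by [G] is the product of the generating function of [F] with the divided
    difference of [conformal_poly h r e]. That factor is invertible in the sup norm: the largest
    modulus [S] of the [F k l] satisfies [S * r <= G + r / 2 * S]. *)
Lemma convolution_inverse_bound (h : {poly C}) (F : nat -> nat -> C) (r e G : R) L :
  0 < r -> 0 <= e -> 0 <= G ->
  e * (\sum_(i < size h) \sum_(j < size h) cabs h`_(i + j)) <= r / 2 ->
  (forall k l, (k < L)%N -> (l < L)%N ->
     cabs (rc r * F k l + rc e * \sum_(i < k.+1) \sum_(j < l.+1)
        h`_(i + j) * F (k - i)%N (l - j)%N) <= G) ->
  forall k l, (k < L)%N -> (l < L)%N -> cabs (F k l) <= 2 * G / r.
Proof.
move=> r0 e0 G0 h_small F_eq.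
pose S : R := \big[Num.max/0]_(k < L) \big[Num.max/0]_(l < L) cabs (F k l).
have S0 : 0 <= S by rewrite /S; elim/big_rec: _ => // i x _ x0; rewrite le_max x0 orbT.
have FS k l : (k < L)%N -> (l < L)%N -> cabs (F k l) <= S.
  move=> kL lL; rewrite /S (bigD1 (Ordinal kL)) //= le_max.
  by rewrite (bigD1 (Ordinal lL)) //= le_max lexx.
have hS k l : \sum_(i < k.+1) \sum_(j < l.+1) cabs h`_(i + j) <=
    \sum_(i < size h) \sum_(j < size h) cabs h`_(i + j).
  have inner i m : \sum_(j < m) cabs h`_(i + j) <= \sum_(j < size h) cabs h`_(i + j).
    pose g j := cabs h`_(i + j).
    apply: le_trans (_ : \sum_(j < maxn m (size h)) g j <= _).
      rewrite -!(big_mkord xpredT g) [leRHS](@big_cat_nat _ _ _ m) ?leq_maxl //=.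
      by rewrite lerDl sumr_ge0 // => j _; apply: cabs_ge0.
    rewrite -!(big_mkord xpredT g) [leLHS](@big_cat_nat _ _ _ (size h)) ?leq_maxr //=.
    rewrite gerDl [leLHS]big_nat_cond big1 // => j /andP[/andP[le_hj _] _].
    by rewrite /g nth_default ?cabs0 // (leq_trans le_hj) // leq_addl.
  pose g i := \sum_(j < size h) cabs h`_(i + j).
  apply: le_trans (_ : \sum_(i < k.+1) g i <= _); first by apply: ler_sum.
  apply: le_trans (_ : \sum_(j < maxn k.+1 (size h)) g j <= _).
    rewrite -!(big_mkord xpredT g) [leRHS](@big_cat_nat _ _ _ k.+1) ?leq_maxl //=.
    by rewrite lerDl sumr_ge0 // => j _; apply: sumr_ge0 => i _; apply: cabs_ge0.
  rewrite -!(big_mkord xpredT g) [leLHS](@big_cat_nat _ _ _ (size h)) ?leq_maxr //=.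
  rewrite gerDl [leLHS]big_nat_cond big1 // => j /andP[/andP[le_hj _] _].
  apply: big1 => i _.
  by rewrite nth_default ?cabs0 // (leq_trans le_hj) // leq_addr.
have step k l : (k < L)%N -> (l < L)%N -> cabs (F k l) * r <= G + r / 2 * S.
  move=> kL lL; set X := \sum_(i < k.+1) \sum_(j < l.+1) h`_(i + j) * F (k - i)%N (l - j)%N.
  have X_le : cabs (rc e * X) <= r / 2 * S.
    rewrite cabsM cabs_rc_ge0 //.
    apply: le_trans (_ : e * ((\sum_(i < k.+1) \sum_(j < l.+1) cabs h`_(i + j)) * S) <= _).
      rewrite ler_wpM2l // mulr_suml; apply: le_trans (ler_cabs_sum _ _ _) _.
      apply: ler_sum => i _; rewrite mulr_suml; apply: le_trans (ler_cabs_sum _ _ _) _.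
      apply: ler_sum => j _; rewrite cabsM ler_wpM2l ?cabs_ge0 // FS //.
        by rewrite (leq_ltn_trans (leq_subr _ _)).
      by rewrite (leq_ltn_trans (leq_subr _ _)).
    rewrite mulrA ler_wpM2r //; apply: le_trans h_small.
    by rewrite ler_wpM2l.
  have -> : cabs (F k l) * r = cabs ((rc r * F k l + rc e * X) - rc e * X).
    by rewrite addrK cabsM cabs_rc_ge0 ?(ltW r0) // mulrC.
  by apply: le_trans (ler_cabsB _ _) _; apply: lerD; rewrite ?F_eq.
have S_le : S * r <= G + r / 2 * S.
  have rhs0 : 0 <= G + r / 2 * S by rewrite addr_ge0 // mulr_ge0 // divr_ge0 // ltW.
  rewrite -ler_pdivlMr //; rewrite {1}/S; elim/big_ind: _.
  - by rewrite divr_ge0 // ltW.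
  - by move=> x y x_le y_le; rewrite ge_max x_le.
  move=> k _; elim/big_ind: _.
  - by rewrite divr_ge0 // ltW.
  - by move=> x y x_le y_le; rewrite ge_max x_le.
  by move=> l _; rewrite ler_pdivlMr // step.
move=> k l kL lL; apply: le_trans (FS k l kL lL) _.
rewrite ler_pdivlMr //; lra.
Qed.

(* With [T] the triangular matrix of the coefficients of the powers of [phi],
   [T^T A T] generates [(g(phi x) - g(phi y)) / (phi x - phi y)], [g = X b]: its
   entries are bounded by [convolution_inverse_bound], while
   [\det T = (r + e) ^ (m (m - 1) / 2)]. *)
Lemma hankel_det_bound (b : nat -> C) (h : {poly C}) (r e G : R) m :
  let phi := conformal_poly h r e in
  0 < r -> 0 <= e -> h`_0 = 1 ->
  e * (\sum_(i < size h) \sum_(j < size h) cabs h`_(i + j)) <= r / 2 ->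
  (forall n, cabs (\sum_(s < n.+1) b s * (phi ^+ s)`_n) <= G) ->
  cabs (\det (\matrix_(i < m, j < m) b (i + j)%N)) *
    (r + e) ^+ (\sum_(i < m) i).*2 <= m`!%:R * (2 * (wnorm phi * G) / r) ^+ m.
Proof.
move=> phi r0 e0 h0 h_small bG.
have phiE : phi = 'X * ((rc r)%:P + rc e *: h).
  by rewrite /phi /conformal_poly mulrDr -scalerAr [_ * _%:P]mulrC mul_polyC.
have phi_lt s n : (n < s)%N -> (phi ^+ s)`_n = 0.
  by move=> lt_ns; rewrite phiE exprMn coefXnM lt_ns.
have phi_diag s : (phi ^+ s)`_s = rc (r + e) ^+ s.
  rewrite phiE exprMn coefXnM ltnn subnn -!horner_coef0 horner_exp hornerD.
  by rewrite hornerC hornerZ horner_coef0 h0 mulr1 rmorphD.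
pose M := (m + m)%N.
pose F : {poly {poly C}} := \sum_(s < M) (b s)%:P%:P *
  \sum_(i < s.+1) (phi ^+ (s - i))%:P * map_poly polyC (phi ^+ i).
have FE : divided_difference phi * F =
    divided_difference (\sum_(s < M) b s *: phi ^+ s.+1).
  have -> : divided_difference (\sum_(s < M) b s *: phi ^+ s.+1) =
      \sum_(s < M) (b s)%:P%:P * divided_difference (phi ^+ s.+1).
    apply/polyP => l; apply/polyP => k; rewrite coef_divided_difference.
    rewrite !coef_sum; apply: eq_bigr => s _.
    by rewrite coefZ !coefCM coef_divided_difference.
  rewrite mulr_sumr; apply: eq_bigr => s _.
  by rewrite mulrCA divided_difference_mul.
have G0 : 0 <= G by apply: le_trans (bG 0%N); apply: cabs_ge0.
have Gamma_le k l : (k < m)%N -> (l < m)%N ->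
    cabs (divided_difference (\sum_(s < M) b s *: phi ^+ s.+1))`_l`_k <=
      wnorm phi * G.
  move=> km lm; rewrite coef_divided_difference.
  have -> : \sum_(s < M) b s *: phi ^+ s.+1 = phi * \sum_(s < M) b s *: phi ^+ s.
    by rewrite mulr_sumr; apply: eq_bigr => s _; rewrite -scalerAr exprS.
  have -> : (phi * \sum_(s < M) b s *: phi ^+ s)`_(k + l).+1 =
     (((rc r)%:P + rc e *: h) * \sum_(s < M) b s *: phi ^+ s)`_(k + l).
    by rewrite {1}phiE -mulrA coefXM.
  have -> : wnorm phi = wnorm ((rc r)%:P + rc e *: h).
    by rewrite phiE wnorm_mulX.
  apply: wnorm_coefM => j le_j.
  apply: le_trans (bG j); rewrite coef_sum.
  have ltjM : (j < M)%N by rewrite /M; lia.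
  rewrite [leRHS](_ : _ = cabs (\sum_(s < M) (b s *: phi ^+ s)`_j)) //; congr cabs.
  rewrite (big_ord_widen_cond M xpredT (fun s => b s * (phi ^+ s)`_j)) //=.
  rewrite [RHS](bigID (fun s : 'I_M => (s < j.+1)%N)) /= [X in _ = _ + X]big1 ?addr0.
    by apply: eq_bigr => s _; rewrite coefZ.
  by move=> s; rewrite -leqNgt => lt_js; rewrite coefZ phi_lt ?mulr0.
have F_le k l : (k < m)%N -> (l < m)%N -> cabs F`_l`_k <= 2 * (wnorm phi * G) / r.
  apply: (@convolution_inverse_bound h (fun k l => F`_l`_k) r e) => //.
    by rewrite mulr_ge0 ?wnorm_ge0.
  move=> k' l' km lm; have := Gamma_le k' l' km lm; rewrite -FE.
  congr (cabs _ <= _); rewrite coefM coef_sum.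
  under eq_bigr => j _.
    rewrite coefM.
    under eq_bigr => i _ do rewrite coef_divided_difference phiE coefXM /= coefD coefC coefZ mulrDl.
    rewrite big_split /=; over.
  rewrite big_split /=; congr (_ + _).
    rewrite big_ord_recl big_ord_recl /= !subn0 big1 ?addr0 => [|i _]; last by rewrite mul0r.
    rewrite big1 ?addr0 // => j _; apply: big1 => i _.
    by rewrite addn_eq0 /= andbF mul0r.
  rewrite exchange_big /= mulr_sumr; apply: eq_bigr => i _.
  by rewrite mulr_sumr; apply: eq_bigr => j _; rewrite -mulrA.
pose T : 'M[C]_m := \matrix_(i, k) (phi ^+ i)`_k.
pose A : 'M[C]_m := \matrix_(i, j) b (i + j)%N.
(* [phi ^+ i] has no coefficient below [i], so in the coefficients of [F] with both indices below
   [m] only the terms with [i, j < m] survive. *)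
have TE : T^T *m A *m T = \matrix_(k, l) F`_l`_k.
  apply/matrixP => k l; rewrite !mxE /F coef_sum coef_sum.
  have -> : \sum_(j < m) (T^T *m A) k j * T j l =
     \sum_(j < m) \sum_(i < m) b (i + j)%N * ((phi ^+ i)`_k * (phi ^+ j)`_l).
    apply: eq_bigr => j _; rewrite mxE mulr_suml; apply: eq_bigr => i _.
    by rewrite !mxE; ring.
  have -> : \sum_(s < M) ((b s)%:P%:P * \sum_(i < s.+1)
       (phi ^+ (s - i))%:P * map_poly polyC (phi ^+ i))`_l`_k =
     \sum_(s < M) \sum_(j < m | (j <= s)%N) b s * ((phi ^+ (s - j))`_k * (phi ^+ j)`_l).
    apply: eq_bigr => s _; rewrite !coefCM !coef_sum mulr_sumr.
    pose g j := b s * ((phi ^+ (s - j))`_k * (phi ^+ j)`_l).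
    transitivity (\sum_(i < s.+1) g i).
      by apply: eq_bigr => i _; rewrite coefCM coef_map /= coefMC.
    have g0 j : (m <= j)%N -> g j = 0.
      by move=> le_mj; rewrite /g (phi_lt j) ?mulr0 // (leq_trans _ le_mj).
    transitivity (\sum_(i < maxn m s.+1 | (i < s.+1)%N) g i).
      by rewrite (big_ord_widen_cond (maxn m s.+1) xpredT g) ?leq_maxr.
    by rewrite -(sum_ord_extend (fun i => (i < s.+1)%N) (leq_maxl m s.+1)) // => i /g0.
  rewrite [RHS](exchange_big_dep xpredT) //=; apply: eq_bigr => j _.
  pose g i := b (i + j)%N * ((phi ^+ i)`_k * (phi ^+ j)`_l).
  transitivity (\sum_(s < M | (j <= s)%N) g (s - j)%N); last first.
    by apply: eq_bigr => s le_js; rewrite /g subnK.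
  transitivity (\sum_(0 <= i < m) g i); first by rewrite big_mkord.
  have -> : \sum_(s < M | (j <= s)%N) g (s - j)%N = \sum_(j <= s < M) g (s - j)%N.
    rewrite -(big_mkord (fun s => (j <= s)%N) (fun s => g (s - j)%N)).
    rewrite (@big_cat_nat _ _ _ j) //=; last by rewrite /M; have := ltn_ord j; lia.
    rewrite big_nat_cond big1 ?add0r; last by move=> i; case/andP=> /andP[_]; lia.
    by rewrite big_nat_cond [RHS]big_nat_cond; apply: eq_bigl => i; lia.
  have -> : \sum_(j <= s < M) g (s - j)%N = \sum_(0 <= i < M - j) g i.
    rewrite -[X in \sum_(X <= _ < _) _](add0n j) big_addn.
    by under eq_bigr do rewrite addnK.
  rewrite [RHS](@big_cat_nat _ _ _ m) //=; last by rewrite /M; have := ltn_ord j; lia.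
  rewrite [X in _ = _ + X]big_nat_cond [X in _ = _ + X]big1 ?addr0 //.
  move=> i /andP[/andP[le_mi _] _]; rewrite /g phi_lt ?mul0r ?mulr0 //.
  by rewrite (leq_trans _ le_mi).
have detT : \det T = rc (r + e) ^+ (\sum_(i < m) i).
  rewrite -det_tr det_trig; last first.
    apply/is_trig_mxP => i j lt_ij; rewrite !mxE phi_lt //.
  under eq_bigr do rewrite !mxE phi_diag.
  by rewrite -prodrXr.
have TAT_le k l : cabs ((T^T *m A *m T) k l) <= 2 * (wnorm phi * G) / r.
  by rewrite TE mxE F_le.
have := det_le_factorial TAT_le.
rewrite !det_mulmx det_tr detT !cabsM !cabsX cabs_rc_ge0 ?addr_ge0 ?(ltW r0) //.
by rewrite mulrAC -exprD addnn mulrC.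
Qed.

End Hankel.

Section Continuation.
Variable R : realType.
Local Notation C := (CC R).
Implicit Types (a b c : nat -> C) (z w : C).

Lemma cpseriesE b z n : cpseries b z n = (partial_sum n b).[z].
Proof. by rewrite /cpseries /series /= horner_poly big_mkord. Qed.

Lemma cvg_cabs (u : nat -> C) (l : C) (e : R) : u n @[n --> \oo] --> l -> 0 < e ->
  exists N, forall n, (N <= n)%N -> cabs (u n - l) <= e.
Proof.
move=> ul e0; have e0' : 0 < rc e by rewrite -(rmorph0 (@rc R)) ltr_rc.
have [N _ HN] : \forall n \near \oo, `|l - u n| <= rc e.
  by move/cvgrPdist_le: ul; apply.
by exists N => n /HN; rewrite /= ler_cabs cabs_distC.
Qed.

Lemma cvg_cpseries_bounded b z (l : C) : cpseries b z n @[n --> \oo] --> l ->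
  exists A, forall n, cabs (b n) * cabs z ^+ n <= A.
Proof.
move=> bl; have [N HN] := cvg_cabs bl ltr01.
exists (2 + \sum_(i < N) cabs (b i * z ^+ i)) => n.
rewrite -cabsX -cabsM; have [lt_nN|le_Nn] := ltnP n N.
  rewrite (bigD1 (Ordinal lt_nN)) //= addrCA lerDl addr_ge0 //.
  by apply: sumr_ge0 => i _; apply: cabs_ge0.
have -> : b n * z ^+ n = (cpseries b z n.+1 - l) - (cpseries b z n - l).
  by rewrite /cpseries /series /= big_nat_recr //=; ring.
apply: le_trans (ler_cabsB _ _) _.
have := HN n le_Nn; have := HN n.+1 (leqW le_Nn).
have : 0 <= \sum_(i < N) cabs (b i * z ^+ i).
  by apply: sumr_ge0 => i _; apply: cabs_ge0.
lra.
Qed.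

Lemma cvg_disk_bounded b : (forall z, `|z| < 1 -> cvgn (cpseries b z)) ->
  forall x : R, 0 < x < 1 -> exists A, forall n, cabs (b n) * x ^+ n <= A.
Proof.
move=> b_cvg x /andP[x0 x1]; have xE : cabs (rc x) = x by rewrite cabs_rc_ge0 ?ltW.
have /cvg_ex[l /cvg_cpseries_bounded[A HA]] : cvgn (cpseries b (rc x)).
  by apply: b_cvg; rewrite -(rmorph1 (@rc R)) ltr_cabs xE.
by exists A => n; have := HA n; rewrite xE.
Qed.

Lemma partial_sum_rotate b w z n : (partial_sum n (fun k => b k * w ^+ k)).[z] = (partial_sum n b).[w * z].
Proof.
by rewrite !horner_poly; apply: eq_bigr => i _; rewrite exprMn mulrA.
Qed.

(** Rotating by [w] moves the point to 1. The radius of the neighbourhood is halved so that the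
    local series still converges at [w + D], which gives the bound on [c]. *)
Lemma continuation_local_series a w : `|w| = 1 ->
  (forall z, `|z| < 1 -> cvgn (cpseries a z)) ->
  continues_analytically_at a w ->
  exists (c : nat -> C) (D : R), [/\ 0 < D,
    exists A, forall n, cabs (c n) * D ^+ n <= A &
    forall (z : C) (e : R), cabs z < 1 -> cabs (z - 1) < D -> 0 < e ->
    exists N, forall M, (N <= M)%N ->
      cabs ((partial_sum M (fun k => a k * w ^+ k)).[z] - (partial_sum M c).[z - 1]) <= e].
Proof.
move=> w1 a_cvg [U [g [U_open Uw g_an ag]]].
have w1' : cabs w = 1 by apply/eqP; rewrite -norm1_cabs w1.
have [c c_near] := g_an w Uw.
have U_near : nbhs w U by apply: open_nbhs_nbhs.
have /nbhs_ballP[e /= e0 He] : \forall z \near w,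
    U z /\ cpseries c (z - w) n @[n --> \oo] --> g z.
  by apply: filterS2 U_near c_near => z.
have eE : e = rc (cabs e) by rewrite -cabsE gtr0_norm.
have ce0 : 0 < cabs e by rewrite lt_def cabs_ge0 cabs_eq0 gt_eqF.
have ballE z : cabs (z - w) < cabs e -> ball w e z.
  by move=> zwe; rewrite -ball_normE /= distrC [ltRHS]eE ltr_cabs.
pose D := cabs e / 2; have D0 : 0 < D by rewrite divr_gt0.
exists (fun k => c k * w ^+ k), D; split => //.
  have zE : cabs (w + rc D - w) = D by rewrite addrAC subrr add0r cabs_rc_ge0 ?ltW.
  have [|_ cz] := He (w + rc D); first by apply: ballE; rewrite zE /D; lra.
  have [A HA] := cvg_cpseries_bounded cz.
  by exists A => n; have := HA n; rewrite zE cabsM cabsX w1' expr1n mulr1.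
move=> z d z1 zD d0.
have wz1 : `|w * z| < 1 by rewrite -(rmorph1 (@rc R)) ltr_cabs cabsM w1' mul1r.
have wzD : cabs (w * z - w) < cabs e.
  rewrite -[X in _ - X]mulr1 -mulrBr cabsM w1' mul1r; apply: lt_trans zD _.
  by rewrite /D; lra.
have [Uwz cz] := He _ (ballE _ wzD).
have d2 : 0 < d / 2 by rewrite divr_gt0.
have [N1 HN1] := cvg_cabs cz d2; have [N2 HN2] := cvg_cabs (ag _ Uwz wz1) d2.
exists (maxn N1 N2) => M; rewrite geq_max => /andP[/HN1 H1 /HN2 H2].
rewrite !partial_sum_rotate mulrBr mulr1 -!cpseriesE.
have -> : cpseries a (w * z) M - cpseries c (w * z - w) M =
  (cpseries a (w * z) M - g (w * z)) - (cpseries c (w * z - w) M - g (w * z)) by ring.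
apply: le_trans (ler_cabsB _ _) _; lra.
Qed.

(** The rotation multiplies the Hankel matrix on both sides by a diagonal matrix whose determinant
    has modulus 1. *)
Lemma cabs_det_rotate b w m : cabs w = 1 ->
  cabs (\det (\matrix_(i < m, j < m) (b (i + j)%N * w ^+ (i + j)))) =
  cabs (\det (\matrix_(i < m, j < m) b (i + j)%N)).
Proof.
move=> w1; pose d : 'rV[C]_m := \row_i w ^+ i.
have -> : \matrix_(i < m, j < m) (b (i + j)%N * w ^+ (i + j)) =
    diag_mx d *m (\matrix_(i < m, j < m) b (i + j)%N) *m diag_mx d.
  apply/matrixP => i j; rewrite mul_mx_diag mul_diag_mx !mxE exprD.
  by rewrite mulrCA mulrA.
rewrite !det_mulmx !cabsM det_diag cabs_prod big1 ?mul1r ?mulr1 //.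
by move=> i _; rewrite mxE cabsX w1 expr1n.
Qed.

(** The continuation across [w] enters the arithmetic argument only through this bound. The
    constants depend on the series and on [w] alone, so they serve all weights, all [m], and the
    second round, where [xs] is empty. *)
Lemma hankel_analytic_bound a w : `|w| = 1 ->
  (forall z, `|z| < 1 -> cvgn (cpseries a z)) ->
  continues_analytically_at a w ->
  exists kappa A B : R, [/\ 1 < kappa, 0 <= A, 1 <= B &
    forall (N : R) (xs : seq C) m,
      all (fun x => cabs x <= N) xs -> (size xs)%:R <= N ->
      cabs (\det (\matrix_(i < m, j < m)
         ((\prod_(x <- xs) ((i + j)%N%:R - x)) * a (i + j)%N))) *
        kappa ^+ (\sum_(i < m) i).*2 <=
      m`!%:R * (A * (size xs).+1%:R * (B * N) ^+ size xs) ^+ m].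
Proof.
move=> w1 a_cvg a_cont.
have w1' : cabs w = 1 by apply/eqP; rewrite -norm1_cabs w1.
have [c [D [D0 c_bound agree]]] := continuation_local_series w1 a_cvg a_cont.
pose a' k := a k * w ^+ k.
have a'_bound x : 0 < x < 1 -> exists A, forall n, cabs (a' n) * x ^+ n <= A.
  move=> x01; have [A HA] := cvg_disk_bounded a_cvg x01.
  by exists A => n; rewrite /a' cabsM cabsX w1' expr1n mulr1.
have [h [r [e [A [B [[r0 e0 re1 h0 h_small] [B1 HAB]]]]]]] :=
  conformal_composition_bound D0 a'_bound c_bound agree.
set phi := conformal_poly h r e in HAB.
have A0 : 0 <= A.
  by have := HAB 0%N 0%N; rewrite expr0 mulr1; apply: le_trans; apply: cabs_ge0.
exists (r + e), (2 * wnorm phi * A / r), (3 * B); split => //.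
- by rewrite divr_ge0 ?(ltW r0) // !mulr_ge0 ?wnorm_ge0.
- lra.
move=> N xs m xsN szN.
pose b k := (\prod_(x <- xs) (k%:R - x)) * a k.
rewrite -(cabs_det_rotate b m w1').
have b_bound n : cabs (\sum_(s < n.+1) (b s * w ^+ s) * (phi ^+ s)`_n) <=
    (size xs).+1%:R * A * (3 * N * B) ^+ size xs.
  have := weighted_composition_bound B1 xsN szN HAB n.
  by under eq_bigr do rewrite /a' mulrA.
have := @hankel_det_bound R (fun k => b k * w ^+ k) h r e _ m r0 (ltW e0) h0 h_small b_bound.
rewrite -/phi => /le_trans; apply.
rewrite ler_wpM2l // lerXn2r ?nnegrE //.
- by rewrite divr_ge0 ?(ltW r0) // !mulr_ge0 ?wnorm_ge0 ?exprn_ge0 ?mulr_ge0 ?(le_trans _ szN) ?(le_trans _ B1).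
- rewrite !mulr_ge0 ?exprn_ge0 ?mulr_ge0 ?wnorm_ge0 ?invr_ge0 ?(ltW r0) ?(le_trans _ szN) ?(le_trans _ B1) //.
have -> : 3 * N * B = 3 * B * N by ring.
set X := (3 * B * N) ^+ _; rewrite le_eqVlt; apply/orP; left; apply/eqP.
by ring.
Qed.

End Continuation.

(** * Subexponential growth *)

Section Subexponential.
Variable R : realType.
Implicit Types (u v : nat -> R) (q : R).

(** The growth [e ^ o(n)]. The constant [C] absorbs the finitely many small [n], so that the bounds
    hold for every [n] and multiply without thresholds. *)
Definition subexp u := forall q, 1 < q -> exists C, forall n, u n <= C * q ^+ n.

Lemma subexp_le u v : (forall n, u n <= v n) -> subexp v -> subexp u.
Proof.
move=> uv v_sub q q1; have [C HC] := v_sub q q1.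
by exists C => n; apply: le_trans (uv n) (HC n).
Qed.

Lemma exists_root_gt1 q k : 1 < q -> exists2 x, 1 < x & x ^+ (2 ^ k) = q.
Proof.
elim: k q => [|k IH] q q1; first by exists q.
have q0 : 0 <= q by rewrite ltW // (lt_trans ltr01).
have [|x x1 xE] := IH (Num.sqrt q).
  by rewrite -sqrtr1 ltr_sqrt // (lt_trans ltr01).
by exists x => //; rewrite expnSr exprM xE sqr_sqrtr.
Qed.

Lemma subexp_cst (c : R) : subexp (fun=> c).
Proof.
move=> q q1; exists `|c| => n; apply: le_trans (ler_norm c) _.
by rewrite ler_peMr // exprn_ege1 // ltW.
Qed.

Lemma subexp_ge0 u q C : (forall n, 0 <= u n) -> (forall n, u n <= C * q ^+ n) -> 0 <= C.
Proof. by move=> u0 /(_ 0%N); rewrite expr0 mulr1; apply: le_trans. Qed.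

Lemma subexpM u v : (forall n, 0 <= u n) -> (forall n, 0 <= v n) ->
  subexp u -> subexp v -> subexp (fun n => u n * v n).
Proof.
move=> u0 v0 u_sub v_sub q q1; have [x x1 xE] := exists_root_gt1 1 q1.
have [C HC] := u_sub x x1; have [C' HC'] := v_sub x x1.
exists (C * C') => n; rewrite -xE exprAC expr2 mulrACA.
by apply: ler_pM.
Qed.

Lemma subexpD u v : (forall n, 0 <= u n) -> (forall n, 0 <= v n) ->
  subexp u -> subexp v -> subexp (fun n => u n + v n).
Proof.
move=> u0 v0 u_sub v_sub q q1.
have [C HC] := u_sub q q1; have [C' HC'] := v_sub q q1.
by exists (C + C') => n; rewrite mulrDl lerD.
Qed.

Lemma subexpX u k : (forall n, 0 <= u n) -> subexp u -> subexp (fun n => u n ^+ k).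
Proof.
move=> u0 u_sub; elim: k => [|k IH]; first exact: subexp_cst.
apply: (@subexp_le _ (fun n => u n * u n ^+ k)) => [n|]; first by rewrite exprS.
by apply: subexpM => // n; rewrite exprn_ge0.
Qed.

Lemma subexp_nat : subexp (fun n => n%:R).
Proof.
move=> q q1; have q10 : 0 < q - 1 by rewrite subr_gt0.
exists (q - 1)^-1 => n; rewrite ler_pdivlMl //.
elim: n => [|n IH]; first by rewrite mulr0 expr0.
have qn1 : 1 <= q ^+ n by rewrite exprn_ege1 // ltW.
rewrite exprS -natr1 mulrDr mulr1.
have : 0 <= (q - 1) * (q ^+ n - 1) by rewrite mulr_ge0 ?subr_ge0 // ltW.
rewrite mulrBr mulr1 mulrBl mul1r; lra.
Qed.

Lemma near_subexp u : (forall q, 1 < q -> \forall n \near \oo, u n <= q ^+ n) -> subexp u.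
Proof.
move=> u_near q q1; have [N _ HN] := u_near q q1.
exists (1 + \sum_(i < N) `|u i|) => n.
have S0 : 0 <= \sum_(i < N) `|u i| by apply: sumr_ge0.
have qn1 : 1 <= q ^+ n by rewrite exprn_ege1 // ltW.
have [lt_nN|le_Nn] := ltnP n N.
  apply: le_trans (ler_norm _) _; apply: le_trans (_ : 1 + \sum_(i < N) `|u i| <= _).
    rewrite (bigD1 (Ordinal lt_nN)) //= addrCA lerDl addr_ge0 //.
    by apply: sumr_ge0.
  by rewrite ler_peMr // addr_ge0.
apply: le_trans (HN n le_Nn) _; rewrite ler_peMl ?lerDl //.
by rewrite (le_trans ler01).
Qed.

(** With [q] the 32nd root of [kappa], [q ^+ n] is about [kappa ^ (n / 32)], half of the available
    exponent; the other half absorbs [C]. *)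
Lemma exp_dominates (kappa : R) : 1 < kappa -> exists2 q, 1 < q &
  forall C, exists n0, forall n, (n0 <= n)%N -> C * q ^+ n < kappa ^+ (n %/ 16).-1.
Proof.
move=> k1; have [q q1 qE] := exists_root_gt1 5 k1.
have q0 : 0 < q by rewrite (lt_trans ltr01).
have qV0 : 0 <= q^-1 by rewrite invr_ge0 ltW.
have qV1 : q^-1 < 1 by rewrite invf_lt1.
exists q => // C; have e0 : 0 < (`|C| + 1)^-1 by rewrite invr_gt0 ltr_wpDl.
have [N HN] := expr_eventually_le qV0 qV1 e0.
exists (16 * (N + 64))%N => n le_n.
have le_t : (N + 64 <= n %/ 16)%N by rewrite leq_divRL // mulnC.
have lt_n : (n < 16 * (n %/ 16) + 16)%N.
  by rewrite {1}(divn_eq n 16) mulnC ltn_add2l ltn_mod.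
rewrite -qE -exprM.
apply: lt_le_trans (_ : q ^+ (n + N) <= _); last first.
  by rewrite ler_weXn2l ?(ltW q1) //; lia.
rewrite exprD mulrC ltr_pM2l ?exprn_gt0 //.
apply: le_lt_trans (ler_norm C) _.
have := HN N (leqnn N); rewrite exprVn lef_pV2 ?posrE ?exprn_gt0 ?ltr_wpDl //.
by apply: lt_le_trans; rewrite ltrDl.
Qed.

End Subexponential.

Section Counting.
Variable R : realType.

Definition count_below (S : pred nat) n := (\sum_(0 <= k < n | S k) 1)%N.

Lemma count_below_mono (S : pred nat) m n : (m <= n)%N ->
  (count_below S m <= count_below S n)%N.
Proof.
by move=> le_mn; rewrite /count_below (@big_cat_nat _ _ _ m 0 n) //= leq_addr.
Qed.

Lemma count_below_le (S : pred nat) n : (count_below S n <= n)%N.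
Proof.
rewrite /count_below big_mkcond /=; apply: leq_trans (_ : \sum_(0 <= k < n) 1 <= _)%N.
  by apply: leq_sum => k _; case: ifP.
by rewrite sum_nat_const_nat subn0 muln1.
Qed.

(** For large [n] the base [c * n] is at most [n ^ 2], so the logarithm of the power is at most
    [2 * k * ln n], with [k] the count. The density hypothesis makes [k * ln n] at most
    [ln q / 2 * n]. *)
Lemma subexp_count (S : set nat) (c : R) :
  (forall n : nat, S n -> (0 < n)%N) ->
  (fun n : nat => (\sum_(1 <= k < n.+1 | k \in S) 1)%N%:R : R) =o_\oo
             (fun n : nat => n%:R / ln n%:R : R) ->
  1 <= c ->
  subexp (fun n => (c * n%:R) ^+ count_below (fun k => k \in S) n).
Proof.
move=> S_pos S_small c1; apply: near_subexp => q q1.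
have lnq : 0 < ln q by rewrite ln_gt0.
have /eqoP/(_ (ln q / 2)) := S_small; rewrite divr_gt0 // => /(_ isT) [N _ HN].
exists (maxn N (maxn 3 (Num.truncn c).+1)) => // n /=.
rewrite !geq_max => /and3P[le_Nn le_3n le_cn].
have c_le_n : c <= n%:R.
  by apply: le_trans (ltW (truncnS_gt c)) _; rewrite ler_nat.
have n1 : 1 < n%:R :> R by rewrite ltr1n (leq_trans _ le_3n).
have n0 : 0 < n%:R :> R by rewrite (lt_trans ltr01).
have lnn : 0 < ln n%:R :> R by rewrite ln_gt0.
set k := count_below _ n.
have k_le : (k <= \sum_(1 <= k < n.+1 | k \in S) 1)%N.
  rewrite /k /count_below; have n_gt0 : (0 < n)%N by rewrite (leq_trans _ le_3n).
  rewrite big_ltn_cond //; have -> : (0%N \in S) = false by apply/negP => /set_mem/S_pos.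
  by rewrite [leqRHS](@big_cat_nat _ _ _ n) //= leq_addr.
have := HN n le_Nn; rewrite /= ger0_norm // ger0_norm ?divr_ge0 ?(ltW n0) ?(ltW lnn) //.
move=> sum_le; have {sum_le} k_ln : k%:R * ln n%:R <= ln q / 2 * n%:R.
  rewrite -ler_pdivlMr // -[leRHS]mulrA; apply: le_trans sum_le.
  by rewrite ler_nat.
apply: le_trans (_ : (n%:R ^+ 2) ^+ k <= _).
  rewrite lerXn2r ?nnegrE ?mulr_ge0 ?exprn_ge0 ?(ltW n0) ?(le_trans ler01 c1) //.
  by rewrite expr2 ler_pM2r.
rewrite -exprM -[n%:R in leLHS]lnK ?posrE // -[q]lnK ?posrE ?(lt_trans ltr01) //.
rewrite -!expRM_natl ler_expR natrM -mulrA.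
have : n%:R * ln q = 2 * (ln q / 2 * n%:R) by field.
lra.
Qed.

End Counting.

Section SubexponentialSums.
Variable R : realType.
Implicit Types (u v : nat -> R).

Lemma subexp_sum_fin (I : Type) (r : seq I) (F : I -> nat -> R) :
  (forall i n, 0 <= F i n) -> (forall i, subexp (F i)) ->
  subexp (fun n => \sum_(i <- r) F i n).
Proof.
move=> F0 F_sub; elim: r => [|i r IH].
  by apply: (@subexp_le _ _ (fun=> 0)) => [n|]; [rewrite big_nil | apply: subexp_cst].
apply: (@subexp_le _ _ (fun n => F i n + \sum_(j <- r) F j n)) => [n|].
  by rewrite big_cons.
by apply: subexpD => // n; apply: sumr_ge0.
Qed.

Lemma subexp_disk u : (forall x : R, 0 < x < 1 -> exists A, forall n, u n * x ^+ n <= A) ->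
  subexp u.
Proof.
move=> u_bound q q1; have q0 : 0 < q by rewrite (lt_trans ltr01).
have [|A HA] := u_bound q^-1; first by rewrite invr_gt0 q0 invf_lt1.
by exists A => n; have := HA n; rewrite exprVn ler_pdivrMr ?exprn_gt0.
Qed.

Lemma subexp_partial_sum u : (forall n, 0 <= u n) -> subexp u ->
  subexp (fun n => \sum_(k < n) u k).
Proof.
move=> u0 u_sub q q1; have [x x1 xE] := exists_root_gt1 1 q1.
have [A HA] := u_sub x x1; have [B HB] := subexp_nat x1.
have A0 := subexp_ge0 u0 HA.
have x0 : 0 <= x by rewrite ltW // (lt_trans ltr01).
exists (B * A) => n; apply: le_trans (_ : \sum_(k < n) (A * x ^+ n) <= _).
  apply: ler_sum => k _; apply: le_trans (HA k) _.
  by rewrite ler_wpM2l // ler_weXn2l ?(ltW x1) // ltnW.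
rewrite sumr_const card_ord -[leLHS]mulr_natl -xE exprAC expr2 mulrACA.
by rewrite ler_wpM2r // mulr_ge0 ?exprn_ge0.
Qed.

Lemma subexp_natS : subexp (fun n => n.+1%:R : R).
Proof.
apply: (@subexp_le _ _ (fun n => n%:R + 1)) => [n|]; first by rewrite natr1.
by apply: subexpD => //; [apply: subexp_nat | apply: subexp_cst].
Qed.

End SubexponentialSums.

Lemma fact_le_exp m n : (m <= n)%N -> (m`! <= n ^ m)%N.
Proof.
by elim: m => // m IH lt_mn; rewrite factS expnS leq_mul // IH // ltnW.
Qed.

Lemma double_sum_ord m : ((\sum_(i < m) i).*2 = m * m.-1)%N.
Proof.
elim: m => [|m IH]; first by rewrite big_ord0.
by rewrite big_ord_recr /= doubleD IH -muln2; case: m {IH} => //= m; lia.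
Qed.

Section Integrality.
Variable K : fieldExtType rat.

Lemma integral_natmul (m : nat) (x : K) : algebraic_integer x -> algebraic_integer (m%:R * x).
Proof. by move=> x_int; apply: integral_mul => //; apply: integral_nat. Qed.

Lemma integral_intmul (m : int) (x : K) : algebraic_integer x -> algebraic_integer (m%:~R * x).
Proof. by move=> x_int; apply: integral_mul => //; apply: (integral_id (intr : {rmorphism int -> K})). Qed.

Lemma integral_dvdn (m n : nat) (x : K) : (m %| n)%N ->
  algebraic_integer (m%:R * x) -> algebraic_integer (n%:R * x).
Proof. by case/dvdnP=> k ->; rewrite natrM -mulrA; apply: integral_natmul. Qed.

Lemma integral_det m (A : 'M[K]_m) : (forall i j, algebraic_integer (A i j)) ->
  algebraic_integer (\det A).
Proof.
move=> A_int; rewrite /algebraic_integer /determinant; apply: integral_sum => s _.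
have prod_int : algebraic_integer (\prod_i A i (perm.fun_of_perm s i)).
  by rewrite /algebraic_integer; apply: integral_prod => i _; apply: A_int.
case: (perm.odd_perm s); rewrite ?expr1 ?expr0 ?mul1r ?mulN1r //.
exact: integral_opp.
Qed.

Lemma weight_int (S : pred nat) n k : exists z : int, weight K S n k = z%:~R.
Proof.
exists (\prod_(0 <= s < n | S s) (k%:Z - s%:Z)).
rewrite /weight rmorph_prod /=; apply: eq_bigr => s _.
by rewrite rmorphB /= -!pmulrn.
Qed.

Lemma weight_eq0 (S : pred nat) n k : S k -> (k < n)%N -> weight K S n k = 0.
Proof.
move=> Sk lt_kn; rewrite /weight (big_cat_nat (n := k)) ?(ltnW lt_kn) //=.
by rewrite [X in _ * X]big_ltn_cond // Sk subrr mul0r mulr0.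
Qed.

End Integrality.

(** * Vanishing determinants and rationality *)

(* A nonzero Hankel determinant, cleared of denominators, has norm at least 1.
   Under [emb] it is as small as [kappa ^ - (m (m - 1))], while the denominators,
   the weights and the other conjugates cost only [X n ^ (m d)] with [X]
   subexponential. The weight kills the indices in [T], so a denominator from [S]
   enters at most once. *)
Section Vanishing.
Variables (R : realType) (K : fieldExtType rat).
Local Notation C := (CC R).
Variables (d : nat) (sigma : 'I_d -> {rmorphism K -> C}) (emb : {rmorphism K -> C}).
Hypothesis sigma_norm : forall g : {poly K}, exists G : {poly rat},
  map_poly ratr G = \prod_i map_poly (sigma i) g.
Variable i0 : 'I_d.
Hypothesis emb_sigma : emb =1 sigma i0.
Variables (a : nat -> K) (S : pred nat) (D E : nat -> nat) (kappa A1 B1 : R).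
Hypothesis kappa_gt1 : 1 < kappa.
Hypothesis A1_ge0 : 0 <= A1.
Hypothesis B1_ge1 : 1 <= B1.
Hypothesis hankel_bound : forall (N : R) (xs : seq C) m,
      all (fun x => cabs x <= N) xs -> (size xs)%:R <= N ->
      cabs (\det (\matrix_(i < m, j < m)
         ((\prod_(x <- xs) ((i + j)%N%:R - x)) * emb (a (i + j)%N)))) *
        kappa ^+ (\sum_(i < m) i).*2 <=
      m`!%:R * (A1 * (size xs).+1%:R * (B1 * N) ^+ size xs) ^+ m.
Hypothesis a_bound : forall i, subexp (fun n => cabs (sigma i (a n))).
Hypothesis S_count : forall c : R, 1 <= c ->
  subexp (fun n => (c * n%:R) ^+ count_below S n).
Hypothesis D_gt0 : forall n, (0 < D n)%N.
Hypothesis D_int : forall n k, (k < n)%N -> ~~ S k -> algebraic_integer ((D n)%:R * a k).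
Hypothesis D_subexp : subexp (fun n => (D n)%:R : R).
Hypothesis E_gt0 : forall n, (0 < E n)%N.
Hypothesis E_int : forall n k, (k < n)%N -> S k ->
  exists e, [/\ (0 < e)%N, (e <= E n)%N & algebraic_integer (e%:R * a k)].
Hypothesis E_subexp : subexp (fun n => (E n)%:R : R).

Definition weight_points (T : pred nat) n : seq C := [seq s%:R | s <- index_iota 0 n & T s].

Lemma size_weight_points T n : size (weight_points T n) = count_below T n.
Proof.
by rewrite size_map size_filter -sum1_count /count_below.
Qed.

Lemma weight_points_le (T : pred nat) n :
  all (fun x => cabs x <= n%:R) (weight_points T n).
Proof.
apply/allP => x /mapP[s]; rewrite mem_filter mem_index_iota => /andP[_ /andP[_ lt_sn]] ->.
by rewrite cabs_nat ler_nat ltnW.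
Qed.

Lemma map_weight (f : {rmorphism K -> C}) (T : pred nat) n k :
  f (weight K T n k) = \prod_(x <- weight_points T n) (k%:R - x).
Proof.
rewrite /weight rmorph_prod /= big_map big_filter; apply: eq_bigr => s _.
by rewrite rmorphB !rmorph_nat.
Qed.

Lemma count_below_sub (T : pred nat) n : (forall k, T k -> S k) ->
  (count_below T n <= count_below S n)%N.
Proof.
move=> TS; rewrite /count_below [leqLHS]big_mkcond [leqRHS]big_mkcond /=.
by apply: leq_sum => k _; have := TS k; case: (T k); case: (S k) => // /(_ isT).
Qed.

Lemma cabs_map_weight_le (f : {rmorphism K -> C}) (T : pred nat) n k :
  (forall k, T k -> S k) -> (k < n)%N ->
  cabs (f (weight K T n k)) <= n%:R ^+ count_below S n.
Proof.
move=> TS lt_kn; have n1 : 1 <= n%:R :> R by rewrite ler1n (leq_trans _ lt_kn).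
apply: le_trans (_ : n%:R ^+ count_below T n <= _); last first.
  by rewrite ler_weXn2l // count_below_sub.
rewrite map_weight -size_weight_points cabs_prod.
have := weight_points_le T n.
have : all (fun x => cabs (k%:R - x) <= n%:R) (weight_points T n).
  apply/allP => x /mapP[s]; rewrite mem_filter mem_index_iota => /andP[_ /andP[_ lt_sn]] ->.
  have [le_sk|/ltnW le_ks] := leqP s k.
    by rewrite -natrB // cabs_nat ler_nat; lia.
  by rewrite cabs_distC -natrB // cabs_nat ler_nat; lia.
elim: (weight_points T n) => [|x xs IH] /=; first by rewrite big_nil expr0.
case/andP=> xn xsn /andP[_ xsn']; rewrite big_cons exprS.
by rewrite ler_pM ?cabs_ge0 ?prodr_ge0 // => [i _|]; rewrite ?cabs_ge0 ?IH.
Qed.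

Lemma hankel_vanishing : exists n0, forall n, (n0 <= n)%N ->
  forall T : pred nat, (forall k, T k -> S k) ->
  (forall k l, S k -> ~~ T k -> S l -> ~~ T l -> k = l) ->
  forall m, (n %/ 16 <= m)%N -> (m <= n %/ 2)%N ->
  \det (\matrix_(i < m, j < m) (weight K T n (i + j) * a (i + j)%N)) = 0.
Proof.
(* [Amax] dominates every conjugate of every [a k] with [k < n]. The two summands of [Y] are the
   entry bounds for an arbitrary conjugate and for [emb]; [X] adds the denominators and a factor [n]
   that pays for the factorial of [m]. *)
pose Amax n := \sum_(i < d) \sum_(k < n) cabs (sigma i (a k)).
pose Y n := (1 * n%:R) ^+ count_below S n * Amax n +
  A1 * n.+1%:R * (B1 * n%:R) ^+ count_below S n.
pose X n := (D n)%:R * (E n)%:R * n%:R * Y n : R.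
have B10 : 0 <= B1 by apply: le_trans B1_ge1.
have Amax0 n : 0 <= Amax n by do 2!apply: sumr_ge0 => ? _; apply: cabs_ge0.
have Y0 n : 0 <= Y n by rewrite addr_ge0 // !mulr_ge0 ?exprn_ge0 ?mulr_ge0.
have X0 n : 0 <= X n by rewrite !mulr_ge0.
have Amax_sub : subexp Amax.
  apply: subexp_sum_fin => [i n|i]; first by apply: sumr_ge0 => k _; apply: cabs_ge0.
  by apply: (@subexp_partial_sum R (fun k => cabs (sigma i (a k)))) => // k; apply: cabs_ge0.
have cnt_ge0 (c : R) n : 0 <= c -> 0 <= (c * n%:R) ^+ count_below S n.
  by move=> c0; rewrite exprn_ge0 ?mulr_ge0.
have Y_sub : subexp Y.
  apply: subexpD; first by move=> n; rewrite mulr_ge0 ?cnt_ge0.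
  - by move=> n; rewrite !mulr_ge0 ?cnt_ge0.
  - by apply: subexpM; [move=> n; exact: cnt_ge0 | exact: Amax0 | exact: S_count | ].
  apply: subexpM; [by move=> n; rewrite mulr_ge0 | by move=> n; exact: cnt_ge0 | | exact: S_count].
  by apply: subexpM; [| | apply: subexp_cst | apply: subexp_natS].
have X_sub : subexp (fun n => X n ^+ d).
  apply: subexpX => //; apply: subexpM; [by move=> n; rewrite !mulr_ge0 | exact: Y0 | | by []].
  apply: subexpM; [by move=> n; rewrite mulr_ge0 | by [] | | exact: subexp_nat].
  by apply: subexpM; [| | exact: D_subexp | exact: E_subexp].
have [q q1 q_dom] := exp_dominates kappa_gt1; have [A HA] := X_sub q q1.
have [n1 Hn1] := q_dom A.
exists (maxn n1 16) => n; rewrite geq_max => /andP[le_n1n le_16n] T TS T_miss m le_nm le_mn.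
pose b k := weight K T n k * a k.
pose H := \matrix_(i < m, j < m) b (i + j)%N.
apply/eqP; apply: contraT => detH0.
have m_gt0 : (0 < m)%N by apply: leq_trans le_nm; rewrite divn_gt0.
have lt_ijn (i j : 'I_m) : (i + j < n)%N.
  by have := ltn_ord i; have := ltn_ord j; have := leq_divM n 2; lia.
have [D' D'_gt0 [D'_le D'_int]] : exists2 D', (0 < D')%N & (D' <= D n * E n)%N /\
    forall k, (k < n)%N -> algebraic_integer (D'%:R * b k).
  have b_int e k : (k < n)%N -> algebraic_integer (e%:R * a k) -> algebraic_integer (e%:R * b k).
    move=> lt_kn ek; rewrite /b mulrCA; have [z ->] := weight_int K T n k.
    exact: integral_intmul.
  have b_T k : (k < n)%N -> T k -> algebraic_integer (b k).
    by move=> lt_kn Tk; rewrite /b weight_eq0 // mul0r; apply: mxpoly.integral0.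
  have [[s0 [ltsn Ss nTs]]|no_s] := pselect (exists s, [/\ (s < n)%N, S s & ~~ T s]).
    have [e [e0 eE e_int]] := E_int ltsn Ss.
    exists (D n * e)%N; first by rewrite muln_gt0 D_gt0.
    split=> [|k lt_kn]; first by rewrite leq_mul2l eE orbT.
    have [Tk|nTk] := boolP (T k); first by apply: integral_natmul; apply: b_T.
    have [Sk|nSk] := boolP (S k).
      rewrite (T_miss k s0) //; apply: b_int => //.
      by apply: integral_dvdn e_int; apply: dvdn_mull.
    by apply: b_int => //; apply: integral_dvdn (D_int lt_kn nSk); apply: dvdn_mulr.
  exists (D n) => //; split=> [|k lt_kn]; first by rewrite leq_pmulr.
  have [Tk|nTk] := boolP (T k); first by apply: integral_natmul; apply: b_T.
  have [Sk|nSk] := boolP (S k); last by apply: b_int => //; apply: D_int.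
  by case: no_s; exists k.
pose x := D'%:R ^+ m * \det H.
have x_int : algebraic_integer x.
  rewrite /x -detZ; apply: integral_det => i j; rewrite !mxE; apply: D'_int; exact: lt_ijn.
have D'0 : D'%:R != 0 :> K.
  by rewrite -(rmorph_nat (in_alg K)) fmorph_eq0 pnatr_eq0 -lt0n.
have x0 : x != 0 by rewrite mulf_neq0 // expf_neq0.
have norm_x : 1 <= \prod_i cabs (sigma i x).
  have := norm_ge1 sigma_norm x_int x0; rewrite -ler_rc rmorph1 rmorph_prod /=.
  by under eq_bigr do rewrite cabsE.
have n_gt0 : (0 < n)%N by apply: leq_trans le_16n.
have n1' : 1 <= n%:R :> R by rewrite ler1n.
have Dm : D'%:R ^+ m * m`!%:R <= ((D n)%:R * (E n)%:R * n%:R) ^+ m :> R.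
  rewrite [leRHS]exprMn; apply: ler_pM; rewrite ?exprn_ge0 //.
    by rewrite -natrM lerXn2r ?nnegrE // ler_nat.
  by rewrite -natrX ler_nat fact_le_exp // (leq_trans le_mn) // leq_div.
have cabs_x i Z : cabs (sigma i (\det H)) * Z <= m`!%:R * Y n ^+ m ->
    cabs (sigma i x) * Z <= X n ^+ m.
  move=> det_le; rewrite /x rmorphM rmorphXn rmorph_nat cabsM cabsX cabs_nat -mulrA.
  apply: le_trans (_ : D'%:R ^+ m * (m`!%:R * Y n ^+ m) <= _).
    by rewrite ler_wpM2l ?exprn_ge0.
  by rewrite mulrA /X [leRHS]exprMn ler_wpM2r ?exprn_ge0.
have conj_bound i : cabs (sigma i x) <= X n ^+ m.
  rewrite -[leLHS]mulr1; apply: cabs_x; rewrite mulr1 -det_map_mx.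
  apply: le_trans (_ : m`!%:R * ((1 * n%:R) ^+ count_below S n * Amax n) ^+ m <= _).
    apply: det_le_factorial => k l; rewrite !mxE rmorphM cabsM mul1r.
    apply: ler_pM; rewrite ?cabs_ge0 //; first exact: cabs_map_weight_le.
    rewrite /Amax (bigD1 i) //= (bigD1 (Ordinal (lt_ijn k l))) //= -addrA lerDl.
    by rewrite addr_ge0 ?sumr_ge0 // => *; rewrite ?sumr_ge0 // => *; apply: cabs_ge0.
  rewrite ler_wpM2l // lerXn2r ?nnegrE ?mulr_ge0 ?exprn_ge0 ?mulr_ge0 // /Y lerDl.
  by rewrite !mulr_ge0 ?exprn_ge0 ?mulr_ge0.
have emb_bound : cabs (sigma i0 x) * kappa ^+ (\sum_(i < m) i).*2 <= X n ^+ m.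
  apply: cabs_x; rewrite -det_map_mx.
  have := hankel_bound m (weight_points_le T n).
  rewrite size_weight_points ler_nat count_below_le => /(_ isT).
  set M1 := \matrix_(i, j) _; set M2 := map_mx _ _.
  have -> : M1 = M2.
    by apply/matrixP => i j; rewrite !mxE rmorphM -!emb_sigma map_weight.
  move/le_trans; apply; rewrite ler_wpM2l //.
  have cT := count_below_sub n TS.
  rewrite lerXn2r ?nnegrE ?mulr_ge0 ?exprn_ge0 ?mulr_ge0 //.
  rewrite /Y; apply: ler_wpDl; first by rewrite mulr_ge0 ?exprn_ge0 ?mulr_ge0.
  apply: ler_pM; rewrite ?mulr_ge0 ?exprn_ge0 ?mulr_ge0 //.
    by rewrite ler_wpM2l // ler_nat ltnS count_below_le.
  rewrite ler_weXn2l // -[leLHS]mulr1; apply: ler_pM => //.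
have key : kappa ^+ (\sum_(i < m) i).*2 <= (X n ^+ d) ^+ m.
  have kge0 : 0 <= kappa ^+ (\sum_(i < m) i).*2.
    by rewrite exprn_ge0 // ltW // (lt_trans ltr01).
  apply: le_trans (_ : (\prod_i cabs (sigma i x)) * kappa ^+ (\sum_(i < m) i).*2 <= _).
    by rewrite -[leLHS]mul1r ler_wpM2r.
  have -> : (X n ^+ d) ^+ m = \prod_(i < d) X n ^+ m.
    by rewrite prodr_const card_ord -!exprM mulnC.
  rewrite (bigD1 i0) //= [leRHS](bigD1 i0) //= mulrAC.
  apply: ler_pM => //; rewrite ?mulr_ge0 ?cabs_ge0 //.
    by apply: prodr_ge0 => i _; apply: cabs_ge0.
  by apply: ler_prod => i _; rewrite cabs_ge0 conj_bound.
have kappa0 : 0 <= kappa by rewrite ltW // (lt_trans ltr01).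
(* Taking [m]-th roots turns the exponent [m * m.-1] of [kappa] into [m.-1], to be compared with
   [(n %/ 16).-1]. *)
have : kappa ^+ m.-1 <= X n ^+ d.
  rewrite -(ler_pXn2r m_gt0) ?nnegrE ?exprn_ge0 // -exprM mulnC -double_sum_ord.
  exact: key.
have : kappa ^+ (n %/ 16).-1 <= kappa ^+ m.-1.
  by rewrite ler_weXn2l ?(ltW kappa_gt1) // -!subn1 leq_sub2r.
have := HA n; have := Hn1 n le_n1n.
move=> h1 h2 h3 h4; have := le_lt_trans (le_trans (le_trans h3 h4) h2) h1.
by rewrite ltxx.
Qed.

End Vanishing.

(* Gluing with [T = S] controls the indices outside [S]; an index [k] in [S] is
   recovered by gluing with [T = S] minus [k]. *)
Section Rounds.
Variables (F : fieldType) (a : nat -> F) (S : pred nat) (n0 : nat).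
Hypothesis F_char0 : forall i j : nat, (i%:R == j%:R :> F) = (i == j).
Hypothesis vanishing : forall n, (n0 <= n)%N ->
  forall T : pred nat, (forall k, T k -> S k) ->
  (forall k l, S k -> ~~ T k -> S l -> ~~ T l -> k = l) ->
  forall m, (n %/ 16 <= m)%N -> (m <= n %/ 2)%N ->
  \det (\matrix_(i < m, j < m) (weight F T n (i + j) * a (i + j)%N)) = 0.

Lemma pade_of_vanishing (T : pred nat) n : (forall k, T k -> S k) ->
  (forall k l, S k -> ~~ T k -> S l -> ~~ T l -> k = l) ->
  (n0 <= n)%N -> (16 <= n)%N -> exists q p : {poly F},
  [/\ q`_0 = 1, (size q <= n %/ 16)%N, (size p <= n %/ 16)%N &
      pade q p (fun k => weight F T n k * a k) (6 * (n %/ 16))].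
Proof.
move=> TS T_miss le_n0n le_16n.
have m0_gt0 : (0 < n %/ 16)%N by rewrite divn_gt0.
(* [pade_normalize] takes one block of length [n %/ 16] from the precision [n %/ 2], and six must
   remain. *)
have le_m : (7 * (n %/ 16) <= n %/ 2)%N.
  rewrite leq_divRL // mulnAC; apply: leq_trans (leq_divM n 16).
  by rewrite mulnC leq_mul2l orbT.
have le_m01 : (n %/ 16 <= n %/ 2)%N by apply: leq_trans le_m; rewrite leq_pmull.
have [|q [p [q0 szq szp padeq]]] :=
  @pade_range F (fun k => weight F T n k * a k) _ _ m0_gt0 le_m01.
  by move=> m /andP[le_m0 le_m1]; apply: vanishing TS T_miss _ _ _.
have [q' [p' [q'0 szq' szp' padeq']]] := pade_normalize le_m01 q0 szq szp padeq.
exists q', p'; split => //; apply: pade_le padeq'.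
by rewrite leq_subRL // -mulSn.
Qed.

Lemma exact_of_vanishing : exists (N : nat) (q p : {poly F}),
  q`_0 = 1 /\ exact q p (fun k => weight F S N k * a k).
Proof.
(* Comparing neighbours takes two blocks for the fraction at [n] and one for that at [n.+1], which
   may be longer by one. As blocks are nonempty from 16 on, a precision of six blocks is enough. *)
pose N := maxn n0 16; pose sz n := (n %/ 16)%N; pose M n := (6 * (n %/ 16))%N.
have le_n0N : (n0 <= N)%N by apply: leq_maxl.
have le_16N : (16 <= N)%N by apply: leq_maxr.
have M_sz n : (N <= n)%N -> (sz n.+1 + (sz n).*2 <= M n)%N.
  move=> le_Nn; rewrite /sz /M.
  have : (0 < n %/ 16)%N by rewrite divn_gt0 // (leq_trans le_16N).
  have : (n.+1 %/ 16 <= (n %/ 16).+1)%N.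
    by clear; lia.
  move: (n.+1 %/ 16)%N (n %/ 16)%N => x y; clear; lia.
have M_mono n : (M n <= M n.+1)%N by rewrite leq_mul2l leq_div2r.
have M_large k : exists2 n, (N <= n)%N & (k < M n)%N.
  exists (N + 16 * k.+1)%N; first exact: leq_addr.
  rewrite /M; apply: leq_trans (_ : 6 * k.+1 <= _)%N; first by rewrite leq_pmull.
  by rewrite leq_mul2l /= leq_divRL // mulnC leq_addl.
have S_miss k l : S k -> ~~ S k -> S l -> ~~ S l -> k = l by move=> ->.
have [q0 [p0 [q00 szq0 szp0 pade0]]] := pade_of_vanishing (fun k Sk => Sk) S_miss le_n0N le_16N.
have q00' : q0`_0 != 0 by rewrite q00 oner_eq0.
have [r exact0] := exact_exists p0 q00'.
have padeT (T : pred nat) : (forall k, T k -> S k) ->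
    (forall k l, S k -> ~~ T k -> S l -> ~~ T l -> k = l) ->
    forall n, (N <= n)%N -> exists q p : {poly F},
    [/\ q`_0 = 1, (size q <= sz n)%N, (size p <= sz n)%N &
      pade q p (fun k => weight F T n k * a k) (M n)].
  by move=> TS T_miss n le_Nn; apply: pade_of_vanishing => //; apply: leq_trans le_Nn.
have rS k : ~~ S k -> r k = weight F S N k * a k.
  exact: (glue_pade F_char0 M_sz M_mono M_large (padeT S (fun k Sk => Sk) S_miss)
    q00 szq0 szp0 pade0 exact0).
have rN k : (N <= k)%N -> r k = weight F S N k * a k.
  move=> le_Nk; have [Sk|] := boolP (S k); last exact: rS.
  (* As [k >= N], leaving it out does not change the weight at [N]: gluing starts from the same
     fraction and the same [r]. *)
  pose T l := S l && (l != k).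
  have TS l : T l -> S l by case/andP.
  have T_miss l l' : S l -> ~~ T l -> S l' -> ~~ T l' -> l = l'.
    by rewrite /T => -> /negPn/eqP -> -> /negPn/eqP ->.
  have wE l : weight F T N l = weight F S N l.
    rewrite /weight big_nat_cond [RHS]big_nat_cond; apply: eq_bigl => s.
    rewrite /T; case: (ltnP s N) => [lt_sN|]; last by rewrite andbF.
    by rewrite neq_ltn (leq_trans lt_sN le_Nk) !andbT.
  have nTk : ~~ T k by rewrite /T eqxx andbF.
  have pade0' : pade q0 p0 (fun l => weight F T N l * a l) (M N).
    by rewrite /pade (@eq_partial_sum _ _ _ (fun l => weight F S N l * a l)) // => l _; rewrite wE.
  rewrite -wE; exact: (glue_pade F_char0 M_sz M_mono M_large (padeT T TS T_miss)
    q00 szq0 szp0 pade0' exact0 nTk).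
(* At indices of [S] below [N], [r] may differ from the weighted series. A polynomial correction of
   the numerator repairs these finitely many terms. *)
pose rho k := weight F S N k * a k.
exists N, q0, (p0 - q0 * (partial_sum N r - partial_sum N rho)); split => // n.
have trE : 'X^n %| (partial_sum n r - partial_sum n rho) - (partial_sum N r - partial_sum N rho).
  apply/dvdXnP => i lt_in; rewrite !coefB !coef_partial_sum lt_in.
  by case: ltnP => [_|le_Ni]; rewrite ?subrr // rN // !subrr.
rewrite /pade -/rho.
have -> : q0 * partial_sum n rho - (p0 - q0 * (partial_sum N r - partial_sum N rho)) =
  (q0 * partial_sum n r - p0) - q0 * ((partial_sum n r - partial_sum n rho) - (partial_sum N r - partial_sum N rho)) by ring.
by apply: dvdp_sub; [apply: exact0 | apply: dvdp_mull].
Qed.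

End Rounds.

Section Denominators.
Variables (R : realType) (K : fieldExtType rat).
Variables (a : nat -> K) (S : pred nat) (D : nat -> nat) (N : nat) (q p : {poly K}).
Hypothesis q0 : q`_0 = 1.
Hypothesis q_exact : exact q p (fun k => weight K S N k * a k).
Hypothesis D_gt0 : forall n, (0 < D n)%N.
Hypothesis D_int : forall n k, (k < n)%N -> ~~ S k -> algebraic_integer ((D n)%:R * a k).
Hypothesis D_subexp : subexp (fun n => (D n)%:R : R).
Hypothesis S_count : subexp (fun n => (1 * n%:R) ^+ count_below S n : R).
Hypothesis c_count : forall c : R, 1 <= c -> subexp (fun n => c ^+ count_below S n).

Lemma den_gt0 (x : K) : (0 < den x)%N.
Proof. by rewrite /den; case: ex_minnP => m /andP[]. Qed.

Lemma den_int (x : K) : algebraic_integer ((den x)%:R * x).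
Proof. by rewrite /den; case: ex_minnP => m /andP[_ /asboolP]. Qed.

Lemma poly_common_den (g : {poly K}) : exists2 c : nat, (0 < c)%N &
  forall i, algebraic_integer (c%:R * g`_i).
Proof.
exists (\prod_(i < size g) den g`_i)%N; first by rewrite prodn_gt0 // => i; apply: den_gt0.
move=> i; have [lt_i|le_i] := ltnP i (size g); last first.
  by rewrite nth_default // mulr0; apply: mxpoly.integral0.
apply: integral_dvdn (den_int _).
by rewrite (bigD1 (Ordinal lt_i)) //= dvdn_mulr.
Qed.

(* The coefficients with index outside [S] have denominator [D n]; each index in
   [S] is reached by the recurrence, at the cost of one more factor [c]. *)
Lemma recurrence_den : exists2 c : nat, (0 < c)%N & forall n k, (k < n)%N ->
  algebraic_integer ((c ^ count_below S k.+1 * D n)%N%:R * (weight K S N k * a k)).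
Proof.
have [cq cq0 cq_int] := poly_common_den q; have [cp cp0 cp_int] := poly_common_den p.
pose c := (cq * cp)%N; have c0 : (0 < c)%N by rewrite muln_gt0 cq0.
exists c => // n; pose rho k := weight K S N k * a k.
have rec k : rho k = p`_k - \sum_(i < k) q`_i.+1 * rho (k - i.+1)%N.
  have /exactP/(_ k) := q_exact; rewrite big_ord_recl subn0 q0 mul1r => <-.
  by rewrite addrK.
elim/ltn_ind => k IH lt_kn.
have [Sk|nSk] := boolP (S k); last first.
  have [z wz] := weight_int K S N k; rewrite wz mulrCA; apply: integral_intmul.
  by apply: integral_dvdn (D_int lt_kn nSk); apply: dvdn_mull.
have cntE : count_below S k.+1 = (count_below S k).+1.
  by rewrite /count_below big_mkcond big_nat_recr //= Sk -big_mkcond addn1.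
rewrite -/(rho k) rec cntE expnS mulrBr; apply: integral_sub.
  apply: integral_dvdn (cp_int k); rewrite -!mulnA mulnCA; exact: dvdn_mulr.
rewrite mulr_sumr; apply: integral_sum => i _.
have lt_ik : (k - i.+1 < k)%N by rewrite ltn_subrL /= (leq_ltn_trans (leq0n i) (ltn_ord i)).
have -> : (c * c ^ count_below S k * D n)%N%:R * (q`_i.+1 * rho (k - i.+1)%N) =
   (c%:R * q`_i.+1) * ((c ^ count_below S k * D n)%N%:R * rho (k - i.+1)%N) :> K.
  by rewrite -mulnA natrM; ring.
apply: integral_mul; first by apply: integral_dvdn (cq_int _); apply: dvdn_mulr.
apply: integral_dvdn (IH _ lt_ik (ltn_trans lt_ik lt_kn)).
by apply: dvdn_mul => //; apply: dvdn_exp2l; apply: count_below_mono.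
Qed.

(** [recurrence_den] concerns [weight K S N k * a k]. For [k >= N] in [S] the weight is a positive
    integer below [n ^ N] or equal to it, and joins the denominator through [P2]; for [k < N] in [S]
    it vanishes, and the finitely many denominators left are collected in [P1]. *)
Lemma common_denominators : exists D' : nat -> nat,
  [/\ forall n, (0 < D' n)%N,
      forall n k, (k < n)%N -> algebraic_integer ((D' n)%:R * a k) &
      subexp (fun n => (D' n)%:R : R)].
Proof.
have [c c0 c_int] := recurrence_den.
pose w s := (\prod_(0 <= t < N | S t) (s - t))%N.
have w_gt0 s : (N <= s)%N -> (0 < w s)%N.
  move=> le_Ns; rewrite /w big_nat_cond; elim/big_ind: _ => // [x y|i]; first by rewrite muln_gt0 => ->.
  by case/andP=> /andP[_ lt_iN] _; rewrite subn_gt0 (leq_trans lt_iN).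
have wE s : (N <= s)%N -> weight K S N s = (w s)%:R.
  move=> le_Ns; rewrite /weight /w big_nat_cond [in RHS]big_nat_cond natr_prod.
  apply: eq_bigr => i /andP[/andP[_ lt_iN] _].
  by rewrite natrB // ltnW // (leq_trans lt_iN).
have w_le s n : (s < n)%N -> (w s <= n ^ N)%N.
  move=> lt_sn; have n_gt0 : (0 < n)%N by apply: leq_ltn_trans lt_sn.
  rewrite /w; apply: leq_trans (_ : \prod_(0 <= t < N) n <= _)%N; last first.
    by rewrite prod_nat_const_nat subn0.
  rewrite big_mkcond /=; apply: leq_prod => t _; case: ifP => // _.
  by rewrite (leq_trans (leq_subr _ _)) // ltnW.
pose P1 := (\prod_(0 <= s < N) den (a s))%N.
pose P2 n := (\prod_(0 <= s < n | S s && (N <= s)) w s)%N.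
have P1_gt0 : (0 < P1)%N by rewrite /P1 prodn_gt0 // => s; apply: den_gt0.
have P2_gt0 n : (0 < P2 n)%N.
  by rewrite /P2; elim/big_ind: _ => // [x y|i /andP[_ /w_gt0 //]]; rewrite muln_gt0 => ->.
have P2_le n : (P2 n <= (n ^ N) ^ count_below S n)%N.
  rewrite /P2 /count_below.
  apply: leq_trans (_ : \prod_(0 <= s < n | S s) (n ^ N) <= _)%N.
    rewrite big_nat_cond [leqRHS]big_nat_cond.
    rewrite [leqLHS]big_mkcond [leqRHS]big_mkcond /=; apply: leq_prod => s _.
    case: (ltnP s n) => [lt_sn|//].
    case: (S s) => //=; case: ifP => _; first exact: w_le.
    by rewrite expn_gt0 (leq_ltn_trans _ lt_sn).
  by rewrite big_const_seq iter_muln muln1 sum1_count.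
pose D' n := (c ^ count_below S n * D n * P1 * P2 n)%N.
exists D'; split => [n|n k lt_kn|].
- by rewrite /D' !muln_gt0 expn_gt0 c0 D_gt0 P1_gt0 P2_gt0.
- have [Sk|nSk] := boolP (S k); last first.
    by apply: integral_dvdn (D_int lt_kn nSk); rewrite /D' -!mulnA mulnCA dvdn_mulr.
  have [lt_kN|le_Nk] := ltnP k N.
    apply: integral_dvdn (den_int (a k)); rewrite /D'.
    apply: dvdn_mulr; apply: dvdn_mull; rewrite /P1 (big_rem k) ?mem_index_iota //=.
    exact: dvdn_mulr.
  have := c_int n k lt_kn; rewrite wE // mulrA -natrM => ck_int.
  apply: integral_dvdn ck_int; rewrite /D' -[X in (_ %| X)%N]mulnA.
  apply: dvdn_mul; last apply: dvdn_mull.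
    by apply: dvdn_mul => //; apply: dvdn_exp2l; apply: count_below_mono.
  rewrite /P2 (big_rem k) ?mem_index_iota //= Sk le_Nk.
  exact: dvdn_mulr.
pose V n : R := c%:R ^+ count_below S n * (D n)%:R * P1%:R * ((1 * n%:R) ^+ count_below S n) ^+ N.
apply: (@subexp_le _ _ V) => [n|].
  rewrite /D' /V !natrM natrX mul1r ler_wpM2l ?mulr_ge0 ?exprn_ge0 //.
  by rewrite -!natrX ler_nat (leq_trans (P2_le n)) // -!expnM mulnC.
have Z0 n : 0 <= (1 * n%:R) ^+ count_below S n :> R by rewrite exprn_ge0 ?mulr_ge0.
have c0' n : 0 <= c%:R ^+ count_below S n :> R by rewrite exprn_ge0.
apply: subexpM; [by move=> n; rewrite !mulr_ge0 | by move=> n; rewrite exprn_ge0 | | exact: subexpX].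
apply: subexpM; [by move=> n; rewrite !mulr_ge0 | by [] | | exact: subexp_cst].
by apply: subexpM => //; apply: c_count; rewrite ler1n.
Qed.

End Denominators.

(** * Rational functions with small denominators *)

Section Rational.
Variables (R : realType) (K : fieldExtType rat).
Local Notation C := (CC R).

(** For large [M] the coefficients of [q * partial_sum M a - p] are confined to [size q] indices
    from [M] on, where they are of order at most [x ^ - M] for some [x > |z|]. Its value at [z]
    therefore tends to 0. *)
Lemma exact_eval (f : {rmorphism K -> C}) (a : nat -> K) (q p : {poly K}) (z l : C) :
  (forall x : R, 0 < x < 1 -> exists A, forall n, cabs (f (a n)) * x ^+ n <= A) ->
  exact q p a -> cabs z < 1 ->
  cpseries (fun n => f (a n)) z n @[n --> \oo] --> l ->
  (map_poly f q).[z] * l = (map_poly f p).[z].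
Proof.
move=> a_bound qpa z1 al; apply/eqP; rewrite -subr_eq0 -cabs_eq0 eq_le cabs_ge0 andbT.
apply/ler_addgt0Pr => e e0; rewrite add0r.
pose x := (1 + cabs z) / 2; have z0 := cabs_ge0 z.
have x01 : 0 < x < 1 by rewrite /x; apply/andP; split; lra.
have zx : cabs z < x by rewrite /x; lra.
have [A HA] := a_bound x x01; have [x0 x1] := andP x01; clearbody x.
have A0 : 0 <= A by apply: le_trans (HA 0%N); rewrite mulr_ge0 ?cabs_ge0.
pose Q := map_poly f q; pose s := size q.
pose W := wnorm Q * A * s%:R; have W0 : 0 <= W by rewrite !mulr_ge0 ?wnorm_ge0.
pose y := cabs z / x; have y0 : 0 <= y by rewrite divr_ge0 // ltW.
have y1 : y < 1 by rewrite ltr_pdivrMr // mul1r.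
have e1 : 0 < e / 2 / (W + 1) by rewrite divr_gt0 ?divr_gt0 // ltr_wpDl.
have e2 : 0 < e / 2 / (cabs Q.[z] + 1) by rewrite divr_gt0 ?divr_gt0 // ltr_wpDl ?cabs_ge0.
have [N1 HN1] := expr_eventually_le y0 y1 e1.
have [N2 HN2] := cvg_cabs al e2.
pose M := maxn (size p) (maxn N1 N2).
have le_pM : (size p <= M)%N by apply: leq_maxl.
have le_1M : (N1 <= M)%N by rewrite /M leq_max leq_max leqnn orbT.
have le_2M : (N2 <= M)%N by rewrite /M !leq_max leqnn !orbT.
pose E := q * partial_sum M a - p.
have trE : map_poly f (partial_sum M a) = partial_sum M (fun n => f (a n)).
  by apply/polyP => i; rewrite [LHS]coef_map /= !coef_partial_sum; case: ifP => // _; exact: rmorph0.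
have Ez : (map_poly f E).[z] = Q.[z] * cpseries (fun n => f (a n)) z M - (map_poly f p).[z].
  by rewrite /E rmorphB rmorphM /= trE hornerD hornerN hornerM cpseriesE.
have szE : (size E <= M + s)%N.
  apply: size_sub_le; last by apply: leq_trans le_pM (leq_addr _ _).
  apply: size_mul_le (leqnn _) (size_poly _ _) _.
  by rewrite addnC (leq_trans (leq_pred _)).
have Elow i : (i < M)%N -> E`_i = 0 by move/dvdXnP: (qpa M); apply.
have Ehigh i : (M <= i)%N -> cabs (f E`_i) <= wnorm Q * (A * x^-1 ^+ M).
  move=> le_Mi; rewrite /E coefB [p`_i]nth_default ?(leq_trans le_pM) // subr0.
  rewrite -coef_map rmorphM /= trE; apply: wnorm_coefM => j _.
  rewrite coef_partial_sum; case: ltnP => [lt_jM|_]; last by rewrite cabs0 mulr_ge0 ?exprn_ge0 ?invr_ge0 ?(ltW x0).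
  rewrite exprVn ler_pdivlMr ?exprn_gt0 //; apply: le_trans (HA j).
  by rewrite ler_wpM2l ?cabs_ge0 // ler_wiXn2l ?(ltW x0) ?(ltW x1) // ltnW.
have Ez_le : cabs (map_poly f E).[z] <= e / 2.
  rewrite (@horner_coef_wide _ (M + s)) ?size_map_poly // big_split_ord /= big1 ?add0r.
    apply: le_trans (ler_cabs_sum _ _ _) _.
    apply: le_trans (_ : \sum_(i < s) wnorm Q * A * y ^+ M <= _).
      apply: ler_sum => i _; rewrite coef_map /= cabsM cabsX.
      apply: le_trans (_ : wnorm Q * (A * x^-1 ^+ M) * cabs z ^+ M <= _).
        apply: ler_pM; rewrite ?cabs_ge0 ?exprn_ge0 ?Ehigh ?leq_addr //.
        by rewrite ler_wiXn2l ?cabs_ge0 ?(ltW z1) // leq_addr.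
      by rewrite /y exprMn; set t := x^-1 ^+ M; set t' := cabs z ^+ M; rewrite -!mulrA [t * t']mulrC.
    rewrite sumr_const card_ord -[leLHS]mulr_natr mulrAC -/W.
    apply: le_trans (_ : W * (e / 2 / (W + 1)) <= _); first by rewrite ler_wpM2l // HN1.
    by rewrite mulrCA ler_piMr ?divr_ge0 ?(ltW e0) // ler_pdivrMr ?mul1r ?lerDl ?ltr_wpDl.
  by move=> i _; rewrite coef_map /= Elow ?rmorph0 ?mul0r.
have Pl := HN2 M le_2M; set P := cpseries _ _ M in Ez Pl.
have -> : Q.[z] * l - (map_poly f p).[z] = (map_poly f E).[z] - Q.[z] * (P - l).
  by rewrite Ez; ring.
apply: le_trans (ler_cabsB _ _) _.
have H : cabs (Q.[z] * (P - l)) <= e / 2.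
  rewrite cabsM; apply: le_trans (_ : cabs Q.[z] * (e / 2 / (cabs Q.[z] + 1)) <= _).
    by rewrite ler_wpM2l ?cabs_ge0.
  by rewrite mulrCA ler_piMr ?divr_ge0 ?(ltW e0) // ler_pdivrMr ?mul1r ?lerDl ?ltr_wpDl ?cabs_ge0.
lra.
Qed.

(** Supplies the last hypothesis of [fatou]. With [x] the [2 ^ k]-th root of 2 and [M = k v + 1],
    the inequality [x ^ (v + M) <= 2 ^ v.+1] leaves a factor [x ^ v] to absorb the constant in
    [u M <= A * x ^ M]. *)
Lemma subexp_lt_pow2 (u : nat -> R) k : (forall n, 0 <= u n) -> subexp u ->
  exists M v, (k * v < M)%N /\ u M < 2 ^+ v.+1.
Proof.
move=> u0 u_sub; have [x x1 xE] := exists_root_gt1 k (ltr1n R 2 : 1 < 2 :> R).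
have [A HA] := u_sub x x1.
have x0 : 0 < x by rewrite (lt_trans ltr01).
have xV0 : 0 <= x^-1 by rewrite invr_ge0 ltW.
have xV1 : x^-1 < 1 by rewrite invf_lt1.
have e0 : 0 < (`|A| + 1)^-1 by rewrite invr_gt0 ltr_wpDl.
have [v HN] := expr_eventually_le xV0 xV1 e0.
exists (k * v).+1, v; split => //; apply: le_lt_trans (HA _) _.
apply: lt_le_trans (_ : x ^+ (v + (k * v).+1) <= _).
  rewrite exprD ltr_pM2r ?exprn_gt0 //; apply: le_lt_trans (ler_norm A) _.
  have := HN v (leqnn v); rewrite exprVn lef_pV2 ?posrE ?exprn_gt0 ?ltr_wpDl //.
  by apply: lt_le_trans; rewrite ltrDl.
rewrite -xE -exprM ler_weXn2l ?(ltW x1) //.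
have lt_k : (k < 2 ^ k)%N := ltn_expl k (isT : (1 < 2)%N).
rewrite mulnS addnS -mulSn -add1n; apply: leq_add; last by rewrite leq_mul2r lt_k orbT.
by rewrite expn_gt0.
Qed.

End Rational.

Lemma exact_lowest_terms (F : fieldType) (a : nat -> F) (q p : {poly F}) :
  q`_0 = 1 -> exact q p a ->
  exists q1 p1 : {poly F}, [/\ q1`_0 != 0, coprimep q1 p1 & exact q1 p1 a].
Proof.
move=> q01 qpa; pose g := gcdp q p; exists (q %/ g), (p %/ g).
have qE : q = q %/ g * g by rewrite divpK // dvdp_gcdl.
have pE : p = p %/ g * g by rewrite divpK // dvdp_gcdr.
have : (q %/ g)`_0 * g`_0 != 0.
  by rewrite -!horner_coef0 -hornerM -qE horner_coef0 q01 oner_eq0.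
rewrite mulf_eq0 negb_or => /andP[q10 g0]; split => //.
  apply: coprimep_div_gcd; rewrite -!size_poly_gt0.
  by rewrite size_poly_gt0; apply/orP; left; apply: contra_eq_neq q01 => ->; rewrite coef0 eq_sym oner_eq0.
move=> M; rewrite /pade -(Gauss_dvdpr _ (coprimeXn M g0)).
have -> : g * (q %/ g * partial_sum M a - p %/ g) = q * partial_sum M a - p.
  by rewrite mulrBr mulrA ![g * _]mulrC -qE -pE.
exact: qpa.
Qed.

Lemma dvdp_prod_sub (F : fieldType) (I : finType) (m c : {poly F}) (P : I -> {poly F}) :
  (forall i, m %| P i - c) -> m %| \prod_i P i - c ^+ #|I|.
Proof.
move=> mP; rewrite -[#|I|]/(#|I|) -prodr_const.
elim/big_rec2: _ => [|i x y _ myx]; first by rewrite subrr dvdp0.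
have -> : P i * y - c * x = P i * (y - x) + (P i - c) * x by ring.
by apply: dvdp_add; [apply: dvdp_mull | apply: dvdp_mulr].
Qed.

Section RationalConclusion.
Variables (R : realType) (K : fieldExtType rat).
Local Notation C := (CC R).
Variables (d : nat) (sigma : 'I_d -> {rmorphism K -> C}) (emb : {rmorphism K -> C}).
Hypothesis sigma_norm : forall g : {poly K}, exists G : {poly rat},
  map_poly ratr G = \prod_i map_poly (sigma i) g.
Variable i0 : 'I_d.
Hypothesis emb_sigma : emb =1 sigma i0.
Variables (a : nat -> K) (D : nat -> nat).
Hypothesis a_cvg : forall (f : {rmorphism K -> C}) (z : C),
  `|z| < 1 -> cvgn (cpseries (fun n => f (a n)) z).
Hypothesis D_gt0 : forall n, (0 < D n)%N.
Hypothesis D_int : forall n k, (k < n)%N -> algebraic_integer ((D n)%:R * a k).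
Hypothesis D_subexp : subexp (fun n => (D n)%:R : R).
Variables (q p : {poly K}).
Hypothesis q0 : q`_0 != 0.
Hypothesis qp_coprime : coprimep q p.
Hypothesis q_exact : exact q p a.

Lemma disk_eval (f : {rmorphism K -> C}) (z : C) : `|z| < 1 ->
  exists2 l, cpseries (fun n => f (a n)) z n @[n --> \oo] --> l &
    (map_poly f q).[z] * l = (map_poly f p).[z].
Proof.
move=> z1; have /cvg_ex[l al] := @a_cvg f z z1; exists l => //.
apply: (exact_eval _ q_exact _ al); first exact: cvg_disk_bounded (@a_cvg f).
by rewrite -ltr_cabs (rmorph1 (@rc R)).
Qed.

(** At a root of the denominator the convergent series would force the numerator to vanish too,
    against coprimality. Convergence under every embedding makes this available for all conjugates
    of [q]. *)
Lemma disk_no_root (f : {rmorphism K -> C}) (z : C) : `|z| < 1 -> ~~ root (map_poly f q) z.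
Proof.
move=> z1; have [l _ ql] := disk_eval f z1; apply/negP => qz.
have : coprimep (map_poly f q) (map_poly f p) by rewrite coprimep_map.
move/coprimep_root/(_ qz); rewrite -ql; move/rootP: qz => ->.
by rewrite mul0r eqxx.
Qed.

Lemma norm_primitive (g : {poly K}) : g != 0 -> exists (Q : {poly int}) (x y : int),
  [/\ zcontents Q = 1, x != 0, y != 0 &
      y%:~R *: \prod_i map_poly (sigma i) g = x%:~R *: map_poly intr Q].
Proof.
move=> g0; have [G GE] := sigma_norm g; have [Q [y y0 QE]] := rat_poly_scale G.
have Q0 : Q != 0.
  have : map_poly ratr G != 0 :> {poly C}.
    by rewrite GE; apply/prodf_neq0 => i _; rewrite map_poly_eq0.
  by apply: contraNneq => Q0; rewrite QE Q0 !rmorph0 scaler0 rmorph0.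
exists (zprimitive Q), (zcontents Q), y; split => //.
- by rewrite zcontents_primitive Q0.
- by rewrite zcontents_eq0.
rewrite -GE QE; apply/polyP => i; rewrite !coefZ !coef_map /= coefZ coef_map /=.
rewrite -intrM -coefZ -zpolyEprim (rmorphM (ratr : rat -> C)) /= fmorphV /= !ratr_int.
by rewrite mulrA divff ?mul1r // intr_eq0.
Qed.

(* With [u * p + v * q = 1], the truncations of [u * f + v], once cleared of
   denominators, invert [q] modulo powers of ['X] at subexponential cost: the
   situation of [fatou] after taking norms. *)
Lemma norm_fatou (Q : {poly int}) (x y : int) :
  zcontents Q = 1 -> x != 0 -> y != 0 ->
  y%:~R *: \prod_i map_poly (sigma i) q = x%:~R *: map_poly intr Q ->
  absz Q`_0 = 1%N.
Proof.
move=> Q_prim x0 y0 QE.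
have /Bezout_eq1_coprimepP[[u v] /= uv] := qp_coprime.
have [cu cu0 cuP] := poly_common_den v; have [cv cv0 cvP] := poly_common_den u.
pose E M := (cu * cv * D M)%N; have E0 M : (0 < E M)%N by rewrite !muln_gt0 cu0 cv0 D_gt0.
pose e M := (E M)%:R *: (v * partial_sum M a + u).
have e_int M : integral_coefs (e M).
  move=> i; rewrite coefZ coefD mulrDr; apply: integral_add; last first.
    by apply: integral_dvdn (cvP i); rewrite /E mulnAC dvdn_mull.
  rewrite coefM mulr_sumr; apply: integral_sum => -[j lt_j] _ /=.
  rewrite coef_partial_sum; case: ifP => [lt_M|_]; last by rewrite !mulr0; apply: mxpoly.integral0.
  rewrite /E mulnAC mulnC !natrM -!mulrA; apply: integral_natmul.
  have -> : cu%:R * ((D M)%:R * (v`_j * a (i - j)%N)) =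
    (cu%:R * v`_j) * ((D M)%:R * a (i - j)%N) by ring.
  by apply: integral_mul; [apply: cuP | apply: D_int].
have e_inv M : 'X^M %| q * e M - (E M)%:R%:P.
  have -> : q * e M - (E M)%:R%:P = ((E M)%:R%:P * v) * (q * partial_sum M a - p).
    rewrite /e -mul_polyC -[X in _ - X]mulr1 -uv; ring.
  by apply: dvdp_mull; apply: q_exact.
pose D' M := (absz y * E M ^ d)%N.
apply: (@fatou Q D') => // [M|M|k].
- by rewrite /D' muln_gt0 absz_gt0 y0 expn_gt0 E0.
- have [G GE] := norm_integral_poly sigma_norm (e_int M).
  (* [y] may be negative while [D'] is a natural number, so the sign is moved into the cofactor. *)
  exists ((Num.sg y * x) *: G) => i lt_iM.
  rewrite -scalerAr coefZ; apply: (@intr_inj C).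
  rewrite -mulrA rmorphM /= [(x * _)%:~R]rmorphM /=.
  have -> : x%:~R * ((Q * G)`_i)%:~R = y%:~R * (\prod_i map_poly (sigma i) (q * e M))`_i :> C.
    rewrite -[((Q * G)`_i)%:~R]coef_map rmorphM /= GE -!coefZ; congr (_`_i).
    rewrite scalerAl -QE -scalerAl -big_split /=.
    by under [in RHS]eq_bigr => j _ do rewrite rmorphM /=.
  have : 'X^M %| \prod_i map_poly (sigma i) (q * e M) - ((E M)%:R%:P) ^+ #|'I_d|.
    apply: dvdp_prod_sub => j; have := e_inv M.
    rewrite -(dvdp_map (sigma j)) /= map_polyXn rmorphB /= map_polyC /=.
    by rewrite rmorph_nat.
  move/dvdXnP => /(_ i lt_iM); rewrite coefB => /eqP; rewrite subr_eq0 => /eqP ->.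
  rewrite card_ord -rmorphXn /= coefC; case: ifP => _; last by rewrite !mulr0.
  rewrite mulrA -intrM -normrEsg -abszE /D' PoszM intrM -natrX.
  by rewrite -pmulrn.
have D'_sub : subexp (fun M => (D' M)%:R : R).
  apply: (@subexp_le _ _ (fun M => (absz y)%:R * ((cu * cv)%:R * (D M)%:R) ^+ d)) => [M|].
    by rewrite -natrM -natrX -natrM.
  apply: subexpM => [n|n||]; rewrite ?exprn_ge0 ?mulr_ge0 //; first exact: subexp_cst.
  apply: subexpX => [n|]; first by rewrite mulr_ge0.
  by apply: subexpM => //; apply: subexp_cst.
have [M [v0 [ltM]]] := subexp_lt_pow2 k (fun n => ler0n R (D' n)) D'_sub.
by rewrite -natrX ltr_nat => lt_v; exists M, v0.
Qed.

Lemma rational_conclusion : rational_with_root_of_unity_poles (fun n => emb (a n)).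
Proof.
have qn0 : q != 0 by apply: contraNneq q0 => ->; rewrite coef0.
have [Q [x [y [Q_prim x0 y0 QE]]]] := norm_primitive qn0.
have Q01 := norm_fatou Q_prim x0 y0 QE.
have rootQ (z : C) : reflect (exists2 i, true & (map_poly (sigma i) q).[z] == 0)
    (root (map_poly intr Q) z).
  rewrite -(rootZ _ _ (_ : x%:~R != 0)) ?intr_eq0 // -QE rootZ ?intr_eq0 //.
  by rewrite rootE horner_prod; apply: prodf_eq0.
have Q_ge1 : @roots_ge1 C Q.
  move=> z /rootQ[i _ qz].
  rewrite cabsE -(rmorph1 (@rc R)) ler_rc leNgt -ltr_cabs (rmorph1 (@rc R)).
  by apply: contraL qz; apply: disk_no_root.
exists (map_poly emb p), (map_poly emb q); split.
- by rewrite map_poly_eq0.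
- by rewrite coprimep_sym coprimep_map.
- move=> w qw; have [|n n0 wn] := @kronecker C Q w Q01 Q_ge1.
    by apply/rootQ; exists i0; rewrite // -(eq_map_poly emb_sigma).
  by exists n => //; apply/unity_rootP.
move=> z z1; have [l al ql] := disk_eval emb z1.
have qz := disk_no_root emb z1.
suff -> : (map_poly emb p).[z] / (map_poly emb q).[z] = l by [].
by rewrite -ql mulrAC divff ?mul1r.
Qed.

End RationalConclusion.

(** * The denominator hypotheses and the assembly of the proof *)

Section SubexponentialDenominators.
Variables (R : realType) (K : fieldExtType rat).

Lemma subexp_den_on (S : set nat) (a : nat -> K) (e : nat -> R) :
  e =o_\oo (fun n : nat => n%:R : R) ->
  (forall n : nat, S n -> (den (a n))%:R = expR (e n)) ->
  subexp (fun n => if n \in S then (den (a n))%:R else 0 : R).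
Proof.
move=> e_small den_e; apply: near_subexp => q q1.
have lnq : 0 < ln q by rewrite ln_gt0.
have /eqoP/(_ (ln q) lnq) [N _ HN] := e_small.
exists N => // n /= le_Nn; have q0 : 0 < q by rewrite (lt_trans ltr01).
case: ifP => [/set_mem Sn|_]; last by rewrite exprn_ge0 // ltW.
rewrite den_e // -[q]lnK ?posrE // -expRM_natl ler_expR mulrC.
by apply: le_trans (ler_norm _) _; have := HN n le_Nn; rewrite /= [`|n%:R|]ger0_norm.
Qed.

Lemma subexp_count_base (S : pred nat) (c : R) : 1 <= c ->
  subexp (fun n => (c * n%:R) ^+ count_below S n) -> subexp (fun n => c ^+ count_below S n).
Proof.
move=> c1; apply: subexp_le => n; case: n => [|n].
  by rewrite /count_below big_geq.
have c0 : 0 <= c by rewrite (le_trans ler01).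
by rewrite lerXn2r ?nnegrE ?mulr_ge0 // ler_peMr // ler1n.
Qed.

Lemma count_below_pred0 n : count_below pred0 n = 0%N.
Proof. by rewrite /count_below big_pred0. Qed.

Lemma eqr_nat_number_field (i j : nat) : (i%:R == j%:R :> K) = (i == j).
Proof. by rewrite -!(rmorph_nat (in_alg K)) (inj_eq (fmorph_inj (in_alg K))) eqr_nat. Qed.

Lemma lcm_den_int (S : pred nat) (a : nat -> K) n k : (k < n)%N -> S k ->
  algebraic_integer ((\big[lcmn/1%N]_(0 <= k < n | S k) den (a k))%:R * a k).
Proof.
move=> lt_kn Sk; apply: integral_dvdn (den_int _).
by rewrite big_mkord (bigD1 (Ordinal lt_kn)) //= dvdn_lcml.
Qed.

Lemma lcm_den_gt0 (S : pred nat) (a : nat -> K) n :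
  (0 < \big[lcmn/1%N]_(0 <= k < n | S k) den (a k))%N.
Proof.
elim/big_ind: _ => // [x y x0 y0|k _]; last exact: den_gt0.
by rewrite lcmn_gt0 x0.
Qed.

End SubexponentialDenominators.

Theorem theorem1p6 (R : realType) (S : set nat)
  (S_pos : forall n : nat, S n -> (0 < n)%N)
  (S_small : (fun n : nat => (\sum_(1 <= k < n.+1 | k \in S) 1)%N%:R : R) =o_\oo
             (fun n : nat => n%:R / ln n%:R : R))
  (K : fieldExtType rat) (emb : {rmorphism K -> CC R}) (a : nat -> K)
  (a_cvg : forall (sigma : {rmorphism K -> CC R}) (z : CC R),
     `|z| < 1 -> cvgn (cpseries (fun n => sigma (a n)) z))
  (den_notin_S : forall beta : R, 1 < beta ->
     \forall n \near \oo,
       (\big[lcmn/1%N]_(0 <= k < n.+1 | k \notin S) den (a k))%:R < beta ^+ n)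
  (den_in_S : exists2 e : nat -> R,
     e =o_\oo (fun n : nat => n%:R : R) &
     forall n : nat, S n -> (den (a n))%:R = expR (e n)) :
  unit_circle_natural_boundary (fun n => emb (a n)) \/
  rational_with_root_of_unity_poles (fun n => emb (a n)).
Proof.
have [nb|] := pselect (unit_circle_natural_boundary (fun n => emb (a n))); first by left.
move/existsNP => [w /not_implyP[w1 /contrapT w_cont]]; right.
have [d [sigma [cover sigma_norm]]] := number_field_embeddings K (CC R).
have [i0 emb_sigma] := cover emb.
have [kappa [A [B [kappa1 A0 B1 emb_bound]]]] := hankel_analytic_bound w1 (@a_cvg emb) w_cont.
have a_bound i : subexp (fun n => cabs (sigma i (a n))).
  by apply: subexp_disk => x x01; apply: (cvg_disk_bounded (@a_cvg (sigma i))).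
pose T : pred nat := fun k => k \in S.
have T_count c c1 := @subexp_count R S c S_pos S_small c1.
pose D n := (\big[lcmn/1%N]_(0 <= k < n.+1 | k \notin S) den (a k))%N.
have D_gt0 n : (0 < D n)%N by apply: lcm_den_gt0.
have D_int n k : (k < n)%N -> ~~ T k -> algebraic_integer ((D n)%:R * a k).
  by move=> lt_kn; apply: lcm_den_int; apply: ltnW.
have D_sub : subexp (fun n => (D n)%:R : R).
  apply: near_subexp => q q1; have [N _ HN] := den_notin_S q q1.
  by exists N => // n /HN /= /ltW.
have [e e_small den_e] := den_in_S.
(* The sum dominates each single denominator from [S] and is still subexponential; the successor
   keeps it positive when [S] has no element below [n]. *)
pose E n := (\sum_(k < n | T k) den (a k)).+1.
have E_sub : subexp (fun n => (E n)%:R : R).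
  pose u n : R := if n \in S then (den (a n))%:R else 0.
  have u0 n : 0 <= u n by rewrite /u; case: ifP.
  apply: (@subexp_le _ _ (fun n => 1 + \sum_(k < n) u k)) => [n|].
    by rewrite /E -natr1 addrC natr_sum big_mkcond.
  apply: subexpD => // [n||]; first exact: sumr_ge0.
    exact: subexp_cst.
  by apply: subexp_partial_sum => //; apply: subexp_den_on e_small den_e.
have E_int n k : (k < n)%N -> T k ->
    exists e, [/\ (0 < e)%N, (e <= E n)%N & algebraic_integer (e%:R * a k)].
  move=> lt_kn Tk; exists (den (a k)); split; [exact: den_gt0 | | exact: den_int].
  by rewrite /E (bigD1 (Ordinal lt_kn)) //= leqW // leq_addr.
have [n0 vanish] := hankel_vanishing sigma_norm emb_sigma kappa1 A0 B1 emb_bound a_bound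
  T_count D_gt0 D_int D_sub (fun n => isT : (0 < E n)%N) E_int E_sub.
have [N [q [p [q0 q_exact]]]] := exact_of_vanishing (@eqr_nat_number_field K) vanish.
have [D' [D'_gt0 D'_int D'_sub]] := common_denominators q0 q_exact D_gt0 D_int D_sub
  (T_count 1 (lexx 1)) (fun c c1 => subexp_count_base c1 (T_count c c1)).
(* Second round: [D'] clears every index, so no index has to be killed, the weight is 1, and the
   same analytic bound applies. *)
have no_count (c : R) : 1 <= c -> subexp (fun n => (c * n%:R) ^+ count_below pred0 n).
  move=> _; apply: (subexp_le _ (subexp_cst 1)) => n.
  by rewrite count_below_pred0.
have [n1 vanish'] := @hankel_vanishing R K d sigma emb sigma_norm i0 emb_sigma
  a pred0 D' (fun=> 1%N) kappa A B kappa1 A0 B1 emb_bound a_bound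
  no_count D'_gt0 (fun n k lt_kn _ => D'_int n k lt_kn) D'_sub (fun=> isT)
  (fun n k _ (k0 : pred0 k) => False_ind _ (notF k0)) (subexp_cst 1).
have [N' [q' [p' [q'0 q'_exact]]]] := exact_of_vanishing (@eqr_nat_number_field K) vanish'.
have wa : (fun k => weight K pred0 N' k * a k) = a.
  by apply/funext => k; rewrite /weight big_pred0 // mul1r.
rewrite wa in q'_exact.
have [q1 [p1 [q10 qp1 q1_exact]]] := exact_lowest_terms q'0 q'_exact.
exact: (rational_conclusion sigma_norm emb_sigma a_cvg D'_gt0 D'_int D'_sub q10 qp1 q1_exact).
Qed.
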